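(* Let $V$ be a finite dimensional Jordan algebra (a JB-algebra) with positive cone $\Omega$, and consider any symmetric gauge norm $\|\cdot\|_\phi$ in $V$. Then the geodesics $\alpha(t)=U_{p^{1/2}}\exp(t\,U_{p^{-1/2}}v)$, $t\in[0,1]$ ($p\in\Omega$, $v\in V$), of the symmetric space connection of $\Omega$ are minimizing, i.e. $$\mathrm{Length}_\phi(\alpha)=\|U_{p^{-1/2}}v\|_\phi=\mathrm{dist}_\phi(\alpha(0),\alpha(1)).$$ Moreover, if the symmetric gauge norm is strictly convex, then geodesics are the unique minimizing paths.
   Context: A JB-algebra is a real Banach space $V$ with a bilinear commutative product $\circ$ and unit $1$ such that $x^2\circ(x\circ y)=x\circ(x^2\circ y)$, $\|x\circ y\|\le\|x\|\|y\|$, $\|x^2\|=\|x\|^2$ and $\|x^2\|\le\|x^2+y^2\|$. $L_xy=x\circ y$, $U_x=2L_x^2-L_{x^2}$. The spectrum of $x$ is the set of $\lambda\in\mathbb R$ with $x-\lambda1$ not invertible; $\Omega$ is the set of $x$ with spectrum in $(0,\infty)$, an open convex cone, so $T_p\Omega\simeq V$. Powers $p^{\pm1/2}$ of $p\in\Omega$ and $\exp$ are taken by functional calculus. The symmetric space connection of $\Omega$ is the one given by the symmetric product $\mu(x,y)=U_x(y^{-1})$; its geodesics are the solutions in $\Omega$ of $\alpha''=U_{\alpha'}(\alpha^{-1})$, and the one with $\alpha(0)=p$, $\alpha'(0)=v$ is the path $\alpha$ in the claim. Eigenvalues with multiplicity: every $x\in V$ can be written $x=\sum_{i=1}^n\lambda_ic_i$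 with $c_1,\dots,c_n$ a complete system of orthogonal primitive idempotents ($n$ the rank of $V$); the $\lambda_i$ are the eigenvalues of $x$ counted with multiplicity. Let $s_1(x)\ge\dots\ge s_n(x)\ge0$ be the numbers $|\lambda_i|$ in decreasing order. A symmetric gauge function is a norm $\phi$ on $\mathbb R^n$ invariant under permutations and sign changes of the coordinates; the associated symmetric gauge norm is $\|x\|_\phi=\phi(s_1(x),\dots,s_n(x))$, a norm on $V$. The Finsler norm is $|v|_p=\|U_{p^{-1/2}}v\|_\phi$ for $p\in\Omega$, $v\in T_p\Omega\simeq V$. $\mathrm{Length}_\phi(\gamma)=\int_a^b|\gamma'(t)|_{\gamma(t)}\,dt$ for piecewise $C^1$ paths $\gamma:[a,b]\to\Omega$, and $\mathrm{dist}_\phi(p,q)$ is the infimum of the lengths of piecewise $C^1$ paths in $\Omega$ joining $p$ and $q$. A path is minimizing if its length equals the distance between its endpoints. *)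

(* Defs.v *)
From HB Require Import structures.
From mathcomp Require Import all_boot all_order all_algebra perm.
From mathcomp Require Import all_classical all_reals all_analysis.

Set Implicit Arguments.
Unset Strict Implicit.
Unset Printing Implicit Defensive.

Import Order.TTheory GRing.Theory Num.Theory.
Import numFieldNormedType.Exports.

Local Open Scope classical_set_scope.
Local Open Scope ring_scope.

(* Unital JB-algebras; the norm is the one of the normed module structure.
   Linearity in the second argument follows from commutativity. *)
HB.mixin Record CompleteNormedModule_isJB (R : realType) V
    of CompleteNormedModule R V := {
  jmul : V -> V -> V;
  jone : V;
  jmulDZl : forall (a : R) (x y z : V),
    jmul (a *: x + y) z = a *: jmul x z + jmul y z;
  jmulC : forall x y : V, jmul x y = jmul y x;
  jmul1 : forall x : V, jmul jone x = x;
  jordan_id : forall x y : V,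
    jmul (jmul x x) (jmul x y) = jmul x (jmul (jmul x x) y);
  normJM : forall x y : V, `|jmul x y| <= `|x| * `|y|;
  normJ2 : forall x : V, `|jmul x x| = `|x| ^+ 2;
  normJ2D : forall x y : V, `|jmul x x| <= `|jmul x x + jmul y y|
}.

#[short(type="jbAlgType")]
HB.structure Definition JBAlgebra (R : realType) :=
  {V of CompleteNormedModule_isJB R V & CompleteNormedModule R V}.

Arguments jone {R V} : rename.

Notation "x *j y" := (jmul x y)
  (at level 40, left associativity, format "x  *j  y") : ring_scope.

Section JBTheory.
Context {R : realType} {V : jbAlgType R}.
Implicit Types (x y p q v c : V) (g : R -> V) (a b t : R).

Definition jL x y : V := x *j y.

Definition jU x y : V := 2 *: jL x (jL x y) - jL (x *j x) y.

Definition is_jinv x y : Prop := x *j y = jone /\ (x *j x) *j y = x.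

(* Jordan inverses are unique when they exist; 0 is a default value. *)
Definition jinv x : V := xget 0 [set y | is_jinv x y].

Definition jspectrum x : set R :=
  [set l | ~ exists y, is_jinv (x - l *: jone) y].

Definition jcone : set V := [set x | jspectrum x `<=` [set l | 0 < l]].

Definition jidempotent c : Prop := c *j c = c.

Definition jprimitive c : Prop :=
  [/\ jidempotent c, c != 0 &
    ~ exists c1 c2, [/\ jidempotent c1, jidempotent c2, c1 != 0, c2 != 0 &
                        c1 *j c2 = 0 /\ c = c1 + c2]].

Definition complete_orthogonal_idempotents n (c : 'I_n -> V) : Prop :=
  [/\ forall i, jidempotent (c i),
      forall i j, i != j -> c i *j c j = 0 &
      \sum_(i < n) c i = jone].

Definition jordan_frame n (c : 'I_n -> V) : Prop :=
  complete_orthogonal_idempotents c /\ forall i, jprimitive (c i).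

(* f(x) = sum_i f(l_i) c_i for any spectral resolution x = sum_i l_i c_i:
   in finite dimension this is the continuous functional calculus, and the
   value does not depend on the resolution. *)
Definition jfun (f : R -> R) x : V :=
  xget 0 [set y | exists m (c : 'I_m -> V) (l : 'I_m -> R),
    [/\ complete_orthogonal_idempotents c,
        x = \sum_(i < m) l i *: c i &
        y = \sum_(i < m) f (l i) *: c i]].

Definition jpow x (r : R) : V := jfun (fun s => s `^ r) x.

Definition jexp x : V := jfun expR x.

(* The n eigenvalues of x counted with multiplicity, in an unspecified order
   (n is the rank); they do not depend on the Jordan frame up to
   permutation. *)
Definition jeigenvalues n x : 'rV[R]_n :=
  xget 0 [set l : 'rV[R]_n | exists c : 'I_n -> V,
    jordan_frame c /\ x = \sum_(i < n) l ord0 i *: c i].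

Definition jsingular_values n x : 'rV[R]_n :=
  \row_(i < n) nth (0 : R)
    (sort (fun s t : R => t <= s) [seq (`|jeigenvalues n x ord0 j| : R) | j <- enum 'I_n]) i.

Definition gauge_norm n (phi : 'rV[R]_n -> R) x : R :=
  phi (jsingular_values n x).

Definition finsler_norm n (phi : 'rV[R]_n -> R) p v : R :=
  gauge_norm phi (jU (jpow p (- 2^-1)) v).

Definition C1_on a b g : Prop :=
  exists d : R -> V, {within `[a, b], continuous d} /\
    forall t, t \in `]a, b[ -> is_derive t 1 g (d t).

(* Continuity of g on [a, b] and of d on the closed pieces makes d the
   (one-sided at the ends) derivative of g on each closed piece. *)
Definition piecewise_C1 a b g : Prop :=
  {within `[a, b], continuous g} /\
  exists s : seq R, itv_partition a b s /\
    forall i, (i < size s)%N -> C1_on (nth b (a :: s) i) (nth b s i) g.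

Definition jpath a b g : Prop :=
  [/\ a < b, forall t, t \in `[a, b] -> jcone (g t) & piecewise_C1 a b g].

(* The finitely many points where derive1 g is not meaningful do not contribute
   to the integral. *)
Definition jlength n (phi : 'rV[R]_n -> R) a b g : \bar R :=
  (\int[lebesgue_measure]_(t in `[a, b])
     (finsler_norm phi (g t) (derive1 g t))%:E)%E.

Definition jdist n (phi : 'rV[R]_n -> R) p q : \bar R :=
  ereal_inf [set l | exists a b g,
    [/\ jpath a b g, g a = p, g b = q & l = jlength phi a b g]].

Definition minimizing n (phi : 'rV[R]_n -> R) a b g : Prop :=
  jpath a b g /\ jlength phi a b g = jdist phi (g a) (g b).

(* Geodesic equation of the connection given by the symmetric product
   mu(x, y) = U_x (y^-1). *)
Definition symmetric_space_geodesic g : Prop :=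
  forall t, [/\ jcone (g t), derivable g t 1, derivable (derive1 g) t 1 &
                derive1 (derive1 g) t = jU (derive1 g t) (jinv (g t))].

Definition geodesic_path p v t : V :=
  jU (jpow p 2^-1) (jexp (t *: jU (jpow p (- 2^-1)) v)).

(* g on [a, b] is h on [0, 1] up to a monotone reparametrization; injectivity
   of the reparametrization is not required, since g may pause. *)
Definition reparametrizes a b g (h : R -> V) : Prop :=
  exists tau : R -> R,
    [/\ {within `[a, b], continuous tau},
        {in `[a, b] &, {homo tau : s t / s <= t}},
        tau a = 0, tau b = 1 &
        forall t, t \in `[a, b] -> g t = h (tau t)].

End JBTheory.

Definition finite_dimensional {R : realType} (V : normedModType R) : Prop :=
  exists (m : nat) (e : 'I_m -> V),
    forall x, exists l : 'I_m -> R, x = \sum_(i < m) l i *: e i.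

(* All Jordan frames of a finite dimensional JB-algebra have the same number
   of elements. *)
Definition jrank_is {R : realType} (V : jbAlgType R) (n : nat) : Prop :=
  exists c : 'I_n -> V, jordan_frame c.

Definition symmetric_gauge {R : realType} n (phi : 'rV[R]_n -> R) : Prop :=
  [/\ forall x y : 'rV[R]_n, phi (x + y) <= phi x + phi y,
      forall (a : R) (x : 'rV[R]_n), phi (a *: x) = `|a| * phi x,
      forall x : 'rV[R]_n, phi x = 0 -> x = 0,
      forall (s : 'S_n) (x : 'rV[R]_n), phi (col_perm s x) = phi x &
      forall (e : 'I_n -> bool) (x : 'rV[R]_n),
        phi (\row_(i < n) ((-1) ^+ e i * x ord0 i)) = phi x].

Definition strictly_convex_norm {R : realType} {V : lmodType R}
    (N : V -> R) : Prop :=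
  forall x y, N x = 1 -> N y = 1 -> x <> y -> N (x + y) < 2.

(* Main.v *)
Require Import Defs.
From mathcomp Require Import all_boot all_order all_algebra perm.
From mathcomp Require Import all_classical all_reals all_analysis.
From mathcomp Require Import measurable_realfun complex ring lra.

Set Implicit Arguments.
Unset Strict Implicit.
Unset Printing Implicit Defensive.

Import Order.TTheory GRing.Theory Num.Theory.
Import numFieldNormedType.Exports.

Local Open Scope classical_set_scope.
Local Open Scope ring_scope.

(** The geodesics minimize because the distance from a fixed point grows along
    any path at most as fast as the path runs, and this is a first order
    estimate on logarithms.

    Its algebraic source is the fundamental formula [U_(U_z x) = U_z U_x U_z]
    ([jU_jU]), which follows from the weights of the Peirce components. It has
    two consequences. First, [U_a] is an isometry of the Finsler structure for
    the relevant [a], since [U_((U_a p)^(-1/2)) U_a U_(p^(1/2))] fixes the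
    identity and therefore is an automorphism ([jU3_automorphism], [isqrt_jU]).
    Second, if [c] is a primitive idempotent then [U_c v = w_c(v) c] defines a
    state [w_c] ([jstate]), and [w_c(d) = w_d(c)] ([jstateC]); so two frames are
    related by a doubly stochastic matrix. Hence the rank and the multiplicities
    of the eigenvalues do not depend on the frame, the values of [x] at the
    states of a frame have gauge at most [|x|_phi] (Schur: [gauge_norm_state],
    [gauge_doubly_stochastic]), and [|.|_phi] is a norm.

    Let [d(p, q)] be the gauge norm of [log (U_(p^(-1/2)) q)] ([geod_dist]), the
    length of the geodesic from [p] to [q]. The inequality [log s <= s - 1],
    averaged by the states of the frame of [log q], shows that
    [d(p0, q) - d(p0, p)] is at most the Finsler norm of [q - p] at [q] up to
    a quadratic error ([gauge_norm_log_lip], [geod_dist_lip]). So the left slope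
    of [d(p0, .)] along a path is at most the speed ([geod_dist_left_slope]), and
    integration bounds the length below by [d] ([dist_growth_path]); a geodesic
    has constant speed and attains the bound ([jdistE]).

    For uniqueness, a point [z] of a minimizing path from [p] to [q] satisfies
    [d(p, z) + d(z, q) = d(p, q)]. Move [z] to the identity by an isometry and
    let [Y], [Z] be the logarithms of the end points. The triangle inequality,
    applied to the points [exp(t Y)] and [exp(t Z)], gives
    [d(exp(t Y), exp(t Z)) >= t (|Y| + |Z|)] for small [t], whereas the left hand
    side is at most [t |Z - Y|] up to a smaller order. Thus
    [|Z - Y| >= |Y| + |Z|], strict convexity makes [Y] and [Z] antiparallel, and
    [z] lies on the geodesic ([geod_dist_between]), at the parameter given by its
    distance to [p]. *)

(** * Linear identities in modules *)

Section LinearExpressions.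
Context {R : comNzRingType} {V : lmodType R}.

(** Syntax of linear combinations: the reflection behind [lmod], which reduces
    an identity in a module to identities between scalars. *)
Inductive lexpr : Type :=
  | LAtom of nat
  | LZero
  | LAdd of lexpr & lexpr
  | LOpp of lexpr
  | LScale of R & lexpr
  | LMuln of lexpr & nat.

Fixpoint leval (env : seq V) (e : lexpr) : V :=
  match e with
  | LAtom i => nth 0 env i
  | LZero => 0
  | LAdd e1 e2 => leval env e1 + leval env e2
  | LOpp e1 => - leval env e1
  | LScale a e1 => a *: leval env e1
  | LMuln e1 n => leval env e1 *+ n
  end.

Fixpoint lcoef (e : lexpr) (i : nat) : R :=
  match e with
  | LAtom j => if eqn i j then 1 else 0
  | LZero => 0
  | LAdd e1 e2 => lcoef e1 i + lcoef e2 i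
  | LOpp e1 => - lcoef e1 i
  | LScale a e1 => a * lcoef e1 i
  | LMuln e1 n => lcoef e1 i *+ n
  end.

Fixpoint all_below (n : nat) (P : nat -> Prop) : Prop :=
  match n with 0 => True | m.+1 => P m /\ all_below m P end.

Lemma leval_coef env e :
  leval env e = \sum_(i < size env) lcoef e i *: env`_i.
Proof.
elim: e => [j||e1 IH1 e2 IH2|e1 IH1|a e1 IH1|e1 IH1 n] /=.
- have [jlt|jge] := ltnP j (size env); last first.
    rewrite nth_default// big1// => i _; change (eqn i j) with (i == j :> nat).
    case: eqP => [ij|_].
      by move: jge; rewrite -ij leqNgt ltn_ord.
    by rewrite scale0r.
  rewrite (bigD1 (Ordinal jlt))//= -[eqn j j]/(j == j) eqxx scale1r big1 ?addr0// => i ij.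
  change (eqn i j) with (i == j :> nat); case: eqP => [ij0|_]; last by rewrite scale0r.
  by move: ij; rewrite -val_eqE /= ij0 eqxx.
- by rewrite big1// => i _; rewrite scale0r.
- by rewrite IH1 IH2 -big_split/=; apply: eq_bigr => i _; rewrite scalerDl.
- by rewrite IH1 -sumrN; apply: eq_bigr => i _; rewrite scaleNr.
- by rewrite IH1 scaler_sumr; apply: eq_bigr => i _; rewrite scalerA.
- by rewrite IH1 -sumrMnl; apply: eq_bigr => i _; rewrite scalerMnl.
Qed.

Lemma leval_eq env e1 e2 :
  all_below (size env) (fun i => lcoef e1 i = lcoef e2 i) ->
  leval env e1 = leval env e2.
Proof.
move=> h; rewrite !leval_coef; apply: eq_bigr => i _; congr (_ *: _).
move: (size env) h i => n; elim: n => [_ []//|n IH /= [hn hlt] [i ilt]] /=.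
move: ilt; rewrite ltnS leq_eqVlt => /predU1P[->//|ilt].
exact: (IH hlt (Ordinal ilt)).
Qed.

End LinearExpressions.

Ltac lm_mem x l :=
  lazymatch l with
  | nil => constr:(false)
  | ?y :: ?m =>
    match goal with
    | _ => let _ := match goal with _ => constr_eq x y end in constr:(true)
    | _ => lm_mem x m
    end
  end.

Ltac lm_index x l :=
  lazymatch l with
  | ?y :: ?m =>
    match goal with
    | _ => let _ := match goal with _ => constr_eq x y end in constr:(0%N)
    | _ => let k := lm_index x m in constr:(S k)
    end
  end.

Ltac lm_atoms t l :=
  lazymatch t with
  | GRing.add ?a ?b => let l1 := lm_atoms a l in lm_atoms b l1
  | GRing.opp ?a => lm_atoms a l
  | GRing.scale _ ?a => lm_atoms a l
  | GRing.natmul ?a _ => lm_atoms a l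
  | GRing.zero => l
  | _ => let b := lm_mem t l in
         lazymatch b with true => l | false => constr:(t :: l) end
  end.

Ltac lm_quote R t l :=
  lazymatch t with
  | GRing.add ?a ?b =>
    let e1 := lm_quote R a l in let e2 := lm_quote R b l in
    constr:(@LAdd R e1 e2)
  | GRing.opp ?a => let e1 := lm_quote R a l in constr:(@LOpp R e1)
  | GRing.scale ?c ?a => let e1 := lm_quote R a l in constr:(@LScale R c e1)
  | GRing.natmul ?a ?n => let e1 := lm_quote R a l in constr:(@LMuln R e1 n)
  | GRing.zero => constr:(@LZero R)
  | _ => let i := lm_index t l in constr:(@LAtom R i)
  end.

(** Proves an identity of linear combinations over [R], leaving to [tac] the
    equations between the coefficients. *)
Ltac lmod_with R tac :=
  lazymatch goal with
  | |- @eq ?V ?t1 ?t2 =>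
    let l0 := constr:(@nil V) in
    let l1 := lm_atoms t1 l0 in
    let l := lm_atoms t2 l1 in
    let e1 := lm_quote R t1 l in
    let e2 := lm_quote R t2 l in
    change (leval l e1 = leval l e2);
    apply: leval_eq; cbn [all_below lcoef size eqn];
    repeat split; tac
  end.

Ltac lmod R := lmod_with R ltac:(ring).

(** * Linearizations of the Jordan identity *)

Section JordanIdentities.
Context {R : realType} {V : jbAlgType R}.
Implicit Types (x y z u w c : V) (a b : R).

Lemma jmulDl x y z : (x + y) *j z = x *j z + y *j z.
Proof. by rewrite -[x in LHS]scale1r jmulDZl scale1r. Qed.

Lemma jmulDr x y z : z *j (x + y) = z *j x + z *j y.
Proof. by rewrite !(jmulC z) jmulDl. Qed.

Lemma jmul0l x : 0 *j x = 0.
Proof. by apply: (addrI (0 *j x)); rewrite -jmulDl !addr0. Qed.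

Lemma jmul0r x : x *j 0 = 0. Proof. by rewrite jmulC jmul0l. Qed.

Lemma jmulZl a x y : (a *: x) *j y = a *: (x *j y).
Proof. by rewrite -[a *: x]addr0 jmulDZl jmul0l addr0. Qed.

Lemma jmulZr a x y : x *j (a *: y) = a *: (x *j y).
Proof. by rewrite !(jmulC x) jmulZl. Qed.

Lemma jmulNl x y : (- x) *j y = - (x *j y).
Proof. by rewrite -scaleN1r jmulZl scaleN1r. Qed.

Lemma jmulNr x y : x *j (- y) = - (x *j y).
Proof. by rewrite !(jmulC x) jmulNl. Qed.

Lemma jmulBl x y z : (x - y) *j z = x *j z - y *j z.
Proof. by rewrite jmulDl jmulNl. Qed.

Lemma jmulBr x y z : z *j (x - y) = z *j x - z *j y.
Proof. by rewrite jmulDr jmulNr. Qed.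

Lemma jmul1r x : x *j jone = x. Proof. by rewrite jmulC jmul1. Qed.

Lemma jmul_suml I (r : seq I) (P : pred I) (F : I -> V) x :
  (\sum_(i <- r | P i) F i) *j x = \sum_(i <- r | P i) F i *j x.
Proof.
by elim/big_rec2: _ => [|i y z _ <-]; rewrite ?jmul0l ?jmulDl.
Qed.

Lemma jmul_sumr I (r : seq I) (P : pred I) (F : I -> V) x :
  x *j (\sum_(i <- r | P i) F i) = \sum_(i <- r | P i) x *j F i.
Proof. by rewrite jmulC jmul_suml; under eq_bigr do rewrite jmulC. Qed.

Definition jmulE := (jmulDl, jmulDr, jmulNl, jmulNr, jmulZl, jmulZr,
  jmul0l, jmul0r, @jmul1 R V, jmul1r).

Lemma scalerI2 x y : 2 *: x = 2 *: y :> V -> x = y.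
Proof. by apply: scalerI; rewrite pnatr_eq0. Qed.

(** The part of the Jordan identity that is linear in [z] after replacing [x]
    by [x + z]; the odd part in [z] of a cubic polynomial is isolated by the
    values at [z] and [- z]. *)
Lemma jordan_lin2 x y z :
  2 *: ((x *j z) *j (x *j y)) + (x *j x) *j (z *j y)
  = z *j ((x *j x) *j y) + 2 *: (x *j ((x *j z) *j y)).
Proof.
have h1 := jordan_id (x + z) y; have h2 := jordan_id (x - z) y.
have h3 := jordan_id z y.
apply: scalerI2; apply/eqP; rewrite -subr_eq0; apply/eqP.
transitivity (((x + z) *j (x + z)) *j ((x + z) *j y)
   - (x + z) *j (((x + z) *j (x + z)) *j y)
   - (((x - z) *j (x - z)) *j ((x - z) *j y)
   - (x - z) *j (((x - z) *j (x - z)) *j y))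
   - 2 *: ((z *j z) *j (z *j y) - z *j ((z *j z) *j y))).
  rewrite !jmulE (jmulC z x); lmod R.
by rewrite h1 h2 h3 !subrr scaler0 subr0.
Qed.

(** Polarization of [jordan_lin2] in [x]. *)
Lemma jordan_lin x u z y :
  (x *j z) *j (u *j y) + (u *j z) *j (x *j y) + (x *j u) *j (z *j y)
  = z *j ((x *j u) *j y) + x *j ((u *j z) *j y) + u *j ((x *j z) *j y).
Proof.
have h1 := jordan_lin2 (x + u) y z; have h2 := jordan_lin2 x y z.
have h3 := jordan_lin2 u y z.
apply: scalerI2; apply/eqP; rewrite -subr_eq0; apply/eqP.
transitivity
  ((2 *: (((x + u) *j z) *j ((x + u) *j y)) + ((x + u) *j (x + u)) *j (z *j y)
  - (z *j (((x + u) *j (x + u)) *j y)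
     + 2 *: ((x + u) *j (((x + u) *j z) *j y))))
  - (2 *: ((x *j z) *j (x *j y)) + (x *j x) *j (z *j y)
  - (z *j ((x *j x) *j y) + 2 *: (x *j ((x *j z) *j y))))
  - (2 *: ((u *j z) *j (u *j y)) + (u *j u) *j (z *j y)
  - (z *j ((u *j u) *j y) + 2 *: (u *j ((u *j z) *j y))))).
  rewrite !jmulE (jmulC u x); lmod R.
by rewrite h1 h2 h3 !subrr.
Qed.

(** [L_(x (u y))] in terms of multiplications by products of at most two
    elements: the linearized identity read as an operator identity in [z]. *)
Lemma jmul_triple x u y z :
  ((x *j u) *j y) *j z =
    (x *j u) *j (y *j z) + (x *j y) *j (u *j z) + (u *j y) *j (x *j z)
    - x *j (y *j (u *j z)) - u *j (y *j (x *j z)).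
Proof.
have h := jordan_lin x u z y.
rewrite (jmulC _ z) (jmulC y z) (jmulC y (u *j z)) (jmulC y (x *j z)).
rewrite (jmulC (x *j y) (u *j z)) (jmulC (u *j y) (x *j z)).
apply/eqP; rewrite -subr_eq0; apply/eqP.
transitivity (
 (z *j ((x *j u) *j y) + x *j ((u *j z) *j y) + u *j ((x *j z) *j y)) -
 ((x *j z) *j (u *j y) + (u *j z) *j (x *j y) + (x *j u) *j (z *j y))).
  by lmod R.
by rewrite h subrr.
Qed.

(** [jordan_lin2] read as an operator identity in [y],
    [[L_(x^2), L_z] = 2 [L_x, L_(x z)]]. *)
Lemma jmul_comm2 x z y :
  (x *j x) *j (z *j y) - z *j ((x *j x) *j y)
  = 2 *: (x *j ((x *j z) *j y) - (x *j z) *j (x *j y)).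
Proof.
have h := jordan_lin2 x y z; apply/eqP; rewrite -subr_eq0; apply/eqP.
transitivity (
  2 *: ((x *j z) *j (x *j y)) + (x *j x) *j (z *j y)
  - (z *j ((x *j x) *j y) + 2 *: (x *j ((x *j z) *j y)))); first by lmod R.
by rewrite h subrr.
Qed.

(** ** Powers *)

Definition jexpn x n : V := iter n (jmul x) jone.

Lemma jexpn0 x : jexpn x 0 = jone. Proof. by []. Qed.
Lemma jexpnS x n : jexpn x n.+1 = x *j jexpn x n. Proof. by []. Qed.
Lemma jexpn1 x : jexpn x 1 = x. Proof. exact: jmul1r. Qed.

Lemma jmul_sq_expn x n : (x *j x) *j jexpn x n = jexpn x n.+2.
Proof. by elim: n => [|n IH]; [rewrite jmul1r /= jmul1r|rewrite jordan_id IH]. Qed.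

Lemma jmul_expnSS x n z : jexpn x n.+2 *j z =
  (x *j x) *j (jexpn x n *j z) + 2 *: (jexpn x n.+1 *j (x *j z))
  - 2 *: (x *j (jexpn x n *j (x *j z))).
Proof.
rewrite -jmul_sq_expn (jmul_triple x x (jexpn x n) z) -jexpnS; lmod R.
Qed.

Lemma jmul_expn_comm x n z : jexpn x n *j (x *j z) = x *j (jexpn x n *j z).
Proof.
elim/ltn_ind: n z => -[|[|n]] IH z; first by rewrite !jmul1.
  by rewrite jexpn1.
rewrite (jmul_expnSS x n (x *j z)) (jmul_expnSS x n z).
rewrite !jmulBr !jmulDr !jmulZr -jordan_id.
by rewrite (IH n) 1?ltnW// (IH n.+1)// (IH n _ (x *j z)) 1?ltnW// (IH n) 1?ltnW.
Qed.

(** Power associativity: [L_(x^n)] commutes with [L_x], and [x^m = L_x^m 1]. *)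
Lemma jexpnD x m n : jexpn x m *j jexpn x n = jexpn x (m + n).
Proof.
elim: n => [|n IH]; first by rewrite jmul1r addn0.
by rewrite jexpnS jmul_expn_comm IH addnS.
Qed.

(** ** Polynomials in one element *)

Definition jhorner (p : {poly R}) x : V := \sum_(i < size p) p`_i *: jexpn x i.

Lemma jhornerE n (p : {poly R}) x : (size p <= n)%N ->
  jhorner p x = \sum_(i < n) p`_i *: jexpn x i.
Proof.
move=> pn; rewrite /jhorner (big_ord_widen _ (fun i => p`_i *: jexpn x i) pn).
rewrite big_mkcond; apply: eq_bigr => i _; case: ltnP => // ip.
by rewrite nth_default// scale0r.
Qed.

Lemma jhornerD p q x : jhorner (p + q) x = jhorner p x + jhorner q x.
Proof.
pose n := maxn (size p) (size q).
rewrite !(@jhornerE n) ?leq_maxl ?leq_maxr// ?size_polyD// -big_split/=.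
by apply: eq_bigr => i _; rewrite coefD scalerDl.
Qed.

Lemma jhornerZ a p x : jhorner (a *: p) x = a *: jhorner p x.
Proof.
rewrite !(@jhornerE (size p)) ?size_scale_leq// scaler_sumr.
by apply: eq_bigr => i _; rewrite coefZ scalerA.
Qed.

Lemma jhorner0 x : jhorner 0 x = 0.
Proof. by rewrite /jhorner size_poly0 big_ord0. Qed.

Lemma jhornerN p x : jhorner (- p) x = - jhorner p x.
Proof. by rewrite -scaleN1r jhornerZ scaleN1r. Qed.

Lemma jhorner_sum I (r : seq I) (P : pred I) (F : I -> {poly R}) x :
  jhorner (\sum_(i <- r | P i) F i) x = \sum_(i <- r | P i) jhorner (F i) x.
Proof.
by elim/big_rec2: _ => [|i y z _ <-]; rewrite ?jhorner0 ?jhornerD.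
Qed.

Lemma jhornerXn n x : jhorner 'X^n x = jexpn x n.
Proof.
rewrite (@jhornerE n.+1) ?size_polyXn// (bigD1 ord_max)//= coefXn eqxx scale1r.
rewrite big1 ?addr0// => i; rewrite coefXn -val_eqE /= => /negPf ->.
by rewrite scale0r.
Qed.

Lemma jhornerX x : jhorner 'X x = x.
Proof. by rewrite -['X]expr1 jhornerXn jexpn1. Qed.

Lemma jhornerM p q x : jhorner (p * q) x = jhorner p x *j jhorner q x.
Proof.
have poly_sum (r : {poly R}) : r = \sum_(i < size r) r`_i *: 'X^i.
  by rewrite -poly_def coefK.
rewrite [in LHS](poly_sum p) [in LHS](poly_sum q) mulr_suml jhorner_sum jmul_suml.
apply: eq_bigr => i _; rewrite mulr_sumr jhorner_sum jmul_sumr.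
apply: eq_bigr => j _; rewrite -scalerAl -scalerAr -exprD !jhornerZ jhornerXn.
by rewrite jmulZl jmulZr jexpnD.
Qed.

End JordanIdentities.

(** * The spectral theorem *)

Section RealSplitting.
Context {R : realType}.
Local Open Scope complex_scope.

(** The remainder modulo [(X - a)^2 + b^2], where [a + i b] is a nonreal root,
    is a real polynomial of degree at most one that vanishes at [a + i b]. *)
Lemma real_poly_split (p : {poly R}) : p != 0 ->
  (exists (a b : R) (q : {poly R}), b != 0 /\
     p = (('X - a%:P) ^+ 2 + (b ^+ 2)%:P) * q) \/
  exists rs, p = lead_coef p *: \prod_(r <- rs) ('X - r%:P).
Proof.
move=> p0; pose iota := real_complex R.
have [zs Dp] := closed_field_poly_normal (map_poly iota p).
have pz_root z : z \in zs -> root (map_poly iota p) z.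
  move=> zzs; rewrite Dp rootZ ?root_prod_XsubC// lead_coef_eq0.
  by rewrite map_poly_eq0.
have [/allP zsR|/allPn[[a b] zzs]] := boolP (all (fun z => complex.Im z == 0) zs).
  right; exists [seq complex.Re z | z <- zs].
  apply: (map_poly_inj iota); rewrite {1}Dp lead_coef_map map_polyZ big_map.
  rewrite rmorph_prod; congr (_ *: _); apply: eq_big_seq => -[a b] /zsR /=.
  by move=> /eqP ->; rewrite rmorphB/= map_polyX map_polyC.
rewrite /= => b0; left; exists a, b; pose d := ('X - a%:P) ^+ 2 + (b ^+ 2)%:P.
have d_size : size d = 3%N.
  by rewrite size_polyDl size_exp_XsubC// size_polyC; case: (_ == _).
have d0 : d != 0 by rewrite -size_poly_eq0 d_size.
have dz : (map_poly iota d).[a +i* b] = 0.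
  rewrite rmorphD rmorphXn rmorphB/= map_polyX !map_polyC/=.
  rewrite !(hornerE, horner_exp).
  by apply/eqP; rewrite eq_complex /=; apply/andP; split; apply/eqP; simpc; ring.
have pz : (map_poly iota p).[a +i* b] = 0 by exact/eqP/pz_root.
exists (p %/ d); split=> //; rewrite -/d mulrC {1}(divp_eq p d).
suff -> : p %% d = 0 by rewrite addr0.
have rsz : (size (p %% d)%R <= 2)%N by rewrite -ltnS -d_size ltn_modp.
have rz : (map_poly iota (p %% d)).[a +i* b] = 0.
  move: pz; rewrite {1}(divp_eq p d) rmorphD rmorphM/= hornerD hornerM dz.
  by rewrite mulr0 add0r.
move: rz; set r := p %% d in rsz *.
have -> : r = r`_1 *: 'X + (r`_0)%:P.
  apply/polyP => i; rewrite coefD coefZ coefX coefC.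
  case: i => [|[|i]] /=; rewrite ?mulr0 ?mulr1 ?add0r ?addr0//.
  by rewrite nth_default// (leq_trans rsz).
rewrite rmorphD/= map_polyZ map_polyX map_polyC/= !hornerE => /eqP.
rewrite eq_complex /=; simpc => /andP[/eqP h1 /eqP h2].
have r1 : r`_1 = 0 by apply/eqP; move/eqP: h2; rewrite mulf_eq0 (negPf b0) orbF.
by move: h1; rewrite r1 mul0r add0r scale0r add0r => ->.
Qed.

End RealSplitting.

Section FiniteDimension.
Context {R : realType} {V : normedModType R}.

(** The matrix of coordinates of [m] vectors on [M < m] generators has a
    nonzero left kernel. *)
Lemma finite_dimensional_dependent : finite_dimensional V ->
  exists M, forall m (v : 'I_m -> V), (M < m)%N ->
    exists2 u : 'rV[R]_m, u != 0 & \sum_(i < m) u 0 i *: v i = 0.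
Proof.
move=> [M [e span]]; exists M => m v Mm.
have [A vA] : exists A : 'M[R]_(m, M), forall i, v i = \sum_(j < M) A i j *: e j.
  have /choice[l lP] : forall i, exists l : 'I_M -> R, v i = \sum_(j < M) l j *: e j.
    by move=> i; exact: span.
  by exists (\matrix_(i, j) l i j) => i; rewrite lP; apply: eq_bigr => j _; rewrite mxE.
have : kermx A != 0.
  rewrite -mxrank_eq0 mxrank_ker subn_eq0 -ltnNge.
  by rewrite (leq_ltn_trans _ Mm)// rank_leq_col.
move=> /rowV0Pn[u /sub_kermxP uA u0]; exists u => //.
under eq_bigr do rewrite vA scaler_sumr.
rewrite exchange_big/= big1// => j _.
under eq_bigr do rewrite scalerA.
rewrite -scaler_suml.
by move/rowP/(_ j): uA; rewrite !mxE => ->; rewrite scale0r.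
Qed.

End FiniteDimension.

Section Spectral.
Context {R : realType} {V : jbAlgType R}.
Implicit Types (x y z u w c e : V) (a b : R).

Lemma jsq_eq0 x : x *j x = 0 -> x = 0.
Proof.
move=> xx; have /eqP : `|x| ^+ 2 = 0 by rewrite -normJ2 xx normr0.
by rewrite expf_eq0/= normr_eq0 => /eqP.
Qed.

(** Formal reality is a consequence of the norm axioms. *)
Lemma jsqD_eq0 x y : x *j x + y *j y = 0 -> x = 0 /\ y = 0.
Proof.
move=> xy; have x0 : x = 0.
  by apply: jsq_eq0; apply/eqP; rewrite -normr_le0 (le_trans (normJ2D x y))// xy normr0.
by split=> //; apply: jsq_eq0; move: xy; rewrite x0 jmul0l add0r.
Qed.

(** Formal reality removes from an annihilating polynomial the square factors
    and the factors without real roots. *)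
Lemma annihilator_split (p : {poly R}) x : p != 0 -> jhorner p x = 0 ->
  exists2 rs, uniq rs & jhorner (\prod_(r <- rs) ('X - r%:P)) x = 0.
Proof.
have [n] := ubnP (size p); elim: n p => // n IH p pn p0 px.
have [[a [b [q [b0 Dp]]]]|[rs Dp]] := real_poly_split p0.
  have q0 : q != 0 by apply: contra_neq p0 => q0; rewrite Dp q0 mulr0.
  have d_size : size (('X - a%:P) ^+ 2 + (b ^+ 2)%:P) = 3%N.
    by rewrite size_polyDl size_exp_XsubC// size_polyC; case: (_ == _).
  apply: (IH q) => //.
    move: pn; rewrite Dp size_mul// -?size_poly_eq0 d_size//=.
    by rewrite ltnS => /ltnW.
  have [_] : jhorner (('X - a%:P) * q) x = 0 /\ jhorner (b *: q) x = 0.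
    apply: jsqD_eq0; rewrite -!jhornerM -jhornerD.
    have -> : ('X - a%:P) * q * (('X - a%:P) * q) + b *: q * (b *: q) = p * q.
      by rewrite Dp -!mul_polyC rmorphXn/=; ring.
    by rewrite jhornerM px jmul0l.
  by rewrite jhornerZ => /eqP; rewrite scaler_eq0 (negPf b0) => /eqP.
have px' : jhorner (\prod_(r <- rs) ('X - r%:P)) x = 0.
  move: px; rewrite Dp jhornerZ => /eqP.
  by rewrite scaler_eq0 lead_coef_eq0 (negPf p0) => /eqP.
have [urs|] := boolP (uniq rs); first by exists rs.
move=> /uniqPn -/(_ 0)[i [j [ij jrs eqij]]].
have [rs' Drs] : exists rs', perm_eq rs [:: rs`_i, rs`_i & rs'].
  have irs : (i < size rs)%N by exact: ltn_trans jrs.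
  exists (rem rs`_i (rem rs`_i rs)).
  apply: (perm_trans (perm_to_rem (mem_nth 0 irs))); rewrite perm_cons.
  apply: perm_to_rem; rewrite -has_pred1 has_count count_rem mem_nth//= eqxx subn_gt0.
  have : subseq [:: rs`_i; rs`_j] rs.
    rewrite -[X in subseq _ X](cat_take_drop j); apply: (@cat_subseq _ [:: _] [:: _]).
      by rewrite sub1seq -(nth_take 0 ij) mem_nth// size_take jrs.
    by rewrite sub1seq (drop_nth 0 jrs) mem_head.
  by rewrite eqij => /leq_count_subseq -/(_ (pred1 rs`_j)); rewrite /= eqxx.
move: px'; rewrite (perm_big _ Drs)/= !big_cons mulrA.
set q := \prod_(_ <- rs') _ => px'.
apply: (IH (('X - (rs`_i)%:P) * q)).
- move: pn; rewrite Dp size_scale ?lead_coef_eq0// (perm_big _ Drs)/= !big_cons -/q.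
  rewrite !size_Mmonic ?monicXsubC ?monic_prod_XsubC ?monicMl ?monic_neq0
    ?monicXsubC ?monic_prod_XsubC// !size_XsubC.
  by rewrite add2n/= ltnS.
- by rewrite monic_neq0// monicMl ?monicXsubC ?monic_prod_XsubC.
- apply: jsq_eq0; rewrite -jhornerM.
  have -> : ('X - (rs`_i)%:P) * q * (('X - (rs`_i)%:P) * q)
    = (('X - (rs`_i)%:P) * ('X - (rs`_i)%:P) * q) * q by ring.
  by rewrite jhornerM px' jmul0l.
Qed.

End Spectral.

Section Resolutions.
Context {R : realType} {V : jbAlgType R}.
Implicit Types (x y z u w e : V) (a b : R).

Section System.
Variables (m : nat) (c : 'I_m -> V).
Hypothesis cP : complete_orthogonal_idempotents c.

Lemma coi_mul_delta i j : c i *j c j = (i == j)%:R *: c i.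
Proof.
case: cP => cc cc0 _; have [->|ij] := eqVneq; first by rewrite scale1r cc.
by rewrite scale0r cc0.
Qed.

Lemma coi_mulr i (f : 'I_m -> R) : c i *j (\sum_j f j *: c j) = f i *: c i.
Proof.
rewrite jmul_sumr (bigD1 i)//= jmulZr coi_mul_delta eqxx scale1r big1 ?addr0//.
by move=> j ij; rewrite jmulZr coi_mul_delta eq_sym (negPf ij) scale0r scaler0.
Qed.

Lemma coi_mul (f g : 'I_m -> R) :
  (\sum_j f j *: c j) *j (\sum_j g j *: c j) = \sum_j (f j * g j) *: c j.
Proof.
rewrite jmul_suml; apply: eq_bigr => i _.
by rewrite jmulZl coi_mulr scalerA.
Qed.

Lemma coi_one : \sum_i c i = jone. Proof. by case: cP. Qed.

Lemma coi_const a : \sum_i a *: c i = a *: jone.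
Proof. by rewrite -scaler_sumr coi_one. Qed.

Lemma coi_expn (f : 'I_m -> R) n :
  jexpn (\sum_j f j *: c j) n = \sum_j f j ^+ n *: c j.
Proof.
elim: n => [|n IH].
  rewrite jexpn0 -[LHS]scale1r -coi_const.
  by apply: eq_bigr => i _; rewrite expr0.
by rewrite jexpnS IH coi_mul; under eq_bigr do rewrite -exprS.
Qed.

Lemma coi_horner (p : {poly R}) (f : 'I_m -> R) :
  jhorner p (\sum_j f j *: c j) = \sum_j p.[f j] *: c j.
Proof.
under [in RHS]eq_bigr do rewrite horner_coef scaler_suml.
rewrite exchange_big/=; apply: eq_bigr => i _.
by rewrite coi_expn scaler_sumr; apply: eq_bigr => j _; rewrite scalerA.
Qed.

End System.

Lemma interpolation (f : R -> R) (rs : seq R) :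
  exists p : {poly R}, forall r, r \in rs -> p.[r] = f r.
Proof.
elim: rs => [|r rs [p pP]]; first by exists 0.
have [rrs|rrs] := boolP (r \in rs).
  by exists p => s; rewrite inE => /predU1P[->|]; exact: pP.
pose q := \prod_(s <- rs) ('X - s%:P).
have qr : q.[r] != 0 by rewrite -rootE root_prod_XsubC.
exists (p + ((f r - p.[r]) / q.[r]) *: q) => s; rewrite inE hornerD hornerZ.
move=> /predU1P[->|srs]; first by rewrite divfK// subrKC.
by have /eqP -> : root q s; rewrite ?root_prod_XsubC// mulr0 addr0 pP.
Qed.

(** The functional calculus does not depend on the resolution, being given by
    an interpolating polynomial common to two resolutions. *)
Lemma jfunE (f : R -> R) m (c : 'I_m -> V) (l : 'I_m -> R) :
  complete_orthogonal_idempotents c ->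
  jfun f (\sum_i l i *: c i) = \sum_i f (l i) *: c i.
Proof.
move=> cP; rewrite /jfun; case: xgetP => [y _ [m' [c' [l' [c'P xE ->]]]]|]; last first.
  by move=> /(_ (\sum_i f (l i) *: c i)) []; exists m, c, l.
have [p pP] := interpolation f (codom l ++ codom l').
transitivity (jhorner p (\sum_i l i *: c i)).
  rewrite xE coi_horner//; apply: eq_bigr => i _.
  by rewrite pP// mem_cat codom_f orbT.
by rewrite coi_horner//; apply: eq_bigr => i _; rewrite pP// mem_cat codom_f.
Qed.

(** Lagrange idempotents of an annihilating polynomial with simple roots. *)
Lemma spectral_resolution x : finite_dimensional V ->
  exists m (c : 'I_m -> V) (l : 'I_m -> R) (p : 'I_m -> {poly R}),
    [/\ complete_orthogonal_idempotents c, x = \sum_i l i *: c i &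
        forall i, c i = jhorner (p i) x].
Proof.
move=> /finite_dimensional_dependent[M /(_ _ (fun i : 'I_M.+1 => jexpn x i) (ltnSn M))].
move=> [u u0 ux]; pose q := \poly_(i < M.+1) u 0 (inord i).
have qx : jhorner q x = 0.
  rewrite (@jhornerE _ _ M.+1) ?size_poly// -[RHS]ux; apply: eq_bigr => i _.
  by rewrite coef_poly ltn_ord inord_val.
have q0 : q != 0.
  apply: contra_neq u0 => q0; apply/rowP => i; rewrite mxE.
  by have := congr1 (fun p : {poly R} => p`_i) q0; rewrite coef_poly ltn_ord inord_val coef0.
have [rs urs rsx] := annihilator_split q0 qx.
have vanish (p : {poly R}) : (forall r, r \in rs -> p.[r] = 0) -> jhorner p x = 0.
  move=> p0; have : \prod_(r <- rs) ('X - r%:P) %| p.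
    rewrite uniq_roots_dvdp ?uniq_rootsE//.
    by apply/allP => r /p0 pr; apply/rootP.
  by move=> /dvdpP[q' ->]; rewrite jhornerM rsx jmul0r.
have eqh (p p' : {poly R}) : (forall r, r \in rs -> p.[r] = p'.[r]) ->
    jhorner p x = jhorner p' x.
  move=> pp'; apply/eqP; rewrite -subr_eq0 -jhornerN -jhornerD; apply/eqP.
  by apply: vanish => r /pp' pr; rewrite hornerD hornerN pr subrr.
have /choice[p pP] : forall i : 'I_(size rs), exists p : {poly R},
    forall r, r \in rs -> p.[r] = (r == rs`_i)%:R.
  by move=> i; exact: interpolation.
have psum (F : 'I_(size rs) -> R) (r : 'I_(size rs)) :
    \sum_i F i * (p i).[rs`_r] = F r.
  rewrite (bigD1 r)//= pP ?mem_nth// eqxx mulr1 big1 ?addr0// => i ir.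
  by rewrite pP ?mem_nth// nth_uniq// eq_sym val_eqE (negPf ir) mulr0.
exists (size rs), (fun i => jhorner (p i) x), (fun i => rs`_i), p; split=> //.
  split=> [i|i j ij|].
  - rewrite /jidempotent -jhornerM; apply: eqh => r rrs.
    by rewrite hornerM pP//; case: eqP; rewrite ?mulr1 ?mulr0.
  - rewrite -jhornerM; apply: vanish => r rrs; rewrite hornerM !pP// -natrM mulnb.
    case: eqP => //= ->; rewrite nth_uniq//.
    by rewrite val_eqE (negPf ij).
  - rewrite -jhorner_sum -[RHS](jhornerXn 0 x) expr0; apply: eqh => r rrs.
    rewrite horner_sum hornerC -(nth_index 0 rrs).
    have irs : (index r rs < size rs)%N by rewrite index_mem.
    rewrite -[RHS](psum (fun=> 1) (Ordinal irs)).
    by apply: eq_bigr => i _; rewrite mul1r.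
rewrite -[LHS]jhornerX; under eq_bigr do rewrite -jhornerZ.
rewrite -jhorner_sum; apply: eqh => r rrs.
have irs : (index r rs < size rs)%N by rewrite index_mem.
rewrite hornerX horner_sum -{1}(nth_index 0 rrs) -{1}(psum (fun i => rs`_i) (Ordinal irs)).
by apply: eq_bigr => i _; rewrite hornerZ /= nth_index.
Qed.

End Resolutions.

(** * Peirce decomposition and the fundamental formula *)

Section Peirce.
Context {R : realType} {V : jbAlgType R}.
Implicit Types (x y z u v w c e : V) (a b : R).

(** Polarization of [jU] in its first argument, locked because unification
    would otherwise take it for a difference. *)
Definition jU2 := locked (fun x y v =>
  x *j (y *j v) + y *j (x *j v) - (x *j y) *j v).

Lemma jU2E x y v : jU2 x y v = x *j (y *j v) + y *j (x *j v) - (x *j y) *j v.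
Proof. by rewrite /jU2 -lock. Qed.

Lemma jUE x v : jU x v = 2 *: (x *j (x *j v)) - (x *j x) *j v.
Proof. by []. Qed.

Lemma jU2xx x v : jU2 x x v = jU x v.
Proof. by rewrite !jU2E jUE; lmod R. Qed.

Lemma jU2C x y v : jU2 x y v = jU2 y x v.
Proof. by rewrite !jU2E (jmulC y x); lmod R. Qed.

Lemma jU2Dl x x' y v : jU2 (x + x') y v = jU2 x y v + jU2 x' y v.
Proof. by rewrite !jU2E !jmulE; lmod R. Qed.

Lemma jU2Zl a x y v : jU2 (a *: x) y v = a *: jU2 x y v.
Proof. by rewrite !jU2E !jmulE; lmod R. Qed.

Lemma jU2Dr x y v v' : jU2 x y (v + v') = jU2 x y v + jU2 x y v'.
Proof. by rewrite !jU2E !jmulE; lmod R. Qed.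

Lemma jU2Zr a x y v : jU2 x y (a *: v) = a *: jU2 x y v.
Proof. by rewrite !jU2E !jmulE; lmod R. Qed.

Lemma jU2_suml I (r : seq I) (P : pred I) (F : I -> V) y v :
  jU2 (\sum_(i <- r | P i) F i) y v = \sum_(i <- r | P i) jU2 (F i) y v.
Proof.
elim/big_rec2: _ => [|i u w _ <-]; last exact: jU2Dl.
by rewrite !jU2E !jmul0l jmul0r !addr0 subr0.
Qed.

Lemma jU2_sumr I (r : seq I) (P : pred I) (F : I -> V) x v :
  jU2 x (\sum_(i <- r | P i) F i) v = \sum_(i <- r | P i) jU2 x (F i) v.
Proof. by rewrite jU2C jU2_suml; under eq_bigr do rewrite jU2C. Qed.

Lemma jUD x u v : jU x (u + v) = jU x u + jU x v.
Proof. by rewrite -!jU2xx jU2Dr. Qed.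

Lemma jUZ x a v : jU x (a *: v) = a *: jU x v.
Proof. by rewrite -!jU2xx jU2Zr. Qed.

Lemma jUN x v : jU x (- v) = - jU x v.
Proof. by rewrite -scaleN1r jUZ scaleN1r. Qed.

Lemma jUB x u v : jU x (u - v) = jU x u - jU x v.
Proof. by rewrite jUD jUN. Qed.

Lemma jU0 x : jU x 0 = 0.
Proof. by rewrite -[X in jU _ X](scale0r x) jUZ scale0r. Qed.

Lemma jU_sum x I (r : seq I) (P : pred I) (F : I -> V) :
  jU x (\sum_(i <- r | P i) F i) = \sum_(i <- r | P i) jU x (F i).
Proof.
by elim/big_rec2: _ => [|i u w _ <-]; rewrite ?jU0 ?jUD.
Qed.

Lemma jUZl a x v : jU (a *: x) v = a ^+ 2 *: jU x v.
Proof. by rewrite -!jU2xx jU2Zl jU2C jU2Zl scalerA expr2. Qed.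

Lemma jU_one x : jU x jone = x *j x.
Proof. by rewrite jUE !jmul1r; lmod R. Qed.

Lemma jU1 v : jU jone v = v.
Proof. by rewrite jUE !jmul1; lmod R. Qed.

(** [L_z] belongs to the structure algebra: it acts on [jU2] as a derivation,
    up to the sign on the last argument. *)
Lemma jU2_structure z x y v :
  jU2 (z *j x) y v + jU2 x (z *j y) v = z *j jU2 x y v + jU2 x y (z *j v).
Proof.
have h := jordan_lin x y z v; rewrite !jU2E (jmulC x (z *j y)).
rewrite (jmul_triple z x y v) (jmul_triple z y x v) !jmulE (jmulC y x).
rewrite (jmulC x z) (jmulC y z) in h.
apply/eqP; rewrite -subr_eq0; apply/eqP.
transitivity (z *j ((x *j y) *j v) + x *j ((z *j y) *j v) + y *j ((z *j x) *j v)
  - ((z *j x) *j (y *j v) + (z *j y) *j (x *j v) + (x *j y) *j (z *j v))).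
  by lmod R.
by rewrite h subrr.
Qed.

Lemma peirce_cubic c v : jidempotent c ->
  2 *: (c *j (c *j (c *j v))) = 3 *: (c *j (c *j v)) - c *j v.
Proof.
move=> cc; have := jmul_triple c c c v; rewrite !cc => h.
apply/eqP; rewrite -subr_eq0; apply/eqP.
transitivity (c *j v - (c *j (c *j v) + c *j (c *j v) + c *j (c *j v) -
   c *j (c *j (c *j v)) - c *j (c *j (c *j v)))); first by lmod R.
by rewrite -h subrr.
Qed.

Lemma jU_idem_eig c v : jidempotent c -> c *j jU c v = jU c v.
Proof.
move=> cc; rewrite jUE jmulBr jmulZr peirce_cubic// cc; lmod R.
Qed.

Lemma jidempotent_compl c : jidempotent c -> jidempotent (jone - c).
Proof.
by move=> cc; rewrite /jidempotent !(jmulBl, jmulBr) !jmul1 jmul1r cc subrr subr0.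
Qed.

(** [L_c] commutes with [L_v] because [c v = 0], so that it fixes [u v];
    symmetrically [L_(1 - c)] commutes with [L_u] and fixes [u v]. *)
Lemma peirce_orth c u v : jidempotent c -> c *j u = u -> c *j v = 0 -> u *j v = 0.
Proof.
move=> cc cu cv; have dd := jidempotent_compl cc.
have := jmul_comm2 c v u; rewrite cc cu cv !jmul0l jmul0r subrr scaler0.
move=> /eqP; rewrite subr_eq0 => /eqP; rewrite (jmulC v u) => h1.
have := jmul_comm2 (jone - c) u v; rewrite dd !jmulBl !jmul1 cu cv subrr subr0.
rewrite h1 jmul0r !subrr scaler0 sub0r.
by move=> /eqP; rewrite oppr_eq0 => /eqP.
Qed.

Lemma orth_idem_comm c u v : jidempotent c -> c *j u = 0 ->
  c *j (u *j v) = u *j (c *j v).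
Proof.
move=> cc cu; have := jmul_comm2 c u v; rewrite cc cu !jmul0l jmul0r subrr scaler0.
by move=> /eqP; rewrite subr_eq0 => /eqP.
Qed.

Lemma jUDl x y v : jU (x + y) v = jU x v + jU y v + 2 *: jU2 x y v.
Proof. by rewrite -!jU2xx jU2Dl !(jU2C _ (x + y)) !jU2Dl (jU2C y x); lmod R. Qed.

(** ** The decomposition defined by a complete system of idempotents *)

Section System.
Variables (m : nat) (c : 'I_m -> V).
Hypothesis cP : complete_orthogonal_idempotents c.
Implicit Types (i j k l r s t : 'I_m).

Let cc i : jidempotent (c i). Proof. by case: cP. Qed.
Let cc0 i j : i != j -> c i *j c j = 0. Proof. by case: cP => _ h _ /h. Qed.

Lemma coi_comm i j v : c i *j (c j *j v) = c j *j (c i *j v).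
Proof.
by have [->//|ij] := eqVneq i j; apply: orth_idem_comm => //; exact: cc0.
Qed.

(** The projection onto the Peirce component [(i, j)] if [i = j], and half of
    it otherwise: both [(i, j)] and [(j, i)] occur in [peirce_sum]. *)
Definition peirce i j v := jU2 (c i) (c j) v.

Lemma peirceC i j v : peirce i j v = peirce j i v.
Proof. exact: jU2C. Qed.

Lemma peirceii i v : peirce i i v = jU (c i) v.
Proof. exact: jU2xx. Qed.

Lemma peirce_neq i j v : i != j -> peirce i j v = 2 *: (c i *j (c j *j v)).
Proof. by move=> ij; rewrite /peirce !jU2E cc0// jmul0l (coi_comm j i); lmod R. Qed.

Lemma peirce_sum v : \sum_i \sum_j peirce i j v = v.
Proof.
case: cP => _ _ c1; rewrite -[RHS]jU1 -[in RHS]c1 -jU2xx jU2_suml.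
by apply: eq_bigr => i _; rewrite jU2_sumr.
Qed.

Lemma peirce_comm r i j v : c r *j peirce i j v = peirce i j (c r *j v).
Proof.
rewrite /peirce !jU2E jmulBr jmulDr !(coi_comm r); congr (_ - _).
have [->|ij] := eqVneq i j; first by rewrite cc coi_comm.
by rewrite cc0// !jmul0l jmul0r.
Qed.

Lemma jU_orth_eig e u v : jidempotent e -> e *j u = 0 -> u *j jU e v = 0.
Proof.
by move=> ee eu; rewrite jmulC; apply: (@peirce_orth e) => //; exact: jU_idem_eig.
Qed.

Lemma jU_coi_orth k i v : k != i -> c k *j jU (c i) v = 0.
Proof. by move=> ki; apply: jU_orth_eig => //; rewrite cc0// eq_sym. Qed.

Lemma peirce_eig_distinct r i j v : i != j -> r != i -> r != j ->
  c r *j peirce i j v = 0.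
Proof.
move=> ij ri rj; have ee : jidempotent (c i + c j).
  by rewrite /jidempotent !jmulE !cc !cc0 ?addr0 ?add0r// eq_sym.
have er : (c i + c j) *j c r = 0 by rewrite jmulDl !cc0 ?addr0// eq_sym.
have := jU_orth_eig v ee er.
rewrite jUDl (jmulDr _ (2 *: _)) (jmulDr (jU _ _)) !jU_coi_orth// !add0r.
by rewrite jmulZr => /eqP; rewrite scaler_eq0 pnatr_eq0 => /eqP.
Qed.

Lemma peirce_eig_half i j v : i != j ->
  c i *j peirce i j v = 2^-1 *: peirce i j v.
Proof.
move=> ij; rewrite peirce_neq//.
have : jU (c i) (c j *j v) = 0.
  by rewrite -peirceii -peirce_comm peirceii jU_coi_orth// eq_sym.
rewrite jUE cc => /eqP; rewrite subr_eq0 => /eqP h.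
by rewrite jmulZr h scalerA mulVf ?pnatr_eq0// scale1r.
Qed.

(** [peirce i j v] is a joint eigenvector of the [L_(c r)], with the weight
    of the root [(e_i + e_j) / 2]. *)
Lemma peirce_eig r i j v :
  c r *j peirce i j v = (((r == i)%:R + (r == j)%:R) / 2) *: peirce i j v.
Proof.
have [<-|ri] := eqVneq r i; have [<-|rj] := eqVneq r j.
- by rewrite peirceii jU_idem_eig// -natrD divff ?scale1r// pnatr_eq0.
- by rewrite addr0 mul1r peirce_eig_half.
- by rewrite add0r mul1r peirceC peirce_eig_half.
- rewrite add0r mul0r scale0r; have [<-|ij] := eqVneq i j.
    by rewrite peirceii jU_coi_orth.
  exact: peirce_eig_distinct.
Qed.

Lemma peirce_ind (P : V -> Prop) : P 0 -> (forall x y, P x -> P y -> P (x + y)) ->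
  (forall i j v, P (peirce i j v)) -> forall v, P v.
Proof.
move=> P0 PD PE v; rewrite -(peirce_sum v).
by apply: big_ind => // i _; apply: big_ind => // j _.
Qed.

Variable l : 'I_m -> R.
Let z := \sum_i l i *: c i.

Lemma jU_peirce i j v : jU z (peirce i j v) = (l i * l j) *: peirce i j v.
Proof.
have Lz (f : 'I_m -> R) : (\sum_k f k *: c k) *j peirce i j v
    = ((f i + f j) / 2) *: peirce i j v.
  rewrite jmul_suml; under eq_bigr do rewrite jmulZl peirce_eig scalerA.
  rewrite -scaler_suml; congr (_ *: _).
  have fs k : \sum_k' f k' * (k' == k)%:R = f k.
    rewrite (bigD1 k)//= eqxx mulr1 big1 ?addr0// => k' /negPf ->.
    by rewrite mulr0.
  by under eq_bigr do rewrite mulrA mulrDr; rewrite -mulr_suml big_split/= !fs.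
rewrite jUE {3 4}/z coi_mul// !Lz jmulZr Lz !scalerA -scalerBl; congr (_ *: _).
by field.
Qed.

(** Comparing the weights of the [L_(c r)] on both sides of [jU2_structure]
    shows that a nonzero component [(s, t)] of [jU2] of components [(i, j)],
    [(k, k')] and [(p, q)] has [{s, t, p, q} = {i, j, k, k'}] as multisets. *)
Lemma jU2_peirce_weight i j k k' p q s t x y v :
  let w := jU2 (peirce i j x) (peirce k k' y) (peirce p q v) in
  (l i * l j * (l k * l k')) *: peirce s t w
  = (l p * l q * (l s * l t)) *: peirce s t w.
Proof.
move=> w; have [->|w0] := eqVneq (peirce s t w) 0; first by rewrite !scaler0.
suff wt : perm_eq [:: i; j; k; k'] [:: p; q; s; t].
  have : \prod_(r <- [:: i; j; k; k']) l r = \prod_(r <- [:: p; q; s; t]) l r.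
    exact: perm_big.
  by rewrite !big_cons !big_nil !mulr1 !mulrA => ->.
apply/allP => r _ /=; rewrite !addn0 -(eqr_nat R) !natrD.
have := congr1 (peirce s t) (jU2_structure (c r) (peirce i j x) (peirce k k' y) (peirce p q v)).
rewrite !peirce_eig jU2Zl (jU2C _ (_ *: _)) jU2Zl (jU2C (peirce k k' y)) jU2Zr -/w.
have peirceD u u' : peirce s t (u + u') = peirce s t u + peirce s t u' by exact: jU2Dr.
have peirceZ a u : peirce s t (a *: u) = a *: peirce s t u by exact: jU2Zr.
rewrite !peirceD !peirceZ -peirce_comm peirce_eig -!scalerDl.
move=> /eqP; rewrite -subr_eq0 -scalerBl scaler_eq0 (negPf w0) orbF => /eqP.
by rewrite !(eq_sym _ r) -subr_eq0 /GRing.scale/= => h; apply/eqP; lra.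
Qed.

Lemma jU2_jU x y v : jU2 (jU z x) (jU z y) v = jU z (jU2 x y (jU z v)).
Proof.
elim/peirce_ind: x y v => [y v|x x' IH IH' y v|i j x].
- by rewrite jU0 !jU2E !(jmul0l, jmul0r) !addr0 subr0 jU0.
- by rewrite jUD (jU2Dl (jU z x)) (jU2Dl x) IH IH' jUD.
elim/peirce_ind => [v|y y' IH IH' v|k k' y].
- by rewrite jU0 !jU2E !(jmul0l, jmul0r) !addr0 subr0 jU0.
- have jU2D2 u w w' v' : jU2 u (w + w') v' = jU2 u w v' + jU2 u w' v'.
    by rewrite jU2C jU2Dl !(jU2C u).
  by rewrite jUD (jU2D2 _ (jU z y)) (jU2D2 _ y) IH IH' jUD.
elim/peirce_ind => [|v v' IH IH'|p q v].
- by rewrite jU0 !jU2E !(jmul0l, jmul0r) !addr0 subr0 jU0.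
- by rewrite (jU2Dr _ _ v) IH IH' -jUD -jU2Dr -jUD.
rewrite !jU_peirce jU2Zl jU2C jU2Zl jU2C scalerA jU2Zr jUZ.
set w := jU2 _ _ _; rewrite -[in RHS](peirce_sum w) -[in LHS](peirce_sum w).
rewrite jU_sum !scaler_sumr; apply: eq_bigr => s _.
rewrite jU_sum !scaler_sumr; apply: eq_bigr => t _.
by rewrite jU_peirce scalerA; exact: jU2_peirce_weight.
Qed.

End System.
End Peirce.

(** The fundamental formula, reduced by a resolution of [z] to its Peirce
    components. *)
Lemma jU_jU {R : realType} {V : jbAlgType R} (z x v : V) :
  finite_dimensional V -> jU (jU z x) v = jU z (jU x (jU z v)).
Proof.
move=> /(spectral_resolution z)[m [c [l [p [cP -> _]]]]].
by rewrite -(jU2xx (jU _ x)) (jU2_jU cP l) jU2xx.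
Qed.

(** * Symmetric gauge functions and doubly stochastic matrices *)

Section Gauge.
Context {R : realType} {n : nat}.
Variable phi : 'rV[R]_n -> R.
Hypothesis phi_gauge : symmetric_gauge phi.
Implicit Types (x y : 'rV[R]_n) (M : 'I_n -> 'I_n -> R) (i j k : 'I_n).

Lemma gaugeD x y : phi (x + y) <= phi x + phi y.
Proof. by case: phi_gauge. Qed.

Lemma gaugeZ a x : phi (a *: x) = `|a| * phi x.
Proof. by case: phi_gauge. Qed.

Lemma gauge_perm s x : phi (col_perm s x) = phi x.
Proof. by case: phi_gauge. Qed.

Lemma gauge0 : phi 0 = 0.
Proof. by rewrite -(scale0r 0) gaugeZ normr0 mul0r. Qed.

Lemma gaugeN x : phi (- x) = phi x.
Proof. by rewrite -scaleN1r gaugeZ normrN normr1 mul1r. Qed.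

Lemma gauge_ge0 x : 0 <= phi x.
Proof.
have := gaugeD x (- x); rewrite gaugeN subrr gauge0 -mulr2n -mulr_natl.
by rewrite pmulr_rge0// ltr0n.
Qed.

Lemma gauge_eq0 x : phi x = 0 -> x = 0.
Proof. by case: phi_gauge => _ _ h _ _; exact: h. Qed.

Lemma gauge_sum I (r : seq I) (P : pred I) (F : I -> 'rV[R]_n) :
  phi (\sum_(i <- r | P i) F i) <= \sum_(i <- r | P i) phi (F i).
Proof.
elim/big_ind2: _ => [|x a y b xa yb|//]; first by rewrite gauge0.
by rewrite (le_trans (gaugeD _ _))// lerD.
Qed.

Lemma gauge_abs x : phi (\row_i `|x 0 i|) = phi x.
Proof.
case: phi_gauge => _ _ _ _ sgn; rewrite -(sgn (fun i => x 0 i < 0) x).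
by congr phi; apply/rowP => i; rewrite !mxE normrEsign.
Qed.

Lemma gauge_perm_eq x y : perm_eq (codom (x 0)) (codom (y 0)) -> phi x = phi y.
Proof.
move=> xy; have /tuple_permP[s sE] : perm_eq (codom (x 0)) [tuple y 0 i | i < n].
  by rewrite (perm_trans xy).
rewrite -(gauge_perm s y); congr phi; apply/rowP => i; rewrite !mxE.
have := congr1 (fun t => nth 0 t i) sE.
by rewrite -[LHS]/(nth 0 (codom (x 0)) i) (nth_map i) ?size_enum_ord// nth_ord_enum
  (nth_map i) ?size_enum_ord// nth_ord_enum tnth_mktuple.
Qed.

(** The constant that compares the gauge with the maximum norm. *)
Definition gauge_bound : R := \sum_i phi (delta_mx 0 i).

Lemma gauge_bound_ge0 : 0 <= gauge_bound.
Proof. by apply: sumr_ge0 => i _; exact: gauge_ge0. Qed.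

Lemma gauge_le_bound x r : (forall i, `|x 0 i| <= r) -> phi x <= gauge_bound * r.
Proof.
move=> xr; rewrite [x]row_sum_delta (le_trans (gauge_sum _ _ _))// mulr_suml.
by apply: ler_sum => i _; rewrite gaugeZ mulrC ler_wpM2l ?gauge_ge0.
Qed.

Definition doubly_stochastic M : Prop :=
  [/\ forall i j, 0 <= M i j, forall i, \sum_j M i j = 1 &
      forall j, \sum_i M i j = 1].

Definition mxact M x : 'rV[R]_n := \row_i \sum_j M i j * x 0 j.

(** Moving mass from the largest coordinate [k] of [y'] to smaller ones: the
    result is a convex combination of [y'] and its transpositions. *)
Lemma gauge_transfer (k : 'I_n) (d : R) (w : 'I_n -> R) y y' :
  0 < d -> (forall i, 0 <= w i) -> \sum_(i | i != k) w i = 1 ->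
  (forall i, i != k -> 0 < w i -> y 0 i <= y 0 k) ->
  y' 0 k = y 0 k + d -> (forall i, i != k -> y' 0 i = y 0 i - w i * d) ->
  phi y <= phi y'.
Proof.
move=> d0 w0 w1 ymax y'k y'i.
pose th i := w i * d / (y' 0 k - y' 0 i).
have gap i : i != k -> 0 < w i -> d <= y' 0 k - y' 0 i.
  move=> ik wi; rewrite y'k (y'i i ik).
  have := ymax i ik wi; have : 0 <= w i * d by rewrite mulr_ge0// ltW.
  lra.
have thE i : i != k -> th i * (y' 0 k - y' 0 i) = w i * d.
  move=> ik; rewrite /th; have [wi|wi] := ltP 0 (w i).
    by rewrite divfK// gt_eqF// (lt_le_trans d0)// gap.
  by rewrite (@le_anti _ _ (w i) 0) ?wi ?w0// !mul0r.
have th0 i : i != k -> 0 <= th i <= w i.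
  move=> ik; rewrite /th; have [wi|wi] := ltP 0 (w i); last first.
    by rewrite (@le_anti _ _ (w i) 0) ?wi ?w0// !mul0r lexx.
  have g := gap i ik wi; have g0 := lt_le_trans d0 g.
  apply/andP; split; first by rewrite divr_ge0 ?mulr_ge0// ltW.
  by rewrite ler_pdivrMr// ler_wpM2l// ltW.
pose t := \sum_(i | i != k) th i.
have t1 : t <= 1 by rewrite -w1 ler_sum// => i /th0/andP[].
have yE : y = (1 - t) *: y' + \sum_(i | i != k) th i *: col_perm (tperm k i) y'.
  apply/rowP => j; rewrite !mxE summxE.
  have [->|jk] := eqVneq j k.
    under eq_bigr do rewrite !mxE tpermL.
    rewrite mulrBl mul1r mulr_suml -addrA -sumrN -big_split/=.
    rewrite (eq_bigr (fun i => - (w i * d))) => [|i ik]; last first.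
      by rewrite -thE//; ring.
    by rewrite sumrN -mulr_suml w1 y'k; ring.
  rewrite (bigD1 j)//= !mxE tpermR.
  rewrite (eq_bigr (fun i => th i * y' 0 j)) => [|i /andP[ik ij]]; last first.
    by rewrite !mxE tpermD// eq_sym.
  rewrite -mulr_suml; have -> : \sum_(i | (i != k) && (i != j)) th i = t - th j.
    by rewrite /t [in RHS](bigD1 j)//= addrAC subrr add0r.
  have := thE j jk; rewrite (y'i j jk); lra.
rewrite [in leLHS]yE (le_trans (gaugeD _ _))//.
apply: (@le_trans _ _ ((1 - t) * phi y' + \sum_(i | i != k) th i * phi y')).
  rewrite lerD ?gaugeZ ?ger0_norm ?subr_ge0// (le_trans (gauge_sum _ _ _))//.
  by apply: ler_sum => i /th0/andP[thi _]; rewrite gaugeZ gauge_perm ger0_norm.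
by rewrite -mulr_suml -mulrDl subrK mul1r.
Qed.

Section Elimination.
Variables (M : 'I_n -> 'I_n -> R) (k : 'I_n).
Hypothesis MP : doubly_stochastic M.
Hypothesis Mk : M k k < 1.

(** Away from [k], the matrix [1 - ds_eliminate] is the Schur complement of
    [1 - M k k] in [1 - M]. *)
Definition ds_eliminate i j : R :=
  if (i == k) || (j == k) then (i == j)%:R
  else M i j + M i k * M k j / (1 - M k k).

Lemma ds_eliminateP : doubly_stochastic ds_eliminate.
Proof.
have [M0 Mr Mc] := MP; have Mk0 : 1 - M k k != 0 by rewrite subr_eq0 gt_eqF.
have delta (f : 'I_n -> R) i : (forall j, f j = (i == j)%:R) -> \sum_j f j = 1.
  move=> fE; rewrite (bigD1 i)//= fE eqxx big1 ?addr0// => j ji.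
  by rewrite fE eq_sym (negPf ji).
split=> [i j|i|j].
- rewrite /ds_eliminate; case: ifP => _; first by rewrite ler0n.
  by rewrite addr_ge0// divr_ge0 ?mulr_ge0// subr_ge0 ltW.
- have [->|ik] := eqVneq i k.
    by apply: (@delta _ k) => j; rewrite /ds_eliminate eqxx.
  rewrite (bigD1 k)//= {1}/ds_eliminate eqxx orbT (negPf ik) add0r.
  rewrite (eq_bigr (fun j => M i j + M i k / (1 - M k k) * M k j)) => [|j jk].
    rewrite big_split/= -mulr_sumr.
    have := Mr i; rewrite (bigD1 k)//= => /(canRL (addKr _)) ->.
    have := Mr k; rewrite (bigD1 k)//= => /(canRL (addKr _)) ->.
    by field.
  by rewrite /ds_eliminate (negPf ik) (negPf jk)/=; field.
- have [->|jk] := eqVneq j k.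
    by apply: (@delta _ k) => i; rewrite /ds_eliminate eqxx orbT eq_sym.
  rewrite (bigD1 k)//= {1}/ds_eliminate eqxx/= eq_sym (negPf jk) add0r.
  rewrite (eq_bigr (fun i => M i j + M k j / (1 - M k k) * M i k)) => [|i ik].
    rewrite big_split/= -mulr_sumr.
    have := Mc j; rewrite (bigD1 k)//= => /(canRL (addKr _)) ->.
    have := Mc k; rewrite (bigD1 k)//= => /(canRL (addKr _)) ->.
    by field.
  by rewrite /ds_eliminate (negPf ik) (negPf jk)/=; field.
Qed.

Lemma ds_eliminate_act x i : i != k ->
  mxact ds_eliminate x 0 i
  = mxact M x 0 i - M i k / (1 - M k k) * (x 0 k - mxact M x 0 k).
Proof.
move=> ik; have Mk0 : 1 - M k k != 0 by rewrite subr_eq0 gt_eqF.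
rewrite !mxE (bigD1 k)//= {1}/ds_eliminate eqxx orbT (negPf ik) mul0r add0r.
rewrite (eq_bigr (fun j => M i j * x 0 j + M i k / (1 - M k k) * (M k j * x 0 j)))
  => [|j jk]; last by rewrite /ds_eliminate (negPf ik) (negPf jk)/=; field.
rewrite big_split/= -mulr_sumr [in RHS](bigD1 k)//= [\sum_j M k j * _](bigD1 k)//=.
by field.
Qed.

End Elimination.
(** Schur: by induction on the set of coordinates on which [M] is not yet
    trivial, eliminating at each step the largest coordinates of [x] and of
    [M x], moved to the same place by a transposition. *)
Lemma gauge_doubly_stochastic M x : doubly_stochastic M -> phi (mxact M x) <= phi x.
Proof.
pose T0 : {set 'I_n} := finset.setT.
have : forall i, i \notin T0 -> forall j, M i j = (i == j)%:R.
  by move=> i; rewrite inE.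
clearbody T0; have [m] := ubnP #|T0|; elim: m => // m IH in T0 M x *.
rewrite ltnS => Tm Mtriv MP; have [M0 Mr Mc] := MP.
have Mtriv' i j : j \notin T0 -> M i j = (i == j)%:R.
  move=> jT; have [->|ij] := eqVneq i j; first by rewrite Mtriv// eqxx.
  apply/eqP; rewrite eq_le M0 andbT; have := Mc j.
  rewrite (bigD1 j)//= Mtriv// eqxx => /(canRL (addKr _)); rewrite addNr => sum0.
  by rewrite -[leRHS]sum0 (bigD1 i)//= lerDl sumr_ge0.
have [T_empty|[k0 k0T]] := finset.set_0Vmem T0.
  suff -> : mxact M x = x by [].
  apply/rowP => i; rewrite mxE (bigD1 i)//= Mtriv ?T_empty ?inE// eqxx mul1r.
  rewrite big1 ?addr0// => j ji.
  by rewrite Mtriv ?T_empty ?inE// eq_sym (negPf ji) mul0r.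
pose y := mxact M x.
case: (@arg_maxP _ _ _ k0 (fun i => i \in T0) (fun i => y 0 i) k0T) => /= k kT ymax.
case: (@arg_maxP _ _ _ k0 (fun i => i \in T0) (fun i => x 0 i) k0T) => /= k' k'T xmax.
pose s := tperm k k'; pose N i j := M i (s j); pose z := col_perm s x.
have sT j : (s j \in T0) = (j \in T0).
  by rewrite /s; case: tpermP => [->|->|]//; rewrite kT k'T.
have yE : y = mxact N z.
  apply/rowP => i; rewrite !mxE (reindex_inj (@perm_inj _ s)).
  by apply: eq_bigr => j _; rewrite !mxE.
have NP : doubly_stochastic N.
  split=> [i j|i|j]; [exact: M0| |exact: Mc].
  by rewrite -(Mr i) [RHS](reindex_inj (@perm_inj _ s)).
have Ntriv i j : i \notin T0 -> N i j = (i == j)%:R.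
  move=> iT; have si : s i = i by rewrite /s tpermD//; apply: contraNneq iT => <-.
  by rewrite /N Mtriv// -{1}si (inj_eq (@perm_inj _ s)).
have Ntriv' i j : j \notin T0 -> N i j = (i == j)%:R.
  move=> jT; rewrite /N /s tpermD ?Mtriv'//; apply: contraNneq jT => <-//.
have zmax i : i \in T0 -> z 0 i <= z 0 k.
  by move=> iT; rewrite !mxE tpermL xmax// sT.
rewrite -/y yE -(gauge_perm s x) -/z.
have [N0 Nr Nc] := NP.
have kT1 : (#|T0 :\ k| < m)%N.
  by move: Tm; rewrite (finset.cardsD1 k) kT.
have Nkk : N k k <= 1 by rewrite -(Nr k) (bigD1 k)//= lerDl sumr_ge0.
move: Nkk; rewrite le_eqVlt => /predU1P[Nkk|Nkk].
  apply: (IH (T0 :\ k)) => // i; rewrite finset.in_setD1 negb_and negbK.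
  move=> /orP[/eqP -> j|iT j]; last exact: Ntriv.
  have [<-|kj] := eqVneq k j; first by rewrite Nkk.
  apply/eqP; rewrite eq_le N0 andbT; have := Nr k.
  rewrite (bigD1 k)//= Nkk => /(canRL (addKr _)); rewrite addNr => sum0.
  by rewrite -[leRHS]sum0 (bigD1 j) 1?eq_sym//= lerDl sumr_ge0.
have N1 : 0 < 1 - N k k by rewrite subr_gt0.
have EP := ds_eliminateP NP Nkk.
have Ek : mxact (ds_eliminate N k) z 0 k = z 0 k.
  rewrite mxE (bigD1 k)//= /ds_eliminate !eqxx mul1r big1 ?addr0// => j jk.
  by rewrite /= eq_sym (negPf jk) mul0r.
apply: (@le_trans _ _ (phi (mxact (ds_eliminate N k) z))); last first.
  apply: (IH (T0 :\ k)) => // i; rewrite finset.in_setD1 negb_and negbK.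
  move=> /orP[/eqP -> j|iT j]; first by rewrite /ds_eliminate eqxx.
  have ik : i != k by apply: contraNneq iT => ->//.
  rewrite /ds_eliminate (negPf ik)/=; case: ifP => // _.
  by rewrite (Ntriv i k iT) (Ntriv i j iT) (negPf ik) !mul0r addr0.
pose d := z 0 k - mxact N z 0 k.
have d0 : 0 <= d.
  rewrite subr_ge0 mxE -[leRHS]mul1r -(Nr k) mulr_suml ler_sum// => j _.
  have [jT|jT] := boolP (j \in T0); first by rewrite ler_wpM2l// zmax.
  by rewrite Ntriv'//; have [->|] := eqVneq; rewrite ?mul0r.
have Ei i : i != k -> mxact (ds_eliminate N k) z 0 i
    = mxact N z 0 i - N i k / (1 - N k k) * d by exact: ds_eliminate_act.
move: d0; rewrite le_eqVlt => /predU1P[d0|d0].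
  rewrite (_ : mxact N z = mxact (ds_eliminate N k) z)//; apply/rowP => i.
  have [->|ik] := eqVneq i k; last by rewrite Ei// -d0 mulr0 subr0.
  by rewrite Ek; apply/eqP; rewrite -subr_eq0 -opprB -/d -d0 oppr0.
apply: (@gauge_transfer k d (fun i => N i k / (1 - N k k))) => //.
- by move=> i; rewrite divr_ge0// ltW.
- rewrite -mulr_suml; have := Nc k; rewrite (bigD1 k)//=.
  by move=> /(canRL (addKr _)) ->; rewrite addrC divff// gt_eqF.
- move=> i ik wi; rewrite -yE; apply: ymax; apply: contraTT wi => iT.
  by rewrite -leNgt Ntriv// (negPf ik) mul0r.
- by rewrite Ek /d addrC subrK.
Qed.

End Gauge.

(** * Left slopes and integrals *)

Section LeftSlope.
Context {R : realType}.
Implicit Types (a b e r s t u v : R).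
Notation mu := (@lebesgue_measure R).

Lemma within_continuous_epsP (W : normedModType R) (A : set R) (f : R -> W) :
  {within A, continuous f} <->
  forall t, A t -> forall e, 0 < e -> exists2 d : R, 0 < d &
    forall s, A s -> `|s - t| < d -> `|f s - f t| <= e.
Proof.
split=> [/subspace_continuousP cf t At e e0|cf].
  have /cvgrPdist_le/(_ e e0) := cf t At.
  rewrite near_withinE => -[d /= d0 dP]; exists d => // s As st.
  by rewrite distrC; apply: dP => //=; rewrite distrC.
apply/subspace_continuousP => t At; apply/cvgrPdist_le => e e0.
have [d d0 dP] := cf t At e e0.
rewrite near_withinE; exists d => //= s st As.
by rewrite distrC; apply: dP => //; rewrite distrC.
Qed.

Lemma is_derive_eps (W : normedModType R) (g : R -> W) t (d : W) :
  is_derive t 1 g d -> forall e, 0 < e -> exists2 del : R, 0 < del &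
    forall s, `|s - t| < del -> `|g s - g t - (s - t) *: d| <= e * `|s - t|.
Proof.
move=> dg e e0; have [/cvg_ex[/= l gl] dE] := dg.
have ld : l = d by rewrite -dE; apply/esym/cvg_lim.
move: gl; rewrite {}ld => /cvgrPdist_le/(_ e e0)[del /= del0 delP].
exists del => // s st; have [->|st0] := eqVneq s t.
  by rewrite !subrr scale0r subrr !normr0 mulr0.
have h0 : s - t != 0 by rewrite subr_eq0.
have := delP (s - t); rewrite /ball_/= sub0r normrN => /(_ st h0).
have -> : (s - t)%:A + t = s by rewrite /GRing.scale/= mulr1 subrK.
have -> : g s - g t - (s - t) *: d
    = - ((s - t) *: (d - (s - t)^-1 *: (g s - g t))).
  by rewrite scalerBr scalerA divff// scale1r opprB.
by rewrite normrN normrZ mulrC => h; rewrite ler_wpM2r.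
Qed.

Lemma is_derive_of_eps (W : normedModType R) (g : R -> W) t (d : W) :
  (forall e : R, 0 < e -> exists2 del : R, 0 < del &
    forall s, `|s - t| < del -> `|g s - g t - (s - t) *: d| <= e * `|s - t|) ->
  is_derive t 1 g d.
Proof.
move=> dg.
have cv : h^-1 *: ((g \o shift t) (h%:A) - g t) @[h --> (0 : R)^'] --> d.
  apply/cvgrPdist_le => e e0; have [del del0 delP] := dg e e0.
  exists del => //= h; rewrite /ball_/= sub0r normrN => hdel h0.
  have hA : h%:A = h :> R by rewrite /GRing.scale/= mulr1.
  have := delP (h + t); rewrite addrK hA => /(_ hdel) le.
  have -> : d - h^-1 *: (g (h + t) - g t) = - (h^-1 *: (g (h + t) - g t - h *: d)).
    by rewrite [in RHS]scalerBr scalerA mulVf// scale1r opprB.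
  by rewrite normrN normrZ normfV ler_pdivrMl ?normr_gt0// mulrC.
apply: DeriveDef; first by apply/cvg_ex; exists d.
exact: cvg_lim cv.
Qed.

Lemma is_derive_scale (W : normedModType R) (f : R -> R) (w : W) t (df : R) :
  is_derive t 1 f df -> is_derive t 1 (fun s => f s *: w) (df *: w).
Proof.
move=> /is_derive_eps fP; apply: is_derive_of_eps => e e0.
have w1 : 0 < `|w| + 1 by rewrite ltr_wpDl.
have [del del0 delP] := fP (e / (`|w| + 1)) (divr_gt0 e0 w1).
exists del => // s /delP; rewrite scalerA -scalerBl -scalerBl normrZ => le.
rewrite (le_trans (ler_wpM2r (normr_ge0 w) le))// mulrAC ler_wpM2r//.
by rewrite mulrAC ler_pdivrMr// ler_pM2l// lerDl.
Qed.

Lemma is_derive_exp_sum (W : normedModType R) m (l a : 'I_m -> R) (w : 'I_m -> W) t :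
  is_derive t 1 (fun s => \sum_i (a i * expR (s * l i)) *: w i)
     (\sum_i (a i * l i * expR (t * l i)) *: w i).
Proof.
have -> : (fun s => \sum_i (a i * expR (s * l i)) *: w i)
   = \sum_i (fun s => (a i * expR (s * l i)) *: w i).
  by apply/funext => s; rewrite fct_sumE.
apply: is_derive_sum => i; apply: is_derive_scale.
have d1 : is_derive t 1 (fun s : R => s * l i) (l i).
  apply: is_derive_of_eps => e e0; exists 1 => // s _.
  by rewrite /GRing.scale/= -mulrBl subrr normr0 mulr_ge0// ltW.
have d2 := @is_derive1_comp _ expR (fun s : R => s * l i) t _ _ (is_derive_expR _) d1.
have := @is_deriveZ _ _ _ _ (a i) _ _ _ d2.
by rewrite /GRing.scale/= -mulrA (mulrC (l i)).
Qed.

(** If [F] is a primitive of [h], the left slopes of [F - f + 3 e t] are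
    positive, so that the minimum of this function is at the left end. *)
Lemma le_integral_left_slope (f h : R -> R) u v : u < v ->
  {within `[u, v], continuous f} -> {within `[u, v], continuous h} ->
  (forall t, t \in `]u, v[ -> forall e, 0 < e -> exists2 del : R, 0 < del &
     forall s, s \in `[u, v] -> s < t -> t - s < del ->
       f t - f s <= (t - s) * (h t + e)) ->
  ((f v - f u)%:E <= \int[mu]_(t in `[u, v]) (h t)%:E)%E.
Proof.
move=> uv cf ch slope.
have inth : mu.-integrable `[u, v] (EFin \o h).
  by apply: continuous_compact_integrable => //; exact: segment_compact.
pose F x := (\int[mu]_(t in `[u, x]) h t)%R.
have -> : (\int[mu]_(t in `[u, v]) (h t)%:E = (F v)%:E)%E.
  by rewrite /F /Rintegral fineK// integrable_fin_num.
have cF : {within `[u, v], continuous F}.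
  exact: (parameterized_integral_continuous (ltW uv) inth).
have Fu : F u = 0 by rewrite /F set_itv1 Rintegral_set1.
have F' t : t \in `]u, v[ -> is_derive t 1 F (h t).
  move=> tuv; have /andP[ut tv] : u < t < v by move: tuv; rewrite in_itv.
  have ht : {for t, continuous h}.
    by have /(continuous_within_itvP _ uv)[+ _ _] := ch; apply.
  have [dF Ft] := continuous_FTC1_closed tv inth ut ht.
  by rewrite -Ft derive1E; exact: derivableP.
rewrite lee_fin; apply/ler_addgt0Pr => /= e0 e0_gt0.
pose e : R := e0 / (3 * (v - u)); have uv0 : 0 < v - u by rewrite subr_gt0.
have e_gt0 : 0 < e by rewrite divr_gt0// mulr_gt0.
pose k t := F t - f t + 3 * e * t.
have ck : {within `[u, v], continuous k}.
  apply: within_continuousD; first exact: within_continuousB.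
  apply: continuous_subspaceT => x; apply: cvgMr; exact: cvg_id.
have descend t : t \in `]u, v[ -> forall w, u <= w -> w < t ->
    exists2 s, w <= s < t & k s < k t.
  move=> tuv w uw wt; have /andP[ut tv] : u < t < v by move: tuv; rewrite in_itv.
  have [d1 d1_gt0 h1] := slope t tuv e e_gt0.
  have [d2 d2_gt0 h2] := is_derive_eps (F' t tuv) e_gt0.
  pose d : R := Num.min (t - w) (Num.min d1 d2) / 2.
  have d_gt0 : 0 < d by rewrite divr_gt0// !lt_min subr_gt0 wt d1_gt0.
  have [dw [dd1 dd2]] : d < t - w /\ d < d1 /\ d < d2.
    have : d < Num.min (t - w) (Num.min d1 d2).
      by rewrite ltr_pdivrMr// ltr_pMr ?ltr1n// !lt_min subr_gt0 wt d1_gt0.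
    by rewrite !lt_min => /and3P[].
  clearbody d.
  exists (t - d); first by apply/andP; split; lra.
  have ts : t - (t - d) = d by ring.
  have st : (t - d) - t = - d by ring.
  have := h1 (t - d); rewrite ts in_itv/= => /(_ _ _ dd1) H1.
  have := h2 (t - d); rewrite st normrN gtr0_norm// => /(_ dd2).
  rewrite ler_norml => /andP[_].
  have {H1} : f t - f (t - d) <= d * (h t + e).
    by apply: H1; [apply/andP; split|]; lra.
  have ed : 0 < e * d by rewrite mulr_gt0.
  rewrite /k /GRing.scale/=; lra.
have kuw w : u < w -> w < v -> k u <= k w.
  move=> uw wv.
  have ck' : {within `[u, w], continuous k}.
    apply: continuous_subspaceW ck => x; rewrite /= !in_itv/= => /andP[-> xw].
    by rewrite (le_trans xw)// ltW.
  have [t tuw tmin] := EVT_min (ltW uw) ck'.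
  have /andP[ut tw] : u <= t <= w by move: tuw; rewrite in_itv.
  move: ut; rewrite le_eqVlt => /predU1P[->|ut].
    by apply: tmin; rewrite in_itv/= lexx ltW.
  have tuv : t \in `]u, v[ by rewrite in_itv/= ut (le_lt_trans tw).
  have [s /andP[us st] kst] := descend t tuv u (lexx u) ut.
  have := tmin s; rewrite in_itv/= us (le_trans (ltW st) tw) => /(_ isT).
  by rewrite leNgt kst.
have : k u <= k v.
  have /(continuous_within_itvP _ uv)[_ _ kv] := ck.
  apply: (cvgr_to_ge kv); near=> w; apply: kuw.
    by near: w; exact: nbhs_left_gt.
  by near: w; exact: nbhs_left_lt.
rewrite /k Fu; have : e0 = 3 * e * (v - u) by rewrite /e; field; rewrite gt_eqF.
lra.
Unshelve. all: by end_near. Qed.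

End LeftSlope.

(** * Integrals over adjacent intervals *)

Section IntegralCat.
Context {R : realType}.
Notation mu := (@lebesgue_measure R).

Lemma measurable_fun_cat (f : R -> R) (u w v : R) : u <= w -> w <= v ->
  measurable_fun `[u, w] f -> measurable_fun `[w, v] f -> measurable_fun `[u, v] f.
Proof.
move=> uw wv m1 m2; rewrite (@itv_bndbnd_setU _ _ _ (BRight w))//.
apply/measurable_funU => //; split => //; apply: measurable_funS m2 => //.
by apply: subset_itvr; rewrite bnd_simp.
Qed.

Lemma integral_cat (f : R -> R) (u w v : R) : u <= w -> w <= v ->
  measurable_fun `[u, v] f -> (forall t, 0 <= f t) ->
  (\int[mu]_(t in `[u, v]) (f t)%:E
   = \int[mu]_(t in `[u, w]) (f t)%:E + \int[mu]_(t in `[w, v]) (f t)%:E)%E.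
Proof.
move=> uw wv mf f0.
have mf2 : measurable_fun `]w, v] f.
  apply: measurable_funS mf => //.
  by apply: subset_itvr; rewrite bnd_simp.
rewrite -[in RHS](@integral_itv_obnd_cbnd _ w); last exact/measurable_EFinP.
rewrite (@itv_bndbnd_setU _ _ _ (BRight w))//.
rewrite ge0_integral_setU//=.
- by rewrite -itv_bndbnd_setU//; exact/measurable_EFinP.
- by move=> t _; rewrite lee_fin.
- by apply/disj_setPLR => t /=; rewrite !in_itv/= => /andP[_ tw]; rewrite ltNge tw.
Qed.

End IntegralCat.

(** * Frames, states and the order *)

Section FiniteDimensional.
Context {R : realType} {V : jbAlgType R}.
Implicit Types (x y z u v w c d e : V) (a b : R).
Hypothesis Vfin : finite_dimensional V.

Lemma jU_sq x y : jU x y *j jU x y = jU x (jU y (x *j x)).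
Proof. by rewrite -jU_one jU_jU// jU_one. Qed.

Section Calculus.
Variables (m : nat) (c : 'I_m -> V).
Hypothesis cP : complete_orthogonal_idempotents c.

Lemma coi_jU (f g : 'I_m -> R) :
  jU (\sum_i f i *: c i) (\sum_i g i *: c i) = \sum_i (f i ^+ 2 * g i) *: c i.
Proof.
rewrite jUE !(coi_mul cP) scaler_sumr -sumrB; apply: eq_bigr => i _.
by rewrite scalerA -scalerBl; congr (_ *: _); ring.
Qed.

Lemma coi_jU_comp (f g : 'I_m -> R) v :
  jU (\sum_i f i *: c i) (jU (\sum_i g i *: c i) v)
  = jU (\sum_i (f i * g i) *: c i) v.
Proof.
elim/(peirce_ind cP): v => [|x y IHx IHy|i j v]; first by rewrite !jU0.
  by rewrite (jUD _ x y) jUD IHx IHy -jUD.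
by rewrite !(jU_peirce cP) jUZ (jU_peirce cP) scalerA; congr (_ *: _); ring.
Qed.

Lemma coi_jUK (f : 'I_m -> R) v : (forall i, f i != 0) ->
  jU (\sum_i f i *: c i) (jU (\sum_i (f i)^-1 *: c i) v) = v.
Proof.
move=> f0; rewrite coi_jU_comp -[RHS]jU1 -(coi_one cP).
by congr (jU _ v); apply: eq_bigr => i _; rewrite divff ?scale1r.
Qed.

Lemma coi_jU_idem (f : 'I_m -> R) i v :
  jU (c i) (jU (\sum_i f i *: c i) v) = f i ^+ 2 *: jU (c i) v.
Proof.
have ci : c i = \sum_j (i == j)%:R *: c j.
  by rewrite (bigD1 i)//= eqxx scale1r big1 ?addr0// => j; rewrite eq_sym
    => /negPf ->; rewrite scale0r.
rewrite {1}ci coi_jU_comp -jUZl; congr (jU _ v).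
rewrite (bigD1 i)//= eqxx mul1r big1 ?addr0// => j; rewrite eq_sym => /negPf ->.
by rewrite mul0r scale0r.
Qed.

End Calculus.

(** ** Existence of frames *)

Lemma coi_nonzero_bounded : exists M, forall m (c : 'I_m -> V),
  complete_orthogonal_idempotents c -> (forall i, c i != 0) -> (m <= M)%N.
Proof.
have [M MP] := finite_dimensional_dependent Vfin; exists M => m c cP c0.
rewrite leqNgt; apply/negP => /MP -/(_ c)[u u0 uc].
case/negP: u0; apply/eqP/rowP => i; rewrite mxE.
have := coi_mulr cP i (u 0); rewrite uc jmul0r => /esym/eqP.
by rewrite scaler_eq0 (negPf (c0 i)) orbF => /eqP.
Qed.

Lemma coi_nonzero_resolution x : exists m (c : 'I_m -> V) (l : 'I_m -> R),
  [/\ complete_orthogonal_idempotents c, forall i, c i != 0 &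
      x = \sum_i l i *: c i].
Proof.
have [m [c [l [p [cP xE _]]]]] := spectral_resolution x Vfin.
pose A := [pred i | c i != 0].
have restr (f : 'I_m -> R) : \sum_i f i *: c i
    = \sum_(k < #|A|) f (enum_val k) *: c (enum_val k).
  rewrite (bigID A)/= [X in _ + X]big1 ?addr0 => [|i]; last first.
    by rewrite negbK => /eqP ->; rewrite scaler0.
  by rewrite -(big_enum_val (fun i => f i *: c i)); apply: eq_bigl => i; rewrite inE.
exists #|A|, (fun k => c (enum_val k)), (fun k => l (enum_val k)); split.
- case: cP => cc cc0 c1; split=> [i|i j ij|]; first exact: cc.
    by apply: cc0; rewrite (inj_eq enum_val_inj).
  have := restr (fun=> 1); under eq_bigr do rewrite scale1r.
  by under [in RHS]eq_bigr do rewrite scale1r; rewrite c1 => <-.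
- by move=> k; have := enum_valP k; rewrite inE.
- by rewrite xE restr.
Qed.

Lemma idem_summand_eig c d e : jidempotent d -> d *j e = 0 -> c = d + e -> c *j d = d.
Proof. by move=> dd de ->; rewrite jmulDl dd (jmulC e) de addr0. Qed.

(** A complete system with as many nonzero members as possible consists of
    primitive idempotents, since a decomposable member can be split. *)
Lemma frame_resolution x : exists m (c : 'I_m -> V) (l : 'I_m -> R),
  jordan_frame c /\ x = \sum_i l i *: c i.
Proof.
have [M MP] := coi_nonzero_bounded.
pose P m := `[< exists (c : 'I_m -> V) (l : 'I_m -> R),
  [/\ complete_orthogonal_idempotents c, forall i, c i != 0 &
      x = \sum_i l i *: c i] >].
have exP : exists m, P m.
  have [m [c [l h]]] := coi_nonzero_resolution x; exists m.
  by apply/asboolP; exists c, l.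
have leM m : P m -> (m <= M)%N by move=> /asboolP[c [l [cP c0 _]]]; exact: MP c0.
have [m /asboolP[c [l [cP c0 xE]]] maxm] := ex_maxnP exP leM.
exists m, c, l; split=> //; split=> // i; split; [by case: cP|exact: c0|].
move=> [d [e [dd ee d0 e0 [de cE]]]].
suff /maxm : P m.+1 by rewrite ltnn.
apply/asboolP.
pose c' (k : 'I_m.+1) := if unlift ord0 k is Some j
  then if j == i then d else c j else e.
pose l' (k : 'I_m.+1) := if unlift ord0 k is Some j then l j else l i.
have [cc cc0 c1] := cP.
have orth f j : j != i -> c i *j f = f -> f *j c j = 0.
  by move=> ji cf; apply: (@peirce_orth _ _ (c i)) => //; apply: cc0; rewrite eq_sym.
have cd := idem_summand_eig dd de cE.
have ce : c i *j e = e.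
  by apply: (idem_summand_eig ee) (etrans cE (addrC _ _)); rewrite jmulC.
have sum' (f : 'I_m -> R) (f' : 'I_m.+1 -> R) : f' ord0 = f i ->
    (forall j, f' (lift ord0 j) = f j) ->
    \sum_k f' k *: c' k = \sum_j f j *: c j.
  move=> f0 fl; rewrite big_ord_recl /c' unlift_none f0.
  under eq_bigr do rewrite liftK fl.
  rewrite (bigD1 i)//= eqxx [RHS](bigD1 i)//= addrA -scalerDr (addrC e) -cE.
  by congr (_ + _); apply: eq_bigr => j /negPf ->.
exists c', l'; split.
- split.
  + move=> k; rewrite /c'; case: unliftP => [j|] _ //; case: eqP => // _; exact: cc.
  + move=> k k'; rewrite /c'; case: unliftP => [j|] ->; case: unliftP => [j'|] -> //.
    * rewrite (inj_eq lift_inj) => jj'.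
      case: eqP => [ji|/eqP ji]; case: eqP => [ji'|/eqP ji'].
      - by rewrite ji ji' eqxx in jj'.
      - exact: orth.
      - by rewrite jmulC; exact: orth.
      - exact: cc0.
    * by move=> _; case: eqP => [//|/eqP ji]; rewrite jmulC; exact: orth.
    * by move=> _; case: eqP => [_|/eqP ji]; [rewrite jmulC|exact: orth].
  + have := sum' (fun=> 1) (fun=> 1) erefl (fun=> erefl).
    by under eq_bigr do rewrite scale1r; under [in RHS]eq_bigr do rewrite scale1r; rewrite c1.
- by move=> k; rewrite /c'; case: unliftP => [j|] _ //; case: ifP.
- by rewrite xE; apply/esym/sum' => [|j]; rewrite /l' ?unlift_none ?liftK.
Qed.

(** ** The state of a primitive idempotent *)

Lemma jU_idem_id c x : jidempotent c -> c *j x = x -> jU c x = x.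
Proof. by move=> cc cx; rewrite jUE cc !cx; lmod R. Qed.

Lemma peirce1_mul_expn c x n : jidempotent c -> c *j x = x ->
  c *j jexpn x n.+1 = jexpn x n.+1.
Proof.
move=> cc cx; case: n => [|n]; first by rewrite jexpn1.
have -> : jexpn x n.+2 = jU x (jexpn x n) by rewrite jUE jmul_sq_expn -!jexpnS; lmod R.
by rewrite -(jU_idem_id cc cx) jU_jU// jU_idem_eig.
Qed.

(** The spectral idempotents of an [x] fixed by [L_c] lie below [c]. *)
Lemma primitive_peirce1 c x : jprimitive c -> c *j x = x -> exists a, x = a *: c.
Proof.
move=> [cc c0 cprim] cx.
have [m [e [l [p [eP xE pE]]]]] := spectral_resolution x Vfin.
have [ee ee0 _] := eP.
have ce i : l i != 0 -> c *j e i = e i.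
  move=> l0; have : l i *: e i = x *j jhorner (p i) x.
    by rewrite -pE xE jmulC (coi_mulr eP).
  move=> /(congr1 ( *:%R (l i)^-1)); rewrite scalerA mulVf// scale1r => ->.
  rewrite /jhorner jmulZr jmul_sumr; congr (_ *: _); rewrite jmul_sumr.
  by apply: eq_bigr => k _; rewrite !jmulZr -jexpnS peirce1_mul_expn.
have ec i : l i != 0 -> e i != 0 -> e i = c.
  move=> l0 e0; apply/eqP; rewrite -subr_eq0; apply/eqP; apply: contrapT => ec.
  apply: cprim; exists (e i), (c - e i); split=> //.
  - by rewrite /jidempotent jmulBl !jmulBr cc (ce i l0) (jmulC _ c) (ce i l0) ee subrr subr0.
  - by rewrite -opprB oppr_eq0; apply/eqP.
  - by rewrite jmulBr (jmulC _ c) (ce i l0) ee subrr subrKC.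
have [/existsP[i /andP[l0 e0]]|/existsPn none] := boolP [exists i, (l i != 0) && (e i != 0)].
  exists (l i); rewrite xE (bigD1 i)//= (ec i)// big1 ?addr0// => j ji.
  have [->|lj] := eqVneq (l j) 0; first by rewrite scale0r.
  by rewrite -(ce j lj) -(ec i)// ee0 ?scaler0// eq_sym.
exists 0; rewrite scale0r xE big1// => i _; have := none i.
by rewrite negb_and !negbK => /orP[]/eqP ->; rewrite ?scale0r ?scaler0.
Qed.

(** In a matrix algebra [c] projects onto a line, and [jstate c] is the vector
    state of that line. *)
Definition jstate c v : R := xget 0 [set a | jU c v = a *: c].

Lemma jstateE c v : jprimitive c -> jU c v = jstate c v *: c.
Proof.
move=> cP; rewrite /jstate; case: xgetP => // none; have [cc _ _] := cP.
by have [a aE] := primitive_peirce1 cP (jU_idem_eig v cc); have := none a aE.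
Qed.

Lemma jstate_uniq c v a : jprimitive c -> jU c v = a *: c -> jstate c v = a.
Proof.
move=> cP; rewrite jstateE//; case: cP => _ c0 _ /eqP.
by rewrite -subr_eq0 -scalerBl scaler_eq0 (negPf c0) orbF subr_eq0 => /eqP.
Qed.

Lemma jstateD c u v : jprimitive c -> jstate c (u + v) = jstate c u + jstate c v.
Proof. by move=> cP; apply: jstate_uniq => //; rewrite jUD scalerDl !jstateE. Qed.

Lemma jstateZ c a v : jprimitive c -> jstate c (a *: v) = a * jstate c v.
Proof. by move=> cP; apply: jstate_uniq => //; rewrite jUZ jstateE// scalerA. Qed.

Lemma jstateN c v : jprimitive c -> jstate c (- v) = - jstate c v.
Proof. by move=> cP; rewrite -scaleN1r jstateZ// mulN1r. Qed.

Lemma jstateB c u v : jprimitive c -> jstate c (u - v) = jstate c u - jstate c v.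
Proof. by move=> cP; rewrite jstateD ?jstateN. Qed.

Lemma jstate0 c : jprimitive c -> jstate c 0 = 0.
Proof. by move=> cP; apply: jstate_uniq; rewrite ?jU0 ?scale0r. Qed.

Lemma jstate_sum c I (r : seq I) (P : pred I) (F : I -> V) : jprimitive c ->
  jstate c (\sum_(i <- r | P i) F i) = \sum_(i <- r | P i) jstate c (F i).
Proof.
by move=> cP; elim/big_rec2: _ => [|i u w _ <-]; rewrite ?jstate0 ?jstateD.
Qed.

Lemma jstate1 c : jprimitive c -> jstate c jone = 1.
Proof.
by move=> cP; apply: jstate_uniq => //; rewrite jU_one scale1r; case: cP.
Qed.

Lemma jstate_frame m (c : 'I_m -> V) (l : 'I_m -> R) i : jordan_frame c ->
  jstate (c i) (\sum_j l j *: c j) = l i.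
Proof.
move=> [cP cprim]; apply: jstate_uniq => //.
have [cc _ _] := cP; rewrite jUE cc (coi_mulr cP) jmulZr cc; lmod R.
Qed.

(** Transition probabilities are symmetric: [U_c U_d U_c = U_(U_c d)],
    evaluated at [c], gives [w_d(c) w_c(d) = w_c(d)^2]. *)
Lemma jstateC c d : jprimitive c -> jprimitive d -> jstate c d = jstate d c.
Proof.
move=> cP dP; have [cc c0 _] := cP; have [dd d0 _] := dP.
have prod u v : jprimitive u -> jprimitive v ->
    jstate u v ^+ 2 = jstate v u * jstate u v.
  move=> uP vP; have [uu u0 _] := uP.
  have := jU_jU u v u Vfin; rewrite (jstateE v uP) jUZl.
  have Uuu : jU u u = u by apply: jU_idem_id.
  rewrite Uuu (jstateE u vP) jUZ (jstateE v uP) scalerA => /eqP.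
  by rewrite -subr_eq0 -scalerBl scaler_eq0 (negPf u0) orbF subr_eq0 => /eqP.
have h1 := prod c d cP dP; have h2 := prod d c dP cP.
have [cd0|cd0] := eqVneq (jstate c d) 0.
  by apply/esym/eqP; move/eqP: h2; rewrite cd0 mul0r expf_eq0 /= => /eqP ->.
by apply: (mulIf cd0); rewrite -h1 expr2.
Qed.

(** ** Positivity *)

(** If [c u = u / 2] then [u^2 = alpha c + b] with [c b = 0]; by orthogonality
    [alpha] is annihilated by each polynomial that annihilates [u^2], hence is
    the square of an eigenvalue of [u]. *)
Lemma jstate_sq_half c u : jprimitive c -> c *j u = 2^-1 *: u ->
  0 <= jstate c (u *j u).
Proof.
move=> cP cu; have [cc c0 _] := cP; pose x := u *j u; pose q := c *j x.
have cq : c *j q = q.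
  have := jmul_triple u u c c; rewrite -/x cc (jmulC u c) cu !jmulE cu !jmulE.
  rewrite -/x (jmulC (x *j c) c) (jmulC x c) -/q => ->; lmod_with R ltac:(by field).
have [a qE] := primitive_peirce1 cP cq.
have ca : jstate c x = a.
  by apply: jstate_uniq; rewrite // jUE cc -/q cq qE; lmod R.
pose b := x - q; have cb : c *j b = 0 by rewrite jmulBr cq subrr.
have xE : x = a *: c + b by rewrite -qE subrKC.
clearbody b.
have xc : x *j c = a *: c by rewrite jmulC -/q qE.
have xxc : (x *j x) *j c = a ^+ 2 *: c.
  have -> : x *j x = a ^+ 2 *: c + b *j b.
    by rewrite xE !jmulE cc (jmulC b c) cb; lmod R.
  rewrite jmulDl jmulZl cc (jmulC (b *j b)) (orth_idem_comm b cc cb) cb jmul0r.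
  by rewrite addr0.
have expc k : jexpn x k *j c = a ^+ k *: c.
  elim/ltn_ind: k => -[|[|k]] IH; first by rewrite jmul1 scale1r.
    by rewrite jexpn1 expr1.
  rewrite jmul_expnSS xc (jmulZr _ (jexpn x k)) (jmulZr _ (jexpn x k.+1)).
  rewrite (IH k) 1?ltnW// (IH k.+1)// !jmulZr xxc xc !scalerA.
  by rewrite -scalerDl -scalerBl; congr (_ *: _); rewrite !exprS; ring.
have [m [e [l [p [eP uE _]]]]] := spectral_resolution u Vfin.
pose P := \prod_(i < m) ('X - (l i ^+ 2)%:P).
have Px : jhorner P x = 0.
  rewrite /x uE (coi_mul eP) (coi_horner eP) big1// => i _.
  by rewrite /P horner_prod (bigD1 i)//= !hornerE expr2 subrr mul0r scale0r.
have : P.[a] *: c = 0.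
  rewrite -[RHS](jmul0l c) -Px /jhorner jmul_suml horner_coef scaler_suml.
  by apply: eq_bigr => k _; rewrite jmulZl expc scalerA.
move=> /eqP; rewrite scaler_eq0 (negPf c0) orbF horner_prod => /eqP/eqP.
rewrite prodf_seq_eq0 => /hasP[i _ /=]; rewrite !hornerE subr_eq0 ca => /eqP ->.
by rewrite sqr_ge0.
Qed.

(** The cross terms of the square of the Peirce decomposition of [y] do not
    reach the component of [c]. *)
Lemma jstate_sq c y : jprimitive c -> 0 <= jstate c (y *j y).
Proof.
move=> cP; have [cc c0 _] := cP.
have [b bE] : exists b, jU c y = b *: c.
  by exists (jstate c y); exact: jstateE.
pose u := 4 *: (c *j y) - 4 *: (c *j (c *j y)); pose w := y - b *: c - u.
have cub := peirce_cubic y cc.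
have cu : c *j u = 2^-1 *: u.
  have -> : c *j u = 4 *: (c *j (c *j y)) - 2 *: (2 *: (c *j (c *j (c *j y)))).
    by rewrite !jmulE; lmod R.
  by rewrite cub /u; lmod_with R ltac:(by field).
have cw : c *j w = 0.
  rewrite /w jmulBr (jmulBr y) cu -[b *: c]bE (jU_idem_eig y cc) jUE cc /u.
  by lmod_with R ltac:(by field).
have yE : y = b *: c + u + w by rewrite /w; lmod R.
clearbody u w.
have cuw : c *j (u *j w) = 2^-1 *: (u *j w).
  by rewrite (jmulC u) (orth_idem_comm u cc cw) cu jmulZr.
have cww : c *j (w *j w) = 0 by rewrite (orth_idem_comm w cc cw) cw jmul0r.
have half0 v : c *j v = 2^-1 *: v -> jstate c v = 0.
  move=> cv; apply: jstate_uniq; rewrite // jUE cc cv jmulZr cv.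
  by lmod_with R ltac:(by field).
have -> : y *j y = b ^+ 2 *: c + u *j u + w *j w + (b *: u + 2 *: (u *j w)).
  rewrite yE !jmulE cc (jmulC u c) (jmulC w c) cu cw (jmulC w u).
  by lmod_with R ltac:(by field).
rewrite !(jstateD _ _ cP) !(jstateZ _ _ cP) (half0 u)// (half0 (u *j w))//.
rewrite !mulr0 !addr0 (@jstate_uniq c c 1)//; last first.
  by rewrite scale1r jU_idem_id.
rewrite (@jstate_uniq c (w *j w) 0)//; last by rewrite jUE cww jmul0r cc cww; lmod R.
by rewrite mulr1 addr0 addr_ge0 ?sqr_ge0// jstate_sq_half.
Qed.

Lemma jstate_idem_ge0 c d : jprimitive c -> jidempotent d -> 0 <= jstate c d.
Proof. by move=> cP dd; rewrite -[d]dd jstate_sq. Qed.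

(** ** Invariance of the number and multiplicities of eigenvalues *)

Lemma transition_row m (d : 'I_m -> V) c : jprimitive c -> jordan_frame d ->
  \sum_j jstate c (d j) = 1.
Proof. by move=> cP [dP _]; rewrite -jstate_sum// (coi_one dP) jstate1. Qed.

Lemma transition_col m (d : 'I_m -> V) c : jprimitive c -> jordan_frame d ->
  \sum_j jstate (d j) c = 1.
Proof.
move=> cP dP; rewrite -(transition_row cP dP); apply: eq_bigr => j _.
by rewrite jstateC//; case: dP.
Qed.

(** Both numbers are the sum of all transition probabilities. *)
Lemma frame_size m k (c : 'I_m -> V) (d : 'I_k -> V) :
  jordan_frame c -> jordan_frame d -> m = k.
Proof.
move=> cP dP; apply/eqP; rewrite -(eqr_nat R).
have sumk (p : nat) : p%:R = \sum_(i < p) 1 :> R.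
  by rewrite sumr_const card_ord.
rewrite !sumk; apply/eqP; transitivity (\sum_i \sum_j jstate (c i) (d j)).
  by apply: eq_bigr => i _; rewrite transition_row//; case: cP.
rewrite exchange_big/=; apply: eq_bigr => j _.
by rewrite transition_col//; case: dP.
Qed.

(** The multiplicity of an eigenvalue is the trace [\sum_i jstate (c i)] of its
    spectral idempotent, and this trace is independent of the frame. *)
Lemma frame_eigenvalues_perm m (c d : 'I_m -> V) (l l' : 'I_m -> R) :
  jordan_frame c -> jordan_frame d ->
  \sum_i l i *: c i = \sum_i l' i *: d i -> perm_eq (codom l) (codom l').
Proof.
move=> cP dP ld; apply/allP => r _ /=; rewrite -(eqr_nat R); apply/eqP.
pose f s : R := (s == r)%:R.
have count_sum (g : 'I_m -> R) : (count_mem r (codom g))%:R = \sum_i f (g i).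
  rewrite /codom/image_mem count_map -sum1_count natr_sum big_mkcond/= big_enum/=.
  by apply: eq_bigr => i _; rewrite /f; case: eqP.
rewrite !count_sum; have [cC cprim] := cP; have [dC dprim] := dP.
have fE : \sum_i f (l i) *: c i = \sum_i f (l' i) *: d i.
  by rewrite -(jfunE f l cC) ld (jfunE f l' dC).
transitivity (\sum_i jstate (c i) (\sum_j f (l j) *: c j)).
  by apply: eq_bigr => i _; rewrite jstate_frame.
rewrite fE; under eq_bigr => i _.
  rewrite jstate_sum//; under eq_bigr => j _ do rewrite jstateZ//.
  over.
rewrite exchange_big/=; apply: eq_bigr => j _.
by rewrite -mulr_sumr transition_col// mulr1.
Qed.

(** * The cone, the functional calculus and automorphisms *)

Variable n : nat.
Hypothesis Vrank : jrank_is V n.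
Implicit Types p q : V.

Lemma spectral x : exists (c : 'I_n -> V) (l : 'I_n -> R),
  jordan_frame c /\ x = \sum_i l i *: c i.
Proof.
have [m [c [l [cP xE]]]] := frame_resolution x; have [d dP] := Vrank.
by move: (frame_size cP dP) => mn; subst m; exists c, l.
Qed.

Definition jge0 x : Prop := forall e, jprimitive e -> 0 <= jstate e x.

Section FrameExpansion.
Variables (c : 'I_n -> V).
Hypothesis cP : jordan_frame c.

Let cC : complete_orthogonal_idempotents c. Proof. by case: cP. Qed.
Let cprim i : jprimitive (c i). Proof. by case: cP. Qed.
Let c0 i : c i != 0. Proof. by case: (cprim i). Qed.

Lemma frame_jstate e (l : 'I_n -> R) : jprimitive e ->
  jstate e (\sum_i l i *: c i) = \sum_i l i * jstate e (c i).
Proof. by move=> eP; rewrite jstate_sum//; apply: eq_bigr => i _; rewrite jstateZ. Qed.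

Lemma transition_ge0 e i : jprimitive e -> 0 <= jstate e (c i).
Proof. by move=> eP; apply: jstate_idem_ge0 => //; case: cC. Qed.

Lemma frame_jstate_ge e (l : 'I_n -> R) r : jprimitive e -> (forall i, r <= l i) ->
  r <= jstate e (\sum_i l i *: c i).
Proof.
move=> eP rl; rewrite frame_jstate// -[leLHS]mulr1 -(transition_row eP cP) mulr_sumr.
by apply: ler_sum => i _; rewrite ler_wpM2r// transition_ge0.
Qed.

Lemma frame_jstate_le e (l : 'I_n -> R) r : jprimitive e -> (forall i, l i <= r) ->
  jstate e (\sum_i l i *: c i) <= r.
Proof.
move=> eP rl; rewrite frame_jstate// -[leRHS]mulr1 -(transition_row eP cP) mulr_sumr.
by apply: ler_sum => i _; rewrite ler_wpM2r// transition_ge0.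
Qed.

(** ** The norm is the spectral norm *)

Lemma idem_norm e : jidempotent e -> `|e| <= 1.
Proof.
move=> ee; have := normJ2 e; rewrite ee => /eqP.
rewrite expr2 -subr_eq0 -{1}[`|e|]mulr1 -mulrBr mulf_eq0 => /orP[/eqP -> //|].
by rewrite subr_eq0 => /eqP <-.
Qed.

Lemma idem_norm1 e : jidempotent e -> e != 0 -> `|e| = 1.
Proof.
move=> ee e0; apply: (@mulIf _ `|e|); first by rewrite normr_eq0.
by rewrite mul1r -expr2 -normJ2 ee.
Qed.

Lemma jone_norm : `|jone : V| <= 1.
Proof. by apply: idem_norm; exact: jmul1. Qed.

(** [x^2] is completed by a square to [r^2 1], so that the axiom on sums of
    squares applies. *)
Lemma frame_norm_le (l : 'I_n -> R) r : 0 <= r -> (forall i, `|l i| <= r) ->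
  `|\sum_i l i *: c i| <= r.
Proof.
move=> r0 lr; rewrite -(@ler_pXn2r _ 2) ?nnegrE// -normJ2.
pose y := \sum_i Num.sqrt (r ^+ 2 - l i ^+ 2) *: c i.
apply: (le_trans (normJ2D _ y)); rewrite !(coi_mul cC) -big_split/=.
under eq_bigr => i _.
  rewrite -scalerDl -!expr2 sqr_sqrtr ?subrKC; last first.
    by rewrite subr_ge0 -real_normK ?num_real// ler_pXn2r ?nnegrE.
  over.
rewrite (coi_const cC) normrZ ger0_norm ?sqr_ge0//.
by rewrite -[leRHS]mulr1 ler_wpM2l ?sqr_ge0 ?jone_norm.
Qed.

Lemma frame_norm_ge (l : 'I_n -> R) i : `|l i| <= `|\sum_j l j *: c j|.
Proof.
have [cc _ _] := cC; have := normJM (c i) (\sum_j l j *: c j).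
by rewrite (coi_mulr cC) normrZ (idem_norm1 (cc i)) ?c0// mulr1 mul1r.
Qed.

(** ** Inverses and the spectrum *)

Lemma frame_is_jinv (l : 'I_n -> R) : (forall i, l i != 0) ->
  is_jinv (\sum_i l i *: c i) (\sum_i (l i)^-1 *: c i).
Proof.
move=> l0; split; rewrite !(coi_mul cC).
  by under eq_bigr do rewrite divff//; rewrite (coi_const cC) scale1r.
by apply: eq_bigr => i _; rewrite mulfK.
Qed.

End FrameExpansion.

Lemma is_jinv_jU x y : is_jinv x y -> jU x y = x.
Proof. by move=> [xy xxy]; rewrite jUE xy jmul1r xxy; lmod R. Qed.

(** [L_(x^2)] commutes with [L_y], so that [x^2 y^2 = y (x^2 y) = 1]; the other
    term [x (x y^2)] of [U_x y^2] is given by [jmul_triple]. *)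
Lemma is_jinv_jU_sq x y : is_jinv x y -> jU x (y *j y) = jone.
Proof.
move=> [xy xxy]; have yx : y *j x = jone by rewrite jmulC.
have comm v : (x *j x) *j (y *j v) = y *j ((x *j x) *j v).
  apply/eqP; rewrite -subr_eq0 (jmul_comm2 x y v) xy !jmul1 subrr.
  by rewrite scaler0.
have x2y2 : (x *j x) *j (y *j y) = jone by rewrite comm xxy.
have := jmul_triple y y x x; rewrite (jmulC (y *j y) (x *j x)) x2y2 yx !jmul1 jmul1r yx.
by move=> h; rewrite jUE x2y2 (jmulC x (y *j y)) (jmulC x (_ *j x)) h; lmod R.
Qed.

Lemma is_jinv_neq0 (c : 'I_n -> V) (l : 'I_n -> R) y i : jordan_frame c ->
  is_jinv (\sum_j l j *: c j) y -> l i != 0.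
Proof.
move=> [cC cprim] xy; apply/negP => /eqP li; have [_ ci0 _] := cprim i.
case/negP: ci0; rewrite -[c i]jU1 -(is_jinv_jU_sq xy) jU_jU//.
rewrite (_ : jU _ (c i) = 0) ?jU0//.
rewrite jUE (jmulC _ (c i)) (coi_mul cC) (jmulC _ (c i)) !(coi_mulr cC) li.
by rewrite mul0r !scale0r jmul0r scaler0 subrr.
Qed.

Lemma frame_jcone (c : 'I_n -> V) (l : 'I_n -> R) : jordan_frame c ->
  jcone (\sum_j l j *: c j) <-> forall i, 0 < l i.
Proof.
move=> cP; have [cC cprim] := cP.
have shift r : \sum_j l j *: c j - r *: jone = \sum_j (l j - r) *: c j.
  by rewrite -(coi_const cC) -sumrB; apply: eq_bigr => j _; rewrite scalerBl.
split=> [cone i|l0 r /=].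
  apply: cone => /= -[y]; rewrite shift => /(is_jinv_neq0 i cP).
  by rewrite subrr eqxx.
move=> noinv; rewrite ltNge; apply/negP => r0; apply: noinv.
exists (\sum_i (l i - r)^-1 *: c i); rewrite shift; apply: frame_is_jinv => // i.
by rewrite gt_eqF// subr_gt0 (le_lt_trans r0).
Qed.

Lemma spectral_jcone x : jcone x -> exists (c : 'I_n -> V) (l : 'I_n -> R),
  [/\ jordan_frame c, x = \sum_i l i *: c i & forall i, 0 < l i].
Proof.
move=> xcone; have [c [l [cP xE]]] := spectral x; exists c, l; split=> //.
by apply/(frame_jcone l cP); rewrite -xE.
Qed.

(** Eigenvalues are values of states, and the value of a state is a weighted
    mean of eigenvalues. *)
Lemma jconeP x : jcone x <->
  exists2 d : R, 0 < d & forall e, jprimitive e -> d <= jstate e x.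
Proof.
split=> [/spectral_jcone[c [l [cP -> l0]]]|[d d0 dx]].
  have [m m0 ml] : exists2 m : R, 0 < m & forall i, m <= l i.
    exists (\big[Num.min/1]_i l i); first by apply: lt_bigmin.
    by move=> i; apply: bigmin_le_cond.
  by exists m => // e eP; apply: frame_jstate_ge.
have [c [l [cP xE]]] := spectral x; rewrite xE; apply/(frame_jcone l cP) => i.
have [_ cprim] := cP.
by rewrite -(jstate_frame l i cP) -xE (lt_le_trans d0)// dx.
Qed.

Lemma jstate_norm e x : jprimitive e -> `|jstate e x| <= `|x|.
Proof.
move=> eP; have [c [l [cP ->]]] := spectral x.
rewrite ler_norml frame_jstate_ge ?frame_jstate_le// => i.
  by have := frame_norm_ge cP l i; rewrite ler_norml => /andP[].
by have := frame_norm_ge cP l i; rewrite ler_norml => /andP[].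
Qed.

(** ** Positivity of the quadratic representation *)

(** For [d] primitive, [w = U_a d] satisfies [w^2 = jstate d (a^2) w], so that
    it is a nonnegative multiple of a square. *)
Lemma jU_ge0 (a x : V) : jge0 x -> jge0 (jU a x).
Proof.
move=> x0 e eP; have [c [l [cP xE]]] := spectral x; have [cC cprim] := cP.
rewrite xE jU_sum jstate_sum// sumr_ge0// => i _; rewrite jUZ jstateZ//.
have l0 : 0 <= l i by rewrite -(jstate_frame l i cP) -xE x0.
rewrite mulr_ge0//; set w := jU a (c i).
have wE : w *j w = jstate (c i) (a *j a) *: w.
  rewrite /w jU_sq; have [cc _ _] := cC.
  by rewrite (jstateE _ (cprim i)) jUZ.
set t := jstate _ _ in wE; have t0 : 0 <= t by apply: jstate_sq.
have [t_0|tn0] := eqVneq t 0.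
  by move: wE; rewrite t_0 scale0r => /jsq_eq0 ->; rewrite jstate0.
have -> : w = t^-1 *: (w *j w) by rewrite wE scalerA mulVf// scale1r.
by rewrite jstateZ// mulr_ge0 ?invr_ge0 ?jstate_sq.
Qed.

Lemma jU_cone (c : 'I_n -> V) (f : 'I_n -> R) x : jordan_frame c ->
  (forall i, f i != 0) -> jcone x -> jcone (jU (\sum_i f i *: c i) x).
Proof.
move=> cP f0 /jconeP[d d0 dx]; have [cC cprim] := cP; set a := \sum_i _.
have [m m0 ml] : exists2 m : R, 0 < m & forall i, m <= f i ^+ 2.
  exists (\big[Num.min/1]_i (f i ^+ 2)).
    by apply: lt_bigmin => [|i _]; rewrite ?ltr01 // exprn_even_gt0 //= f0.
  by move=> i; apply: bigmin_le_cond.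
apply/jconeP; exists (d * m); first by rewrite mulr_gt0.
move=> e eP; have x_ge : jge0 (x - d *: jone).
  by move=> e' e'P; rewrite jstateB// jstateZ// jstate1// mulr1 subr_ge0 dx.
have := jU_ge0 a x_ge eP; rewrite jUB jUZ jU_one jstateB// jstateZ// subr_ge0.
apply: le_trans; rewrite ler_pM2l// /a (coi_mul cC).
by apply: (frame_jstate_ge cP) => // i; rewrite -expr2.
Qed.

(** ** Powers, exponential and logarithm *)

Definition jlog x : V := jfun (@ln R) x.

Notation sqrtj p := (jpow p 2^-1).
Notation isqrtj p := (jpow p (- 2^-1)).

Section FramePowers.
Variables (c : 'I_n -> V) (l : 'I_n -> R).
Hypotheses (cP : jordan_frame c) (l0 : forall i, 0 < l i).
Let p := \sum_i l i *: c i.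
Let cC : complete_orthogonal_idempotents c. Proof. by case: cP. Qed.

Lemma frame_sqrt : sqrtj p = \sum_i Num.sqrt (l i) *: c i.
Proof.
rewrite /p /jpow jfunE//; apply: eq_bigr => i _.
by rewrite powR12_sqrt// ltW.
Qed.

Lemma frame_isqrt : isqrtj p = \sum_i (Num.sqrt (l i))^-1 *: c i.
Proof.
rewrite /p /jpow jfunE//; apply: eq_bigr => i _.
by rewrite powRN powR12_sqrt// ltW.
Qed.

Lemma sqrt_neq0 i : Num.sqrt (l i) != 0.
Proof. by rewrite gt_eqF// sqrtr_gt0. Qed.

End FramePowers.

Lemma frame_exp (c : 'I_n -> V) (l : 'I_n -> R) : jordan_frame c ->
  jexp (\sum_i l i *: c i) = \sum_i expR (l i) *: c i.
Proof. by move=> [cC _]; rewrite /jexp jfunE. Qed.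

Lemma frame_log (c : 'I_n -> V) (l : 'I_n -> R) : jordan_frame c ->
  jlog (\sum_i l i *: c i) = \sum_i ln (l i) *: c i.
Proof. by move=> [cC _]; rewrite /jlog jfunE. Qed.

Lemma sqrt_isqrtK p v : jcone p -> jU (sqrtj p) (jU (isqrtj p) v) = v.
Proof.
move=> /spectral_jcone[c [l [cP -> l0]]]; have [cC _] := cP.
by rewrite frame_sqrt// frame_isqrt// coi_jUK// => i; exact: sqrt_neq0.
Qed.

Lemma isqrt_sqrtK p v : jcone p -> jU (isqrtj p) (jU (sqrtj p) v) = v.
Proof.
move=> /spectral_jcone[c [l [cP -> l0]]]; have [cC _] := cP.
rewrite frame_sqrt// frame_isqrt// coi_jU_comp//.
rewrite (_ : \sum_i _ = jone) ?jU1//.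
under eq_bigr do rewrite mulVf ?sqrt_neq0//.
by rewrite (coi_const cC) scale1r.
Qed.

Lemma jU_sqrt_one p : jcone p -> jU (sqrtj p) jone = p.
Proof.
move=> /spectral_jcone[c [l [cP -> l0]]]; have [cC _] := cP.
rewrite frame_sqrt// jU_one coi_mul//; apply: eq_bigr => i _.
by rewrite -expr2 sqr_sqrtr// ltW.
Qed.

Lemma jU_isqrt p : jcone p -> jU (isqrtj p) p = jone.
Proof. by move=> pcone; rewrite -{2}(jU_sqrt_one pcone) isqrt_sqrtK. Qed.

Lemma jU_sqrt_cone p x : jcone p -> jcone x -> jcone (jU (sqrtj p) x).
Proof.
move=> /spectral_jcone[c [l [cP -> l0]]]; rewrite frame_sqrt//.
by apply: jU_cone => // i; exact: sqrt_neq0.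
Qed.

Lemma jU_isqrt_cone p x : jcone p -> jcone x -> jcone (jU (isqrtj p) x).
Proof.
move=> /spectral_jcone[c [l [cP -> l0]]]; rewrite frame_isqrt//.
by apply: jU_cone => // i; rewrite invr_eq0 sqrt_neq0.
Qed.

Lemma jone_cone : jcone (jone : V).
Proof.
apply/jconeP; exists 1; first exact: ltr01.
by move=> e eP; rewrite jstate1.
Qed.

Lemma jexp_cone x : jcone (jexp x).
Proof.
have [c [l [cP ->]]] := spectral x; rewrite frame_exp//.
by apply/frame_jcone => // i; exact: expR_gt0.
Qed.

Lemma jexpK x : jlog (jexp x) = x.
Proof.
have [c [l [cP ->]]] := spectral x; rewrite frame_exp// frame_log//.
by apply: eq_bigr => i _; rewrite expRK.
Qed.

Lemma jlogK x : jcone x -> jexp (jlog x) = x.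
Proof.
move=> /spectral_jcone[c [l [cP -> l0]]]; rewrite frame_log// frame_exp//.
by apply: eq_bigr => i _; rewrite lnK ?posrE.
Qed.

(** ** Automorphisms *)

Definition jautomorphism (k : V -> V) : Prop :=
  [/\ forall x y, k (x + y) = k x + k y, forall a x, k (a *: x) = a *: k x,
      forall x y, k (x *j y) = k x *j k y &
      exists k', (forall x, k (k' x) = x) /\ forall x, k' (k x) = x].

(** [k = U_a U_b U_c] has the transpose [k' = U_c U_b U_a] with respect to the
    fundamental formula: [U_(k x) = k U_x k']. When [k 1 = 1] this makes [k']
    the inverse of [k], so that [(k x)^2 = k U_x k' 1 = k (x^2)]. *)
Lemma jU3_automorphism (a b c : V) : jU a (jU b (jU c jone)) = jone ->
  injective (jU a) -> injective (jU b) -> injective (jU c) ->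
  jautomorphism (fun v => jU a (jU b (jU c v))).
Proof.
move=> k1 ainj binj cinj; pose k v := jU a (jU b (jU c v)).
pose k' v := jU c (jU b (jU a v)).
have Uk x v : jU (k x) v = k (jU x (k' v)) by rewrite /k !jU_jU.
have kk' v : k (k' v) = v by rewrite -[RHS]jU1 -k1 -/(k _) Uk jU1.
have kinj : injective k by move=> x y /ainj/binj/cinj.
have k'k v : k' (k v) = v by apply: kinj; rewrite kk'.
have kD x y : k (x + y) = k x + k y by rewrite /k !jUD.
have kZ t x : k (t *: x) = t *: k x by rewrite /k !jUZ.
have ksq x : k (x *j x) = k x *j k x.
  rewrite -[RHS]jU_one Uk; have <- : jone = k' jone by rewrite -{2}k1 -/(k _) k'k.
  by rewrite jU_one.
rewrite -/k; clearbody k k'; split=> //; last by exists k'.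
move=> x y; have h := ksq (x + y); apply: scalerI2.
transitivity (k ((x + y) *j (x + y)) - k (x *j x) - k (y *j y)).
  by rewrite !(jmulDl, jmulDr) (jmulC y x) !kD; lmod R.
by rewrite h kD !ksq !(jmulDl, jmulDr) (jmulC (k y)); lmod R.
Qed.

Section Automorphism.
Variable k : V -> V.
Hypothesis kP : jautomorphism k.

Lemma jaut_inj : injective k.
Proof. by case: kP => _ _ _ [k' [_ k'k]]; exact: can_inj k'k. Qed.

Lemma jaut0 : k 0 = 0.
Proof. by case: kP => _ kZ _ _; rewrite -(scale0r 0) kZ !scale0r. Qed.

Lemma jaut1 : k jone = jone.
Proof.
case: kP => _ _ kM [k' [kk' _]].
by rewrite -[LHS]jmul1r -{2}(kk' jone) -kM jmul1 kk'.
Qed.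

Lemma jaut_sum m (l : 'I_m -> R) (c : 'I_m -> V) :
  k (\sum_i l i *: c i) = \sum_i l i *: k (c i).
Proof.
case: kP => kD kZ _ _.
by elim/big_rec2: _ => [|i x y _ <-]; rewrite ?jaut0// kD kZ.
Qed.

Lemma jaut_frame m (c : 'I_m -> V) : jordan_frame c -> jordan_frame (k \o c).
Proof.
case: kP => kD kZ kM [k' [kk' k'k]] [[cc cc0 c1] cprim].
have idem' e : jidempotent e -> jidempotent (k' e).
  by move=> ee; apply: jaut_inj; rewrite kM kk'.
have neq0' e : e != 0 -> k' e != 0.
  by apply: contra_neq => e0; rewrite -(kk' e) e0 jaut0.
split; first split=> [i|i j ij|].
- by rewrite /jidempotent /= -kM cc.
- by rewrite /= -kM cc0// jaut0.
- have := jaut_sum (fun=> 1) c; under eq_bigr do rewrite scale1r.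
  by under [in RHS]eq_bigr do rewrite scale1r; rewrite c1 jaut1 => <-.
move=> i; have [ci ci0 cip] := cprim i; split=> /=.
- by rewrite /jidempotent -kM ci.
- by apply: contra_neq ci0 => h; apply: jaut_inj; rewrite jaut0.
move=> [d [e [dd ee d0 e0 [de cE]]]]; apply: cip; exists (k' d), (k' e).
split; [exact: idem'|exact: idem'|exact: neq0'|exact: neq0'|split].
  by apply: jaut_inj; rewrite kM !kk' jaut0.
by apply: jaut_inj; rewrite kD !kk'.
Qed.

Lemma jaut_fun f x : k (jfun f x) = jfun f (k x).
Proof.
have [c [l [cP ->]]] := spectral x; have [cC _] := cP.
have [kC _] := jaut_frame cP.
by rewrite jfunE// !jaut_sum (jfunE f l kC).
Qed.

Lemma jaut_norm_le x : `|k x| <= `|x|.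
Proof.
have [c [l [cP ->]]] := spectral x; rewrite jaut_sum.
by apply: frame_norm_le (jaut_frame cP) _ _ _ _ => // i; exact: frame_norm_ge.
Qed.

End Automorphism.

(** * Gauge norms and the distance *)

Variable phi : 'rV[R]_n -> R.
Hypothesis phi_gauge : symmetric_gauge phi.
Notation N := (@gauge_norm R V n phi).

Lemma gauge_normE (c : 'I_n -> V) (l : 'I_n -> R) : jordan_frame c ->
  N (\sum_i l i *: c i) = phi (\row_i l i).
Proof.
move=> cP; set x := \sum_i _; set L := jeigenvalues n x.
have [d [dP xE]] : exists d : 'I_n -> V, jordan_frame d /\ x = \sum_i L 0 i *: d i.
  rewrite /L /jeigenvalues; case: xgetP => [y _ [d [dP xE]]|/(_ (\row_i l i))[]].
    by exists d.
  by exists c; split=> //; apply: eq_bigr => i _; rewrite mxE.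
have lL : perm_eq (codom l) (codom (L 0)) by exact: (frame_eigenvalues_perm cP dP).
rewrite /gauge_norm /jsingular_values -/L.
set s := sort _ _.
have s_size : size s = n by rewrite size_sort size_map size_enum_ord.
have sE : codom ((\row_(i < n) nth 0 s i : 'rV_n) 0) = s.
  apply: (@eq_from_nth _ 0); first by rewrite size_codom card_ord s_size.
  move=> i; rewrite size_codom card_ord => ilt.
  rewrite (nth_map (Ordinal ilt)) ?size_enum_ord// mxE.
  by rewrite (nth_ord_enum _ (Ordinal ilt)).
have LE : codom ((\row_i `|L 0 i| : 'rV_n) 0) = [seq `|L 0 j| | j <- enum 'I_n].
  by apply: eq_map => i; rewrite mxE.
rewrite (@gauge_perm_eq _ _ _ phi_gauge _ (\row_i `|L 0 i|)).
  rewrite gauge_abs//; apply: gauge_perm_eq => //; rewrite perm_sym.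
  by rewrite (_ : codom _ = codom l)//; apply: eq_map => i; rewrite mxE.
by rewrite sE LE /s perm_sort.
Qed.

Lemma gauge_norm_state (c : 'I_n -> V) x : jordan_frame c ->
  phi (\row_i jstate (c i) x) <= N x.
Proof.
move=> cP; have [d [l [dP ->]]] := spectral x; rewrite gauge_normE//.
have [_ cprim] := cP; have [_ dprim] := dP.
have -> : \row_i jstate (c i) (\sum_i l i *: d i)
    = mxact (fun i j => jstate (c i) (d j)) (\row_i l i).
  apply/rowP => i; rewrite !mxE (frame_jstate _ _ (cprim i)).
  by apply: eq_bigr => j _; rewrite mxE mulrC.
apply: gauge_doubly_stochastic => //; split=> [i j|i|j].
- exact: transition_ge0.
- exact: transition_row.
- exact: transition_col.
Qed.

Lemma gauge_normD x y : N (x + y) <= N x + N y.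
Proof.
have [c [l [cP xyE]]] := spectral (x + y); have [_ cprim] := cP.
rewrite [in leLHS]xyE gauge_normE//.
have -> : \row_i l i = \row_i jstate (c i) x + \row_i jstate (c i) y.
  by apply/rowP => i; rewrite !mxE -jstateD// xyE jstate_frame.
by rewrite (le_trans (gaugeD phi_gauge _ _))// lerD// gauge_norm_state.
Qed.

Lemma gauge_normZ a x : N (a *: x) = `|a| * N x.
Proof.
have [c [l [cP ->]]] := spectral x; rewrite scaler_sumr.
under eq_bigr do rewrite scalerA.
rewrite !gauge_normE// -(gaugeZ phi_gauge); congr phi.
by apply/rowP => i; rewrite !mxE.
Qed.

Lemma gauge_norm0 : N 0 = 0.
Proof. by rewrite -(scale0r 0) gauge_normZ normr0 mul0r. Qed.

Lemma gauge_normN x : N (- x) = N x.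
Proof. by rewrite -scaleN1r gauge_normZ normrN1 mul1r. Qed.

Lemma gauge_norm_ge0 x : 0 <= N x.
Proof.
by have [c [l [cP ->]]] := spectral x; rewrite gauge_normE// gauge_ge0.
Qed.

Lemma gauge_norm_eq0 x : N x = 0 -> x = 0.
Proof.
have [c [l [cP ->]]] := spectral x; rewrite gauge_normE//.
move=> /(gauge_eq0 phi_gauge)/rowP l0; rewrite big1// => i _.
by have := l0 i; rewrite !mxE => ->; rewrite scale0r.
Qed.

Lemma gauge_norm_sub x y : N x - N y <= N (x - y).
Proof. by rewrite lerBlDr -{1}(subrK y x) gauge_normD. Qed.

Lemma gauge_norm_le x : N x <= gauge_bound phi * `|x|.
Proof.
have [c [l [cP ->]]] := spectral x; rewrite gauge_normE//.
by apply: gauge_le_bound => // i; rewrite mxE frame_norm_ge.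
Qed.

Lemma jaut_gauge_norm k x : jautomorphism k -> N (k x) = N x.
Proof.
move=> kP; have [c [l [cP ->]]] := spectral x.
by rewrite jaut_sum// !gauge_normE//; exact: jaut_frame.
Qed.

(** [U_a] is an isometry because [U_((U_a p)^(-1/2)) U_a U_(p^(1/2))] fixes [1]. *)
Lemma isqrt_jU (a p : V) : injective (jU a) -> jcone p -> jcone (jU a p) ->
  exists2 k, jautomorphism k &
    forall v, jU (isqrtj (jU a p)) (jU a v) = k (jU (isqrtj p) v).
Proof.
move=> ainj pcone qcone.
exists (fun v => jU (isqrtj (jU a p)) (jU a (jU (sqrtj p) v))).
  apply: jU3_automorphism => //.
  - by rewrite jU_sqrt_one// jU_isqrt.
  - exact: can_inj (fun v => sqrt_isqrtK v qcone).
  - exact: can_inj (fun v => isqrt_sqrtK v pcone).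
by move=> v; rewrite sqrt_isqrtK.
Qed.

Lemma isqrt_inj p : jcone p -> injective (jU (isqrtj p)).
Proof. by move=> pcone; exact: can_inj (fun v => sqrt_isqrtK v pcone). Qed.

Lemma sqrt_inj p : jcone p -> injective (jU (sqrtj p)).
Proof. by move=> pcone; exact: can_inj (fun v => isqrt_sqrtK v pcone). Qed.

Notation F := (finsler_norm phi).

Lemma finsler_jU (a p v : V) : injective (jU a) -> jcone p -> jcone (jU a p) ->
  F (jU a p) (jU a v) = F p v.
Proof.
move=> ainj pcone qcone; have [k kP kE] := isqrt_jU ainj pcone qcone.
by rewrite /finsler_norm kE jaut_gauge_norm.
Qed.

(** The length of the geodesic from [p] to [q]. *)
Definition geod_dist p q : R := N (jlog (jU (isqrtj p) q)).

Lemma geod_dist_jU (a p q : V) : injective (jU a) -> jcone p -> jcone (jU a p) ->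
  geod_dist (jU a p) (jU a q) = geod_dist p q.
Proof.
move=> ainj pcone qcone; have [k kP kE] := isqrt_jU ainj pcone qcone.
by rewrite /geod_dist kE /jlog -jaut_fun// jaut_gauge_norm.
Qed.

Lemma ln_le_sub1 (s : R) : 0 < s -> ln s <= s - 1.
Proof.
by move=> s0; rewrite lerBrDr addrC -{2}(lnK s0) expR_ge1Dx.
Qed.

Lemma inv1B_le (s : R) : `|s| <= 2^-1 -> (1 - s)^-1 <= 1 + s + 2 * s ^+ 2.
Proof.
move=> hs; have s2 : s <= 2^-1 by rewrite (le_trans (ler_norm s)).
have s1 : 0 < 1 - s by lra.
rewrite -div1r ler_pdivrMr//.
have : 0 <= s ^+ 2 * (1 - 2 * s) by rewrite mulr_ge0 ?sqr_ge0//; lra.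
by lra.
Qed.

(** The logarithm is compared with the first order: with [x_i = log m_i] the
    eigenvalues of [log q] and [w_i] the states of its frame, [log s <= s - 1]
    at [s = p_j / m_i] and at [s = m_i / p_j] encloses [x_i - w_i(log p)] between
    [w_i(k)] and [w_i((1 - k)^-1) - 1]. *)
Lemma gauge_norm_log_lip p q : jcone p -> jcone q ->
  let k := jU (isqrtj q) (q - p) in `|k| <= 2^-1 ->
  N (jlog q) <= N (jlog p) + N k + gauge_bound phi * (2 * `|k| ^+ 2).
Proof.
move=> pcone qcone k k_le.
have [c [m [cP qE m0]]] := spectral_jcone qcone; have [cC cprim] := cP.
have [d [t [dP pE t0]]] := spectral_jcone pcone; have [dC dprim] := dP.
pose r := jU (isqrtj q) p; pose pinv := \sum_j (t j)^-1 *: d j.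
have kr : r = jone - k by rewrite /k jUB jU_isqrt// subKr.
have wr i : jstate (c i) r = (m i)^-1 * jstate (c i) p.
  apply: jstate_uniq => //; rewrite /r qE frame_isqrt// coi_jU_idem//.
  by rewrite jstateE// scalerA exprVn sqr_sqrtr// ltW.
have wrinv i : jstate (c i) (jU (sqrtj q) pinv) = m i * jstate (c i) pinv.
  apply: jstate_uniq => //; rewrite qE frame_sqrt// coi_jU_idem//.
  by rewrite jstateE// scalerA sqr_sqrtr// ltW.
have Upinv : jU p pinv = p.
  rewrite pE /pinv coi_jU//; apply: eq_bigr => j _.
  by rewrite expr2 mulfK// gt_eqF.
have rinv_le i : jstate (c i) (jU (sqrtj q) pinv)
    <= 1 + jstate (c i) k + 2 * `|k| ^+ 2.
  have [e [s [eP kE]]] := spectral k; have [eC eprim] := eP.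
  have s_le j : `|s j| <= `|k| by rewrite kE frame_norm_ge.
  have s1 j : 1 - s j != 0.
    have := le_trans (ler_norm (s j)) (le_trans (s_le j) k_le).
    by move=> ?; rewrite gt_eqF//; lra.
  have rE : r = \sum_j (1 - s j) *: e j.
    rewrite kr [in LHS]kE -(coi_one eC) -sumrB; apply: eq_bigr => j _.
    by rewrite scalerBl scale1r.
  have -> : jU (sqrtj q) pinv = \sum_j (1 - s j)^-1 *: e j.
    have rinj : injective (jU r).
      apply: (@can_inj _ _ _ (jU (\sum_j (1 - s j)^-1 *: e j))) => v.
      rewrite rE coi_jU_comp// (_ : \sum_j _ = jone) ?jU1//.
      under eq_bigr do rewrite mulVf//.
      by rewrite (coi_const eC) scale1r.
    apply: rinj; rewrite {1}/r jU_jU// isqrt_sqrtK// Upinv -/r.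
    rewrite rE coi_jU//; apply: eq_bigr => j _.
    by rewrite expr2 mulfK.
  have -> : 1 + jstate (c i) k + 2 * `|k| ^+ 2
      = jstate (c i) (\sum_j (1 + s j + 2 * `|k| ^+ 2) *: e j).
    rewrite (_ : \sum_j _ = (1 + 2 * `|k| ^+ 2) *: jone + k).
      by rewrite (jstateD _ k (cprim i)) (jstateZ _ jone (cprim i)) jstate1//; ring.
    rewrite [X in _ = _ + X]kE -(coi_const eC) -big_split/=; apply: eq_bigr => j _.
    by rewrite -scalerDl; congr (_ *: _); ring.
  rewrite !frame_jstate//; apply: ler_sum => j _.
  rewrite ler_wpM2r ?transition_ge0// (le_trans (inv1B_le _))//.
    by rewrite (le_trans (s_le j)).
  rewrite lerD2l ler_pM2l// -[leLHS]real_normK ?num_real//.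
  by rewrite ler_pXn2r ?nnegrE.
pose u i := ln (m i) - jstate (c i) (jlog p).
have logp : jlog p = \sum_j ln (t j) *: d j by rewrite pE frame_log.
have one_d : jone = \sum_j 1 *: d j by rewrite (coi_const dC) scale1r.
have u_ge i : jstate (c i) k <= u i.
  have -> : jstate (c i) k = 1 - (m i)^-1 * jstate (c i) p.
    by rewrite -wr kr jstateB// jstate1// subKr.
  rewrite /u -subr_ge0 logp pE !frame_jstate//.
  have -> : ln (m i) - \sum_j ln (t j) * jstate (c i) (d j) -
     (1 - (m i)^-1 * (\sum_j t j * jstate (c i) (d j))) =
     \sum_j (ln (m i) - ln (t j) - 1 + (m i)^-1 * t j) * jstate (c i) (d j).
    under [in RHS]eq_bigr do rewrite mulrDl !mulrBl mul1r -mulrA.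
    by rewrite big_split/= !sumrB -!mulr_sumr transition_row//; ring.
  apply: sumr_ge0 => j _; rewrite mulr_ge0 ?transition_ge0//.
  have := @ln_le_sub1 ((m i)^-1 * t j); rewrite mulr_gt0 ?invr_gt0// => /(_ isT).
  rewrite lnM ?posrE ?invr_gt0// lnV ?posrE//; lra.
have u_le i : u i <= jstate (c i) k + 2 * `|k| ^+ 2.
  suff : u i <= m i * jstate (c i) pinv - 1.
    by move=> /le_trans; apply; rewrite -wrinv lerBlDr; have := rinv_le i; lra.
  rewrite /u -subr_ge0 logp !frame_jstate//.
  have -> : m i * (\sum_j (t j)^-1 * jstate (c i) (d j)) - 1 -
     (ln (m i) - \sum_j ln (t j) * jstate (c i) (d j)) =
     \sum_j (ln (t j) - ln (m i) - 1 + m i * (t j)^-1) * jstate (c i) (d j).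
    under [in RHS]eq_bigr do rewrite mulrDl !mulrBl mul1r -mulrA.
    by rewrite big_split/= !sumrB -!mulr_sumr transition_row//; ring.
  apply: sumr_ge0 => j _; rewrite mulr_ge0 ?transition_ge0//.
  have := @ln_le_sub1 (m i * (t j)^-1); rewrite mulr_gt0 ?invr_gt0// => /(_ isT).
  rewrite lnM ?posrE ?invr_gt0// lnV ?posrE//; lra.
rewrite qE frame_log// gauge_normE//.
have -> : \row_i ln (m i) = \row_i jstate (c i) (jlog p) + \row_i jstate (c i) k
    + \row_i (u i - jstate (c i) k).
  by apply/rowP => i; rewrite !mxE /u; ring.
rewrite (le_trans (gaugeD phi_gauge _ _))// lerD//.
  by rewrite (le_trans (gaugeD phi_gauge _ _))// lerD// gauge_norm_state.
apply: gauge_le_bound => // i; rewrite mxE ger0_norm ?subr_ge0//.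
by rewrite lerBlDl.
Qed.

(** The isometry [U_(p0^(-1/2))] moves the base point to the identity. *)
Lemma geod_dist_lip p0 p q : jcone p0 -> jcone p -> jcone q ->
  `|jU (isqrtj q) (q - p)| <= 2^-1 ->
  geod_dist p0 q <= geod_dist p0 p + F q (q - p)
    + gauge_bound phi * (2 * `|jU (isqrtj q) (q - p)| ^+ 2).
Proof.
move=> p0cone pcone qcone k_le; set a := isqrtj p0.
have qacone := jU_isqrt_cone p0cone qcone.
have pacone := jU_isqrt_cone p0cone pcone.
have [k kP kE] := isqrt_jU (isqrt_inj p0cone) qcone qacone.
have kvE : jU (isqrtj (jU a q)) (jU a q - jU a p) = k (jU (isqrtj q) (q - p)).
  by rewrite -jUB kE.
have k_le' := jaut_norm_le kP (jU (isqrtj q) (q - p)).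
apply: (le_trans (gauge_norm_log_lip pacone qacone _)); rewrite kvE.
  exact: le_trans k_le.
rewrite (jaut_gauge_norm _ kP); apply: lerD => //.
by rewrite ler_wpM2l ?gauge_bound_ge0// ler_pM2l// ler_pXn2r ?nnegrE.
Qed.

(** * Continuity of the Finsler norm and of the distance *)

Lemma jU_norm_le (x v : V) : `|jU x v| <= 3 * `|x| ^+ 2 * `|v|.
Proof.
rewrite jUE (le_trans (ler_normB _ _))// normrZ gtr0_norm//.
have h1 : `|x *j (x *j v)| <= `|x| ^+ 2 * `|v|.
  by rewrite (le_trans (normJM _ _))// expr2 -mulrA ler_wpM2l// normJM.
have h2 : `|x *j x *j v| <= `|x| ^+ 2 * `|v|.
  by rewrite (le_trans (normJM _ _))// normJ2.
by rewrite -mulrA; lra.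
Qed.

Lemma isqrt_norm_le q v (r : R) : 0 < r -> jcone q ->
  (forall e, jprimitive e -> r <= jstate e q) ->
  `|jU (isqrtj q) v| <= 3 / r * `|v|.
Proof.
move=> r0 /spectral_jcone[c [l [cP -> l0]]] rl; have [_ cprim] := cP.
rewrite (le_trans (jU_norm_le _ _))// ler_wpM2r// ler_pM2l//.
rewrite -(sqr_sqrtr (ltW r0)) -exprVn ler_pXn2r ?nnegrE ?invr_ge0 ?sqrtr_ge0//.
rewrite frame_isqrt// frame_norm_le ?invr_ge0 ?sqrtr_ge0// => i.
rewrite ger0_norm ?invr_ge0 ?sqrtr_ge0// lef_pV2 ?posrE ?sqrtr_gt0//.
by apply: ler_wsqrtr; have := rl _ (cprim i); rewrite jstate_frame.
Qed.

(** The lower bound of the states of [p] persists near [p], since states are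
    bounded by the norm. *)
Lemma isqrt_norm_near p : jcone p -> exists2 K : R, 0 < K &
  forall q v, jcone q -> `|q - p| <= K^-1 -> `|jU (isqrtj q) v| <= K * `|v|.
Proof.
move=> /jconeP[d d0 dp]; exists (6 / d); first by rewrite divr_gt0.
move=> q v qcone qp; have -> : 6 / d = 3 / (d / 2) by field; rewrite gt_eqF.
apply: isqrt_norm_le; rewrite ?divr_gt0// => e eP.
have := le_trans (jstate_norm (q - p) eP) qp; rewrite jstateB// invf_div ler_norml.
by have := dp e eP; lra.
Qed.

Lemma finsler_le q v K : `|jU (isqrtj q) v| <= K * `|v| ->
  F q v <= gauge_bound phi * K * `|v|.
Proof.
move=> h; rewrite (le_trans (gauge_norm_le _))// -mulrA.
by rewrite ler_wpM2l ?gauge_bound_ge0.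
Qed.

Lemma geod_dist_continuous p0 p (e : R) : jcone p0 -> jcone p -> 0 < e ->
  exists2 d : R, 0 < d & forall q, jcone q -> `|q - p| < d ->
    `|geod_dist p0 q - geod_dist p0 p| <= e.
Proof.
move=> p0cone pcone e0; have [K K0 Kb] := isqrt_norm_near pcone.
have gb := gauge_bound_ge0 phi_gauge; set B := gauge_bound phi in gb *.
pose C := 2 * B * K + 1; have C0 : 0 < C by rewrite /C ltr_wpDl ?mulr_ge0// ltW.
exists (Num.min (K^-1 / 2) (e / C)); first by rewrite lt_min !divr_gt0 ?invr_gt0.
move=> q qcone; rewrite lt_min => /andP[qp1 qp2].
have step x y : jcone x -> jcone y -> `|x - y| = `|q - p| -> `|y - p| <= K^-1 ->
    geod_dist p0 y - geod_dist p0 x <= e.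
  move=> xcone ycone xy yp.
  have b : `|jU (isqrtj y) (y - x)| <= K * `|y - x| by exact: Kb.
  have b2 : K * `|y - x| <= 2^-1.
    rewrite distrC xy -(@ler_pM2l _ K^-1) ?invr_gt0// mulrA mulVf ?gt_eqF// mul1r.
    exact: ltW.
  have := geod_dist_lip p0cone xcone ycone (le_trans b b2).
  have := finsler_le b; rewrite -/B.
  set k := `|jU _ _| in b *; have k0 : 0 <= k by exact: normr_ge0.
  have kk : 2 * k ^+ 2 <= K * `|y - x|.
    rewrite expr2 mulrA (le_trans _ b)// ler_piMl//.
    by have := le_trans b b2; lra.
  have Bkk := ler_wpM2l gb kk.
  have : C * `|y - x| <= e.
    by rewrite mulrC -ler_pdivlMr// distrC xy ltW.
  rewrite /C mulrDl mul1r; have := normr_ge0 (y - x).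
  by rewrite -!mulrA in Bkk *; lra.
rewrite ler_norml lerNl opprB !step// ?subrr ?normr0 ?invr_ge0 ?ltW// ?(distrC p)//.
by rewrite (lt_le_trans qp1)// ler_pdivrMr// ler_peMr ?invr_ge0 ?ltW// ltr1n.
Qed.

Lemma jU_near_one (b y : V) : `|b - jone| <= 1 ->
  `|jU b y - y| <= 5 * `|b - jone| * `|y|.
Proof.
set h := b - jone => h1; have -> : b = jone + h by rewrite subrKC.
have -> : jU (jone + h) y - y = 2 *: (h *j y) + jU h y.
  by rewrite jUDl jU1 jU2E !jmul1; lmod R.
rewrite (le_trans (ler_normD _ _))// normrZ gtr0_norm//.
have := jU_norm_le h y; have := normJM h y; have := normr_ge0 y.
have : `|h| ^+ 2 * `|y| <= `|h| * `|y|.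
  by rewrite ler_wpM2r// expr2 ler_piMl.
by lra.
Qed.

Lemma isqrt_near_one q : jcone q -> `|q - jone| <= 2^-1 ->
  `|isqrtj q - jone| <= 2 * `|q - jone|.
Proof.
move=> /spectral_jcone[c [l [cP -> l0]]]; have [cC _] := cP.
have sub1 (f : 'I_n -> R) : \sum_i f i *: c i - jone = \sum_i (f i - 1) *: c i.
  rewrite -(coi_one cC) -sumrB; apply: eq_bigr => i _.
  by rewrite scalerBl scale1r.
rewrite frame_isqrt// !sub1; set t := `|\sum_i _| => t2.
apply: (frame_norm_le cP) => [|i]; first by rewrite mulr_ge0// normr_ge0.
have := frame_norm_ge cP (fun i => l i - 1) i; rewrite -/t => li.
set s := Num.sqrt (l i); have s0 : 0 < s by rewrite sqrtr_gt0.
have ss : l i = s ^+ 2 by rewrite sqr_sqrtr// ltW.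
have s2 : 2^-1 <= s.
  have := le_trans li t2; rewrite ler_norml ss => /andP[h _].
  rewrite leNgt; apply/negP => sh; have : s ^+ 2 < 2^-1 ^+ 2.
    by rewrite ltr_pXn2r ?nnegrE// ltW.
  lra.
have -> : s^-1 - 1 = - ((l i - 1) / (s * (s + 1))).
  by rewrite ss; field; rewrite !gt_eqF//; lra.
rewrite normrN normrM normfV (gtr0_norm (_ : 0 < s * (s + 1))); last first.
  by rewrite mulr_gt0//; lra.
rewrite ler_pdivrMr; last by rewrite mulr_gt0//; lra.
rewrite (le_trans li)// -mulrA mulrCA ler_peMr ?normr_ge0// mulrA.
have : 0 <= (2 * s - 1) * (s + 1) by rewrite mulr_ge0//; lra.
by rewrite mulrBl mul1r; lra.
Qed.

Lemma finsler_continuous p w (e : R) : jcone p -> 0 < e ->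
  exists2 d : R, 0 < d & forall q v, jcone q -> `|q - p| < d -> `|v - w| < d ->
    `|F q v - F p w| <= e.
Proof.
move=> pcone e0; have [K K0 Kb] := isqrt_norm_near pcone.
have Kp v : `|jU (isqrtj p) v| <= K * `|v|.
  by apply: Kb; rewrite // subrr normr0 invr_ge0 ltW.
have gb := gauge_bound_ge0 phi_gauge; set B := gauge_bound phi in gb *.
pose C := B * (10 * K * (K * (`|w| + 1)) + K) + 1.
have K0' := ltW K0.
have A0 : 0 <= 10 * K * (K * (`|w| + 1)) by rewrite !mulr_ge0// addr_ge0.
have C0 : 0 < C by rewrite /C ltr_wpDl// mulr_ge0// addr_ge0.
exists (Num.min (Num.min 1 (K^-1 / 2)) (e / C)).
  by rewrite !lt_min ltr01 !divr_gt0 ?invr_gt0.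
move=> q v qcone; rewrite !lt_min => /andP[/andP[_ qp1] qp2] /andP[/andP[vw1 _] vw2].
set a := isqrtj p; have acone := jU_isqrt_cone pcone qcone.
have rE : jU a q - jone = jU a (q - p) by rewrite jUB jU_isqrt.
have r_le : `|jU a q - jone| <= K * `|q - p| by rewrite rE.
have r2 : K * `|q - p| <= 2^-1.
  rewrite -(@ler_pM2l _ K^-1) ?invr_gt0// mulrA mulVf ?gt_eqF// mul1r.
  exact: ltW.
have b_le := isqrt_near_one acone (le_trans r_le r2).
have b1 : `|isqrtj (jU a q) - jone| <= 1.
  by rewrite (le_trans b_le)//; have := le_trans r_le r2; lra.
have Fq : F q v = N (jU (isqrtj (jU a q)) (jU a v)).
  rewrite -(finsler_jU v (isqrt_inj pcone) qcone)//.
have v_le : `|v| <= `|w| + 1.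
  by rewrite -[v](subrK w) (le_trans (ler_normD _ _))// addrC lerD2l ltW.
have near_b := jU_near_one (jU a v) b1.
have : `|F q v - F p w| <= B * (`|jU (isqrtj (jU a q)) (jU a v) - jU a v|
     + `|jU a v - jU a w|).
  have NB x y : `|N x - N y| <= N (x - y).
    by rewrite ler_norml lerNl opprB -{1}(gauge_normN (x - y)) opprB !gauge_norm_sub.
  rewrite Fq (le_trans (NB _ _))// (le_trans (gauge_norm_le _))// ler_wpM2l//.
  have := ler_normD (jU (isqrtj (jU a q)) (jU a v) - jU a v) (jU a v - jU a w).
  by rewrite addrA subrK.
move=> /le_trans; apply.
have t1 : `|jU a v - jU a w| <= K * `|v - w| by rewrite -jUB.
have t2 : `|jU (isqrtj (jU a q)) (jU a v) - jU a v|
    <= 10 * K * (K * (`|w| + 1)) * `|q - p|.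
  have h1 : `|jU a v| <= K * (`|w| + 1).
    by rewrite (le_trans (Kp v))// ler_wpM2l// ltW.
  rewrite (le_trans near_b)//.
  have h2 : `|isqrtj (jU a q) - jone| <= 2 * (K * `|q - p|).
    by rewrite (le_trans b_le)// ler_wpM2l.
  have := ler_pM (normr_ge0 _) (normr_ge0 _) h2 h1.
  by rewrite -!mulrA; lra.
have [z [qz vz zC]] : exists z : R, [/\ `|q - p| <= z, `|v - w| <= z & C * z <= e].
  exists (e / C); rewrite (ltW qp2) (ltW vw2); split=> //.
  by rewrite mulrC divfK// gt_eqF.
have z0 : 0 <= z by rewrite (le_trans _ qz).
apply: le_trans zC; rewrite /C mulrDl mul1r.
rewrite (@le_trans _ _ (B * (10 * K * (K * (`|w| + 1)) + K) * z))//; last by lra.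
rewrite -mulrA ler_wpM2l// mulrDl lerD//.
  by rewrite (le_trans t2)// ler_wpM2l.
by rewrite (le_trans t1)// ler_wpM2l// ltW.
Qed.

(** [geod_dist_lip] with [q = g t] and [p = g s], where [q - p] is [(t - s) d]
    up to a smaller order and the quadratic term is negligible. *)
Lemma geod_dist_left_slope p0 (g : R -> V) (u v t : R) (d : V) (e : R) : jcone p0 ->
  u <= t <= v -> (forall s, s \in `[u, v] -> jcone (g s)) -> is_derive t 1 g d ->
  0 < e -> exists2 del : R, 0 < del & forall s, s \in `[u, v] -> s < t ->
    t - s < del -> geod_dist p0 (g t) - geod_dist p0 (g s)
      <= (t - s) * (F (g t) d + e).
Proof.
move=> p0cone utv gcone dg e0; have gt_cone : jcone (g t) by apply: gcone; rewrite in_itv.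
have [K K0 Kb] := isqrt_norm_near gt_cone; set q := g t in gt_cone Kb *.
have Kq x : `|jU (isqrtj q) x| <= K * `|x|.
  by apply: Kb; rewrite // subrr normr0 invr_ge0 ltW.
have gb := gauge_bound_ge0 phi_gauge; set B := gauge_bound phi in gb *.
pose e1 := e / (2 * (B * K + 1)).
have BK : 0 <= B * K by rewrite mulr_ge0// ltW.
have e1_gt0 : 0 < e1 by rewrite divr_gt0// mulr_gt0// ltr_wpDl.
have [d1 d1_gt0 hd1] := is_derive_eps dg e1_gt0.
pose C := K * (`|d| + e1).
have C0 : 0 < C by rewrite mulr_gt0// ltr_wpDl.
pose d2 := e / (4 * (B + 1) * C ^+ 2).
have B1 : 0 < B + 1 by rewrite ltr_wpDl.
have d2_gt0 : 0 < d2.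
  by apply: divr_gt0 => //; apply: mulr_gt0; [exact: mulr_gt0|exact: exprn_gt0].
exists (Num.min d1 (Num.min d2 (2 * C)^-1)).
  by rewrite !lt_min d1_gt0 d2_gt0 invr_gt0 mulr_gt0.
move=> s suv st; rewrite !lt_min => /and3P[s1 s2 s3].
set h := t - s in s1 s2 s3 *; have h0 : 0 < h by rewrite subr_gt0.
have hs : s - t = - h by rewrite opprB.
clearbody h.
have := hd1 s; rewrite hs normrN gtr0_norm// => /(_ s1) rem.
pose rho := q - g s - h *: d.
have rho_le : `|rho| <= e1 * h.
  by rewrite -normrN (_ : - rho = g s - g t - - h *: d)// /rho -/q; lmod R.
have qs : q - g s = h *: d + rho by rewrite /rho subrKC.
clearbody rho.
have k_le : `|jU (isqrtj q) (q - g s)| <= C * h.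
  rewrite (le_trans (Kq _))// /C -mulrA ler_pM2l// qs (le_trans (ler_normD _ _))//.
  by rewrite normrZ gtr0_norm// mulrDl (mulrC h) lerD.
have k2 : `|jU (isqrtj q) (q - g s)| <= 2^-1.
  have C2 : 0 < 2 * C by exact: mulr_gt0.
  rewrite (le_trans k_le)//; move: (ltW s3); rewrite -[(_)^-1]mul1r ler_pdivlMr//.
  by lra.
have := geod_dist_lip p0cone (gcone s suv) gt_cone k2; rewrite -/B.
have Fle : F q (q - g s) <= h * F q d + B * (K * (e1 * h)).
  rewrite qs /finsler_norm jUD jUZ (le_trans (gauge_normD _ _))//.
  rewrite gauge_normZ gtr0_norm// lerD2l (le_trans (gauge_norm_le _))// ler_wpM2l//.
  by rewrite (le_trans (Kq _))// ler_pM2l.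
have ksq : `|jU (isqrtj q) (q - g s)| ^+ 2 <= C ^+ 2 * h ^+ 2.
  by rewrite -exprMn ler_pXn2r ?nnegrE// mulr_ge0// ltW.
have Bksq := ler_wpM2l gb ksq.
have half1 : B * (K * (e1 * h)) <= e / 2 * h.
  have -> : e / 2 = (B * K + 1) * e1.
    by rewrite /e1; field; rewrite gt_eqF// ltr_wpDl.
  have e1h : 0 < e1 * h by exact: mulr_gt0.
  by clear - e1h; lra.
have half2 : 2 * (B * (C ^+ 2 * h ^+ 2)) <= e / 2 * h.
  have -> : e / 2 = 2 * ((B + 1) * C ^+ 2) * d2.
    by rewrite /d2; field; rewrite !gt_eqF.
  have Ch : 0 <= C ^+ 2 * h ^+ 2 by rewrite mulr_ge0 ?sqr_ge0.
  have : (B + 1) * C ^+ 2 * h * h <= (B + 1) * C ^+ 2 * h * d2.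
    rewrite ler_wpM2l ?(ltW s2)// mulr_ge0 ?(ltW h0)// mulr_ge0 ?sqr_ge0//.
    exact: ltW.
  by move: (C ^+ 2) Ch => X; clear; lra.
lra.
Qed.

(** * Growth of the distance along a path *)

Notation mu := (@lebesgue_measure R).

Definition speed (g : R -> V) t : R := F (g t) (derive1 g t).

Lemma speed_ge0 g t : 0 <= speed g t.
Proof. exact: gauge_norm_ge0. Qed.

Definition dist_growth (g : R -> V) (u v : R) : Prop :=
  forall p0 s t, jcone p0 -> u <= s -> s <= t -> t <= v ->
  ((geod_dist p0 (g t) - geod_dist p0 (g s))%:E
    <= \int[mu]_(x in `[s, t]) (speed g x)%:E)%E.

Definition measurable_speed (g : R -> V) (u v : R) : Prop :=
  measurable_fun `[u, v] (speed g).

Lemma geod_dist_path_continuous p0 (g : R -> V) (u v : R) : jcone p0 ->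
  (forall t, t \in `[u, v] -> jcone (g t)) -> {within `[u, v], continuous g} ->
  {within `[u, v], continuous (fun t => geod_dist p0 (g t))}.
Proof.
move=> p0cone gcone /within_continuous_epsP cg; apply/within_continuous_epsP.
move=> t tuv e e0; have [d d0 dP] := geod_dist_continuous p0cone (gcone t tuv) e0.
have [d' d'0 d'P] := cg t tuv (d / 2) (divr_gt0 d0 (ltr0n R 2)).
exists d' => // s suv st; apply: dP; first exact: gcone.
by rewrite (le_lt_trans (d'P s suv st))// ltr_pdivrMr// ltr_pMr// ltr1n.
Qed.

Lemma finsler_path_continuous (g d : R -> V) (u v : R) :
  (forall t, t \in `[u, v] -> jcone (g t)) -> {within `[u, v], continuous g} ->
  {within `[u, v], continuous d} ->
  {within `[u, v], continuous (fun t => F (g t) (d t))}.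
Proof.
move=> gcone /within_continuous_epsP cg /within_continuous_epsP cd.
apply/within_continuous_epsP => t tuv e e0.
have [r r0 rP] := finsler_continuous (d t) (gcone t tuv) e0.
have r2 : 0 < r / 2 by rewrite divr_gt0.
have r2r : r / 2 < r by rewrite ltr_pdivrMr// ltr_pMr// ltr1n.
have [d1 d10 d1P] := cg t tuv (r / 2) r2.
have [d2 d20 d2P] := cd t tuv (r / 2) r2.
exists (Num.min d1 d2); first by rewrite lt_min d10.
move=> s suv; rewrite lt_min => /andP[st1 st2]; apply: rP; first exact: gcone.
  exact: le_lt_trans (d1P s suv st1) r2r.
exact: le_lt_trans (d2P s suv st2) r2r.
Qed.

Lemma dist_growth_C1 (g : R -> V) (u v : R) : u < v ->
  (forall t, t \in `[u, v] -> jcone (g t)) -> {within `[u, v], continuous g} ->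
  C1_on u v g -> measurable_speed g u v /\ dist_growth g u v.
Proof.
move=> uv gcone cg [d [cd dg]]; pose h t := F (g t) (d t).
have ch : {within `[u, v], continuous h} by exact: finsler_path_continuous.
have mh : measurable_fun `[u, v] h.
  exact: subspace_continuous_measurable_fun.
have speedE t : t \in `]u, v[ -> speed g t = h t.
  move=> tuv; have dt := dg t tuv.
  by rewrite /speed /h derive1E (@derive_val _ _ _ _ _ _ _ dt).
have mspeed : measurable_fun `]u, v[ (speed g).
  apply: (eq_measurable_fun h) => [t|].
    by rewrite inE/= => tuv; rewrite speedE.
  apply: measurable_funS mh => //; exact: subset_itv_oo_cc.
split; first exact: measurable_fun_itv_cc mspeed.
move=> p0 s t p0cone us + tv; rewrite le_eqVlt => /predU1P[->|st].
  by rewrite subrr integral_ge0// => x _; rewrite lee_fin speed_ge0.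
have sub : `[s, t] `<=` `[u, v].
  move=> x /=; rewrite !in_itv/= => /andP[sx xt].
  by rewrite (le_trans us sx) (le_trans xt tv).
have subo : `]s, t[ `<=` `]u, v[.
  move=> x /=; rewrite !in_itv/= => /andP[sx xt].
  by rewrite (le_lt_trans us sx) (lt_le_trans xt tv).
rewrite (@eq_integral_itv_bounded _ s t h (speed g)).
- apply: (@le_integral_left_slope _ (fun t => geod_dist p0 (g t))) => //.
  + apply: continuous_subspaceW sub _.
    exact: geod_dist_path_continuous.
  + exact: continuous_subspaceW sub ch.
  move=> x xst e e0; have xuv := subo x xst.
  have sxt : s <= x <= t by move: xst; rewrite in_itv/= => /andP[/ltW -> /ltW ->].
  apply: (geod_dist_left_slope p0cone sxt _ (dg x xuv) e0).
  by move=> y /sub; exact: gcone.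
- by apply: measurable_funS mspeed.
- by apply: measurable_funS mh => //; exact: subset_trans subo (@subset_itv_oo_cc _ _ _ _).
- by move=> x xst; apply: speedE; exact: subo.
Qed.

Lemma dist_growth_cat (g : R -> V) (u w v : R) : u <= w -> w <= v ->
  measurable_speed g u w /\ dist_growth g u w ->
  measurable_speed g w v /\ dist_growth g w v ->
  measurable_speed g u v /\ dist_growth g u v.
Proof.
move=> uw wv [m1 h1] [m2 h2].
have mm : measurable_speed g u v by exact: measurable_fun_cat m1 m2.
split=> // p0 s t p0cone us st tv.
have [tw|wt] := leP t w; first exact: h1.
have [ws|sw] := leP w s; first exact: h2.
rewrite (@integral_cat _ _ s w t (ltW sw) (ltW wt)); last 2 first.
- apply: measurable_funS mm => // x /=; rewrite !in_itv/= => /andP[sx xt].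
  by rewrite (le_trans us sx) (le_trans xt tv).
- exact: speed_ge0.
apply: le_trans (leeD (h1 p0 s w p0cone us (ltW sw) (lexx w))
  (h2 p0 w t p0cone (lexx w) (ltW wt) tv)).
by rewrite -EFinD lee_fin; lra.
Qed.

Lemma dist_growth_path (g : R -> V) (a b : R) : jpath a b g ->
  measurable_speed g a b /\ dist_growth g a b.
Proof.
move=> [_ gcone [cg [s [sP pieces]]]].
elim: s a gcone cg sP pieces => [|w s IH] a gcone cg sP pieces.
  rewrite (itv_partition_nil sP); split.
    by rewrite /measurable_speed set_itv1; exact: measurable_fun_set1.
  move=> p0 s t p0cone bs st tb; have -> : s = t.
    by apply/eqP; rewrite eq_le st (le_trans tb).
  by rewrite subrr integral_ge0// => x _; rewrite lee_fin speed_ge0.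
have aw : a < w by case: sP => /= /andP[].
have sP' := itv_partition_cons sP.
have wb : w <= b by exact: itv_partition_le sP'.
have subl : `[a, w] `<=` `[a, b].
  by move=> x /=; rewrite !in_itv/= => /andP[-> xw]; rewrite (le_trans xw).
have subr : `[w, b] `<=` `[a, b].
  by move=> x /=; rewrite !in_itv/= => /andP[wx ->]; rewrite (le_trans (ltW aw)).
apply: (dist_growth_cat (ltW aw) wb).
  apply: dist_growth_C1 => //.
  - by move=> t /subl; exact: gcone.
  - exact: continuous_subspaceW subl cg.
  - exact: (pieces 0%N).
apply: IH => //.
- by move=> t /subr; exact: gcone.
- exact: continuous_subspaceW subr cg.
- by move=> i ilt; exact: (pieces i.+1).
Qed.

(** * Geodesics *)

Lemma jinv_eq q z : jcone q -> jU q z = q -> jinv q = z.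
Proof.
move=> qcone qz; have [c [l [cP qE l0]]] := spectral_jcone qcone.
have [cC _] := cP; have ln0 i : l i != 0 by rewrite gt_eqF.
have qinj : injective (jU q).
  apply: (@can_inj _ _ _ (jU (\sum_i (l i)^-1 *: c i))) => v.
  rewrite qE coi_jU_comp// (_ : \sum_i _ = jone) ?jU1//.
  under eq_bigr do rewrite mulVf//.
  by rewrite (coi_const cC) scale1r.
apply: qinj; rewrite qz; rewrite /jinv; case: xgetP => [y _ /is_jinv_jU//|].
by move=> /(_ (\sum_i (l i)^-1 *: c i))[]; rewrite /= qE; exact: frame_is_jinv.
Qed.

Lemma jexp_scale (c : 'I_n -> V) (l : 'I_n -> R) t : jordan_frame c ->
  jexp (t *: \sum_i l i *: c i) = \sum_i expR (t * l i) *: c i.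
Proof.
move=> cP; rewrite scaler_sumr; under eq_bigr do rewrite scalerA.
by rewrite frame_exp.
Qed.

Lemma jexp0 : jexp 0 = jone :> V.
Proof.
have [c [cC cprim]] := Vrank; have := @frame_exp c (fun=> 0) (conj cC cprim).
under eq_bigr do rewrite scale0r; rewrite big1// => ->.
by under eq_bigr do rewrite expR0; rewrite (coi_const cC) scale1r.
Qed.

Lemma jU_isqrt_exp a b x :
  jU (isqrtj (jexp (a *: x))) (jexp (b *: x)) = jexp ((b - a) *: x).
Proof.
have [c [l [cP ->]]] := spectral x; have [cC _] := cP.
rewrite !jexp_scale// frame_isqrt => [||i]; rewrite ?expR_gt0//.
rewrite coi_jU//; apply: eq_bigr => i _; congr (_ *: _).
rewrite exprVn sqr_sqrtr ?expR_ge0// -expRN -expRD; congr expR; ring.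
Qed.

Lemma geod_dist_exp a b x : geod_dist (jexp (a *: x)) (jexp (b *: x)) = `|b - a| * N x.
Proof. by rewrite /geod_dist jU_isqrt_exp jexpK gauge_normZ. Qed.

Lemma geod_dist_sqrt_exp p x : jcone p -> geod_dist p (jU (sqrtj p) (jexp x)) = N x.
Proof. by move=> pcone; rewrite /geod_dist isqrt_sqrtK// jexpK. Qed.

Lemma geod_dist_ge0 p q : 0 <= geod_dist p q.
Proof. exact: gauge_norm_ge0. Qed.

Lemma geod_distxx p : jcone p -> geod_dist p p = 0.
Proof.
move=> pcone; rewrite -{2}(jU_sqrt_one pcone) -jexp0 geod_dist_sqrt_exp//.
exact: gauge_norm0.
Qed.

Lemma sqrt_exp_log p q : jcone p -> jcone q ->
  jU (sqrtj p) (jexp (jlog (jU (isqrtj p) q))) = q.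
Proof.
by move=> pcone qcone; rewrite jlogK ?sqrt_isqrtK//; exact: jU_isqrt_cone.
Qed.

Lemma geod_distC p q : jcone p -> jcone q -> geod_dist p q = geod_dist q p.
Proof.
move=> pcone qcone; have acone := jU_isqrt_cone pcone qcone.
have ocone := jU_isqrt_cone pcone pcone.
rewrite -(geod_dist_jU q (isqrt_inj pcone) pcone ocone).
rewrite -(geod_dist_jU p (isqrt_inj pcone) qcone acone) jU_isqrt//.
rewrite -(jlogK acone) -jexp0; set y := jlog _; rewrite -(scale0r y).
have := geod_dist_exp 0 1 y; have := geod_dist_exp 1 0 y.
by rewrite !scale1r sub0r subr0 normrN => -> ->.
Qed.

Section Geodesic.
Variables p v : V.
Hypothesis pcone : jcone p.
Let x := jU (isqrtj p) v.
Notation alpha := (geodesic_path p v).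

Lemma geodesic_exp_sum : exists (c : 'I_n -> V) (l : 'I_n -> R),
  [/\ jordan_frame c, x = \sum_i l i *: c i &
      alpha = fun t => \sum_i (1 * expR (t * l i)) *: jU (sqrtj p) (c i)].
Proof.
have [c [l [cP xE]]] := spectral x; exists c, l; split=> //.
apply/funext => t; rewrite /geodesic_path -/x xE jexp_scale// jU_sum.
by apply: eq_bigr => i _; rewrite jUZ mul1r.
Qed.

Lemma geodesic_cone t : jcone (alpha t).
Proof. by apply: jU_sqrt_cone => //; exact: jexp_cone. Qed.

Lemma geodesic0 : alpha 0 = p.
Proof. by rewrite /geodesic_path scale0r jexp0 jU_sqrt_one. Qed.

(** In a frame of [x], the geodesic is a sum of exponentials whose coefficients
    are the constant vectors [U_(p^(1/2)) c_i]. *)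
Lemma geodesic_derivatives t : exists (c : 'I_n -> V) (l : 'I_n -> R),
  [/\ jordan_frame c, x = \sum_i l i *: c i,
   derivable alpha t 1 /\ derivable (derive1 alpha) t 1,
   derive1 alpha t = jU (sqrtj p) (\sum_i (l i * expR (t * l i)) *: c i) &
   derive1 (derive1 alpha) t
     = jU (sqrtj p) (\sum_i (l i ^+ 2 * expR (t * l i)) *: c i)].
Proof.
have [c [l [cP xE aE]]] := geodesic_exp_sum; exists c, l.
have d1 s := @is_derive_exp_sum R V n l (fun=> 1) (fun i => jU (sqrtj p) (c i)) s.
have d1E : derive1 alpha = fun s => \sum_i (l i * expR (s * l i)) *: jU (sqrtj p) (c i).
  apply/funext => s; rewrite derive1E aE (@derive_val _ _ _ _ _ _ _ (d1 s)).
  by apply: eq_bigr => i _; rewrite mul1r.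
have d2 s := @is_derive_exp_sum R V n l l (fun i => jU (sqrtj p) (c i)) s.
split=> //.
- split; first by rewrite aE; exact: (@ex_derive _ _ _ _ _ _ _ (d1 t)).
  by rewrite d1E; exact: (@ex_derive _ _ _ _ _ _ _ (d2 t)).
- by rewrite d1E jU_sum; apply: eq_bigr => i _; rewrite jUZ.
- rewrite d1E derive1E (@derive_val _ _ _ _ _ _ _ (d2 t)) jU_sum.
  by apply: eq_bigr => i _; rewrite jUZ expr2.
Qed.

(** With [E = exp(t x)], the inverse of [U_(p^(1/2)) E] is [U_(p^(-1/2)) E^(-1)],
    and the fundamental formula leaves an identity between functions of [x]. *)
Lemma geodesic_equation : symmetric_space_geodesic alpha.
Proof.
move=> t; have [c [l [cP xE [der1 der2] d1 d2]]] := geodesic_derivatives t.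
have [cC _] := cP; split=> //; first exact: geodesic_cone.
pose E := \sum_i expR (t * l i) *: c i; pose E' := \sum_i (expR (t * l i))^-1 *: c i.
have aE : alpha t = jU (sqrtj p) E by rewrite /geodesic_path -/x xE jexp_scale.
have EE' : jU E E' = E.
  rewrite coi_jU//; apply: eq_bigr => i _.
  by rewrite expr2 mulfK// gt_eqF// expR_gt0.
have -> : jinv (alpha t) = jU (isqrtj p) E'.
  apply: jinv_eq; first exact: geodesic_cone.
  by rewrite aE jU_jU// sqrt_isqrtK// EE'.
rewrite d2 d1 jU_jU// sqrt_isqrtK// coi_jU//; congr (jU _ _).
apply: eq_bigr => i _; congr (_ *: _); field.
by rewrite gt_eqF// expR_gt0.
Qed.

Lemma geodesic_velocity : derive1 alpha 0 = v.
Proof.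
have [c [l [cP xE _ d1 _]]] := geodesic_derivatives 0.
rewrite d1 -[RHS](sqrt_isqrtK v pcone) -/x xE; congr (jU _ _).
by apply: eq_bigr => i _; rewrite mul0r expR0 mulr1.
Qed.

Lemma geodesic_speed t : speed alpha t = N x.
Proof.
have [c [l [cP xE _ d1 _]]] := geodesic_derivatives t; have [cC _] := cP.
rewrite /speed d1 /geodesic_path -/x finsler_jU; last 3 first.
- exact: sqrt_inj.
- exact: jexp_cone.
- exact: geodesic_cone.
rewrite /finsler_norm xE jexp_scale// frame_isqrt => [||i]; rewrite ?expR_gt0//.
rewrite coi_jU//; congr (gauge_norm phi); apply: eq_bigr => i _; congr (_ *: _).
by rewrite exprVn sqr_sqrtr ?expR_ge0// mulrCA mulVf ?mulr1// gt_eqF// expR_gt0.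
Qed.

Lemma geodesic_jpath : jpath 0 1 alpha.
Proof.
have cont (f : R -> V) : (forall t, derivable f t 1) -> {within `[0, 1], continuous f}.
  by move=> df; apply: derivable_within_continuous => t _; exact: df.
split; [exact: ltr01|by move=> t _; exact: geodesic_cone|split].
  by apply: cont => t; have [c [l [_ _ []]]] := geodesic_derivatives t.
exists [:: 1]; split; first exact: itv_partition1 ltr01.
move=> [|//] _ /=; exists (derive1 alpha); split.
  by apply: cont => t; have [c [l [_ _ []]]] := geodesic_derivatives t.
move=> t _; have [c [l [_ _ [dt _] _ _]]] := geodesic_derivatives t.
by rewrite derive1E; exact: derivableP.
Qed.

Lemma geodesic_length : jlength phi 0 1 alpha = (N x)%:E.
Proof.
rewrite /jlength; under eq_integral => t _ do rewrite -/(speed alpha t) geodesic_speed.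
rewrite integral_cst//= lebesgue_measure_itv/= lte_fin ltr01 oppr0 adde0.
by rewrite mule1.
Qed.

Lemma geodesic_dist t : geod_dist p (alpha t) = `|t| * N x.
Proof. by rewrite geod_dist_sqrt_exp// gauge_normZ. Qed.

End Geodesic.

Lemma geodesic_path_log p q : jcone p -> jcone q ->
  geodesic_path p (jU (sqrtj p) (jlog (jU (isqrtj p) q))) 1 = q.
Proof.
by move=> pcone qcone; rewrite /geodesic_path scale1r isqrt_sqrtK// sqrt_exp_log.
Qed.

Lemma jpath_endpoints a b (g : R -> V) : jpath a b g -> jcone (g a) /\ jcone (g b).
Proof.
move=> [ab gcone _]; split; apply: gcone; rewrite in_itv/= lexx ?(ltW ab)//.
Qed.

Lemma jdistE p q : jcone p -> jcone q -> jdist phi p q = (geod_dist p q)%:E.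
Proof.
move=> pcone qcone; apply/eqP; rewrite eq_le; apply/andP; split.
  apply: ereal_inf_lbound => /=.
  pose v := jU (sqrtj p) (jlog (jU (isqrtj p) q)).
  exists 0, 1, (geodesic_path p v); split.
  - exact: geodesic_jpath.
  - exact: geodesic0.
  - exact: geodesic_path_log.
  - by rewrite geodesic_length// isqrt_sqrtK.
apply: le_ereal_inf_tmp => _ [a [b [g [gpath ga gb ->]]]].
have [_ growth] := dist_growth_path gpath; have [ab _ _] := gpath.
have := growth p a b pcone (lexx a) (ltW ab) (lexx b).
by rewrite ga gb geod_distxx// subr0.
Qed.

(** The growth of the distance to [p] along the geodesic from [z] to [q]. *)
Lemma geod_dist_triangle p z q : jcone p -> jcone z -> jcone q ->
  geod_dist p q <= geod_dist p z + geod_dist z q.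
Proof.
move=> pcone zcone qcone; pose v := jU (sqrtj z) (jlog (jU (isqrtj z) q)).
have [_ growth] := dist_growth_path (geodesic_jpath v zcone).
have := growth p 0 1 pcone (lexx 0) ler01 (lexx 1).
rewrite geodesic0// geodesic_path_log// -/(jlength phi 0 1 _) geodesic_length//.
rewrite lee_fin /v isqrt_sqrtK// -/(geod_dist z q); lra.
Qed.

(** * Equality in the triangle inequality *)

Lemma jexp_near0 y (e : R) : 0 < e -> exists2 d : R, 0 < d &
  forall t : R, 0 < t -> t < d -> `|jexp (t *: y) - jone - t *: y| <= e * t.
Proof.
move=> e0; have [c [l [cP yE]]] := spectral y; have [cC _] := cP.
have [d d0 dP] := is_derive_eps (@is_derive_exp_sum R V n l (fun=> 1) c 0) e0.
exists d => // t t0 td; have := dP t; rewrite subr0 gtr0_norm// => /(_ td).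
rewrite (_ : \sum_i (1 * expR (t * l i)) *: c i = jexp (t *: y)); last first.
  by rewrite yE jexp_scale//; apply: eq_bigr => i _; rewrite mul1r.
rewrite (_ : \sum_i (1 * expR (0 * l i)) *: c i = jone); last first.
  by under eq_bigr do rewrite mul0r expR0 mulr1; rewrite (coi_const cC) scale1r.
rewrite (_ : \sum_i (1 * l i * expR (0 * l i)) *: c i = y)// yE.
by apply: eq_bigr => i _; rewrite mul0r expR0 mulr1 mul1r.
Qed.

Lemma isqrt_one : isqrtj jone = jone :> V.
Proof.
have [c [cC cprim]] := Vrank; have cP : jordan_frame c by [].
rewrite -[X in isqrtj X]scale1r -(coi_const cC) frame_isqrt => [||i]; rewrite ?ltr01//.
by under eq_bigr do rewrite sqrtr1 invr1; rewrite (coi_const cC) scale1r.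
Qed.

Lemma finsler_one v : F jone v = N v.
Proof. by rewrite /finsler_norm isqrt_one jU1. Qed.

(** [geod_dist_lip] at [p0 = p], whose first order term is evaluated with the
    continuity of the Finsler norm at the identity. *)
Lemma geod_dist_exp_near0 y z (e : R) : 0 < e -> exists2 t : R, 0 < t < 1 &
  geod_dist (jexp (t *: y)) (jexp (t *: z)) <= t * (N (z - y) + e).
Proof.
move=> e0; have e2 : 0 < e / 2 by rewrite divr_gt0.
have [K K0 Kb] := isqrt_norm_near jone_cone.
have [d d0 dF] := finsler_continuous (z - y) jone_cone e2.
have gb := gauge_bound_ge0 phi_gauge; set B := gauge_bound phi in gb *.
pose e1 := Num.min 1 (d / 4); have e1_gt0 : 0 < e1 by rewrite lt_min ltr01 divr_gt0.
have [e1_le1 e1_led] : e1 <= 1 /\ e1 <= d / 4.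
  by rewrite /e1; split; rewrite ge_min lexx ?orbT.
have [dy dy0 dyP] := jexp_near0 y e1_gt0; have [dz dz0 dzP] := jexp_near0 z e1_gt0.
pose m := `|z| + 1; have m0 : 0 < m by rewrite ltr_wpDl.
pose m' := `|z - y| + 2; have m'0 : 0 < m' by rewrite ltr_wpDl.
pose Q := 2 * K * m' + 1.
have Q0 : 0 < Q by rewrite /Q ltr_wpDl// mulr_ge0 ?mulr_ge0// ltW.
pose Q' := 4 * (B * (K * m') ^+ 2 + 1).
have BK0 : 0 <= B * (K * m') ^+ 2 by rewrite mulr_ge0// sqr_ge0.
have Q'0 : 0 < Q' by rewrite /Q' mulr_gt0// ltr_wpDl.
have m'E : `|z - y| + 2 * e1 <= m' by rewrite /m'; lra.
clearbody e1 m'.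
(* one upper bound of [t] for each error term *)
pose bounds := [:: 1; dy; dz; d / m; K^-1 / m; Q^-1; e / Q'].
have bounds_gt0 : forall r : R, r \in bounds -> 0 < r.
  move=> r; rewrite !inE => /or4P[|||/or4P[]] /eqP ->//; rewrite ?divr_gt0 ?invr_gt0//.
have [t t0 tb] : exists2 t : R, 0 < t & forall r, r \in bounds -> t < r.
  elim: bounds bounds_gt0 => [|r s IH] pos; first by exists 1.
  have [t t0 tP] : exists2 t : R, 0 < t & forall r, r \in s -> t < r.
    by apply: IH => r' r's; apply: pos; rewrite inE r's orbT.
  have r0 : 0 < r by apply: pos; rewrite mem_head.
  exists (Num.min t (r / 2)); first by rewrite lt_min t0 divr_gt0.
  move=> r'; rewrite inE gt_min => /predU1P[->|/tP ->//].
  by apply/orP; right; rewrite ltr_pdivrMr// ltr_pMr// ltr1n.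
have [t1 ty tz tdm [tKm tQ tQ']] : [/\ t < 1, t < dy, t < dz, t < d / m &
    [/\ t < K^-1 / m, t < Q^-1 & t < e / Q']].
  by split; rewrite ?tb// /bounds !inE eqxx ?orbT//; split; rewrite tb// !inE eqxx ?orbT.
exists t; first by rewrite t0.
have := dyP t t0 ty; have := dzP t t0 tz.
set q := jexp (t *: z); set p := jexp (t *: y) => qE pE.
have qcone : jcone q by exact: jexp_cone.
have pcone : jcone p by exact: jexp_cone.
have q1 : `|q - jone| <= t * m.
  rewrite -(subrK (t *: z) (q - jone)) (le_trans (ler_normD _ _))//.
  rewrite normrZ (gtr0_norm t0) /m mulrDr mulr1 addrC lerD2l (le_trans qE)//.
  by rewrite ler_piMl// ltW.
have w_le : `|t^-1 *: (q - p) - (z - y)| <= 2 * e1.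
  have -> : t^-1 *: (q - p) - (z - y)
      = t^-1 *: ((q - jone - t *: z) - (p - jone - t *: y)).
    have zE x : x = t^-1 *: (t *: x) by rewrite scalerA mulVf ?gt_eqF// scale1r.
    by rewrite {1}(zE z) {1}(zE y); lmod R.
  rewrite normrZ gtr0_norm ?invr_gt0// ler_pdivrMl//.
  rewrite (le_trans (ler_normB _ _))//; lra.
have q1K : `|q - jone| <= K^-1.
  by rewrite (le_trans q1)// -ler_pdivlMr// ltW.
have q1d : `|q - jone| < d.
  by rewrite (le_lt_trans q1)// -ltr_pdivlMr.
have wd : `|t^-1 *: (q - p) - (z - y)| < d.
  by rewrite (le_lt_trans w_le)//; lra.
have qpE : q - p = t *: (t^-1 *: (q - p)) by rewrite scalerA divff ?gt_eqF// scale1r.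
have qp_le : `|q - p| <= t * m'.
  rewrite qpE normrZ gtr0_norm// ler_pM2l// (le_trans _ m'E)//.
  rewrite -[X in `|X|](subrK (z - y)) (le_trans (ler_normD _ _))//.
  by rewrite addrC lerD2l.
pose k := jU (isqrtj q) (q - p).
have k_le : `|k| <= t * (K * m').
  by rewrite (le_trans (Kb _ _ qcone q1K))// mulrCA ler_pM2l.
have k2 : `|k| <= 2^-1.
  rewrite (le_trans k_le)//; move: (ltW tQ); rewrite -[Q^-1]mul1r ler_pdivlMr// /Q.
  by lra.
have := geod_dist_lip pcone pcone qcone k2; rewrite geod_distxx// add0r -/k -/B.
move=> /le_trans; apply.
have Fle : F q (q - p) <= t * (N (z - y) + e / 2).
  rewrite qpE /finsler_norm jUZ gauge_normZ gtr0_norm// ler_pM2l//.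
  have := dF q (t^-1 *: (q - p)) qcone q1d wd; rewrite finsler_one ler_norml.
  by rewrite /finsler_norm => /andP[_]; rewrite lerBlDl.
have ksq : B * (2 * `|k| ^+ 2) <= t * (e / 2).
  have kk : `|k| ^+ 2 <= t ^+ 2 * (K * m') ^+ 2.
    have tKm0 : 0 <= t * (K * m').
      by apply: mulr_ge0; [exact: ltW|apply: mulr_ge0; exact: ltW].
    by rewrite -exprMn ler_pXn2r ?nnegrE.
  have Bkk := ler_wpM2l gb kk.
  have tQ'e : t * Q' <= e by rewrite -ler_pdivlMr// ltW.
  have := ler_wpM2l (ltW t0) tQ'e; rewrite /Q'.
  have := sqr_ge0 t.
  by move: (`|k| ^+ 2) ((K * m') ^+ 2) Bkk => X Y; lra.
by rewrite mulrDr in Fle *; lra.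
Qed.

(** ** Strict convexity *)

Hypothesis N_strict : strictly_convex_norm N.

Lemma strictly_convex_parallel x y : N x + N y <= N (x + y) -> N y *: x = N x *: y.
Proof.
have [x0|x0] := eqVneq (N x) 0.
  by rewrite (gauge_norm_eq0 x0) gauge_norm0 !scaler0 scale0r.
have [y0|y0] := eqVneq (N y) 0.
  by rewrite (gauge_norm_eq0 y0) gauge_norm0 !scaler0 scale0r.
wlog xy : x y x0 y0 / N x <= N y.
  move=> wl; have [xy|/ltW yx] := leP (N x) (N y); first exact: wl.
  by rewrite addrC (addrC x) => h; apply/esym; exact: wl.
have Nx : 0 < N x by rewrite lt_neqAle eq_sym x0 gauge_norm_ge0.
have Ny : 0 < N y by rewrite lt_neqAle eq_sym y0 gauge_norm_ge0.
pose x' := (N x)^-1 *: x; pose y' := (N y)^-1 *: y.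
have x'1 : N x' = 1 by rewrite gauge_normZ gtr0_norm ?invr_gt0// mulVf.
have y'1 : N y' = 1 by rewrite gauge_normZ gtr0_norm ?invr_gt0// mulVf.
have xE : x = N x *: x' by rewrite scalerA divff// scale1r.
have yE : y = N y *: y' by rewrite scalerA divff// scale1r.
clearbody x' y'.
move=> h; suff x'y' : x' = y'.
  transitivity (N y *: (N x *: x')); first by rewrite -xE.
  by rewrite x'y' scalerA mulrC -scalerA -yE.
apply: contrapT => /(N_strict x'1 y'1); apply/negP; rewrite -leNgt.
have : x + y = N x *: (x' + y') + (N y - N x) *: y'.
  by rewrite [in LHS]xE [in LHS]yE; lmod R.
move=> xyE; move: h; rewrite xyE => /le_trans/(_ (gauge_normD _ _)).
rewrite !gauge_normZ (gtr0_norm Nx) y'1 mulr1 ger0_norm ?subr_ge0// => h.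
rewrite -(ler_pM2l Nx); lra.
Qed.

(** With the intermediate point moved to the identity, [y] and [z] are the
    logarithms of the end points. By the triangle inequality the hypothesis
    passes to [t y] and [t z] for [0 < t < 1]; divided by [t], it tends to
    [N y + N z <= N (z - y)] as [t] tends to [0]. *)
Lemma geod_dist_exp_eq y z :
  N y + N z <= geod_dist (jexp y) (jexp z) -> N y *: z = - (N z *: y).
Proof.
move=> yz.
suff h : N z + N (- y) <= N (z - y).
  by have := strictly_convex_parallel h; rewrite gauge_normN scalerN.
rewrite gauge_normN addrC; apply/ler_addgt0Pr => /= e e0.
have [t /andP[t0 t1]] := geod_dist_exp_near0 y z e0.
set q := jexp (t *: z); set p := jexp (t *: y) => pq_le.
have ec (w : V) : jcone (jexp w) by exact: jexp_cone.
have h1 := geod_dist_triangle (ec y) (ec (t *: y)) (ec z).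
have h2 := geod_dist_triangle (ec (t *: y)) (ec (t *: z)) (ec z).
have := geod_dist_exp 1 t y; have := geod_dist_exp t 1 z; rewrite !scale1r => dz dy.
rewrite -/q -/p in h1 h2 dz dy.
rewrite dy in h1; rewrite dz in h2.
rewrite distrC in h1.
rewrite ger0_norm in h1; last by rewrite subr_ge0 ltW.
rewrite ger0_norm in h2; last by rewrite subr_ge0 ltW.
rewrite -(ler_pM2l t0); apply: le_trans pq_le; move: yz h1 h2.
move: (geod_dist (jexp y) _) (geod_dist p (jexp z)) (geod_dist p q) (N y) (N z).
by clear dz dy ec => A B C D E; lra.
Qed.

(** ** Points between the end points of a geodesic *)

(** The isometry [U_(z^(-1/2))] moves [z] to the identity, where the logarithms
    of the end points are antiparallel by [geod_dist_exp_eq]. *)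
Lemma geod_dist_between p z q : jcone p -> jcone z -> jcone q ->
  geod_dist p z + geod_dist z q <= geod_dist p q ->
  exists s : R, 0 <= s <= 1 /\
    z = jU (sqrtj p) (jexp (s *: jlog (jU (isqrtj p) q))).
Proof.
move=> pcone zcone qcone pzq; set a := isqrtj z; set x := jlog _.
have ainj : injective (jU a) by exact: isqrt_inj.
have pacone : jcone (jU a p) := jU_isqrt_cone zcone pcone.
have qacone : jcone (jU a q) := jU_isqrt_cone zcone qcone.
have az : jU a z = jone by exact: jU_isqrt.
pose Y := jlog (jU a p); pose Z := jlog (jU a q).
have pE : jU a p = jexp Y by rewrite jlogK.
have qE : jU a q = jexp Z by rewrite jlogK.
have NY : N Y = geod_dist p z by rewrite geod_distC.
have NZ : N Z = geod_dist z q by [].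
have YZ : N Y *: Z = - (N Z *: Y).
  apply: geod_dist_exp_eq; rewrite -pE -qE geod_dist_jU// NY NZ//.
have xE : jU (isqrtj p) q = jexp x by rewrite jlogK//; exact: jU_isqrt_cone.
have back s : jU (isqrtj p) z = jexp (s *: x) -> z = jU (sqrtj p) (jexp (s *: x)).
  by move=> <-; rewrite sqrt_isqrtK.
have [Z0|Z0] := eqVneq (N Z) 0.
  exists 1; rewrite ler01 lexx; split=> //; apply: back; rewrite scale1r -xE.
  congr (jU _ _); apply: ainj; rewrite az qE (gauge_norm_eq0 Z0).
  by rewrite jexp0.
have NZ0 : 0 < N Z by rewrite lt_neqAle eq_sym Z0 gauge_norm_ge0.
have NY0 : 0 <= N Y by exact: gauge_norm_ge0.
pose c := N Y / N Z; have c0 : 0 <= c by rewrite divr_ge0// ltW.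
have YE : Y = (- c) *: Z.
  rewrite /c scaleNr mulrC -scalerA YZ scalerN opprK scalerA mulVf//.
  by rewrite scale1r.
have [k kP kE] := isqrt_jU ainj pcone pacone.
have kx : k x = (1 + c) *: Z.
  have := kE q; rewrite pE YE qE xE -{2}(scale1r Z) jU_isqrt_exp opprK.
  by move=> /(congr1 jlog); rewrite jexpK /jexp jaut_fun// -/(jexp _) jexpK.
have kz : k (jU (isqrtj p) z) = jexp (c *: Z).
  by rewrite -kE az pE YE -jexp0 -(scale0r Z) jU_isqrt_exp sub0r opprK.
have c1 : 0 < 1 + c by rewrite ltr_pwDl.
exists (c / (1 + c)); split.
  by rewrite divr_ge0 ?(ltW c1)//= ler_pdivrMr// mul1r lerDr.
apply: back; apply: (jaut_inj kP); have [_ kZ _ _] := kP.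
rewrite kz /jexp jaut_fun// kZ kx scalerA divfK// gt_eqF//.
Qed.

(** The lengths of the three parts of the path are at least the distances, and
    their sum is the right hand side. *)
Lemma minimizing_dist_additive (a b : R) (g : R -> V) s t : minimizing phi a b g ->
  a <= s -> s <= t -> t <= b ->
  geod_dist (g a) (g s) + geod_dist (g s) (g t) + geod_dist (g t) (g b)
    <= geod_dist (g a) (g b).
Proof.
move=> [gpath gmin] as_ st tb; have [ab gcone _] := gpath.
have [ac bc] := jpath_endpoints gpath.
have [mg growth] := dist_growth_path gpath.
have sc : jcone (g s) by apply: gcone; rewrite in_itv/= as_ (le_trans st).
have tc : jcone (g t) by apply: gcone; rewrite in_itv/= (le_trans as_ st).
rewrite jdistE// in gmin; rewrite -lee_fin -gmin /jlength -/(speed g).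
have at_ := le_trans as_ st.
rewrite (@integral_cat _ _ a t b at_ tb mg (speed_ge0 g)).
rewrite (@integral_cat _ _ a s t as_ st); last 2 first.
- apply: measurable_funS mg => // x /=; rewrite !in_itv/= => /andP[-> xt].
  exact: le_trans tb.
- exact: speed_ge0.
have h1 := growth _ _ _ ac (lexx a) as_ (le_trans st tb).
have h2 := growth _ _ _ sc as_ st tb.
have h3 := growth _ _ _ tc at_ tb (lexx b).
rewrite !geod_distxx// !subr0 in h1 h2 h3.
by rewrite !EFinD; exact: leeD (leeD h1 h2) h3.
Qed.

(** The parameter of [g t] on the geodesic is its distance to [p] divided by the
    total length; any monotone parameter serves if this length is zero. *)
Lemma minimizing_reparametrizes (a b : R) (g : R -> V) p v : minimizing phi a b g ->
  jcone p -> g a = p -> g b = geodesic_path p v 1 ->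
  reparametrizes a b g (geodesic_path p v).
Proof.
move=> gmin pcone ga gb; have [gpath _] := gmin; have [ab gcone [cg _]] := gpath.
pose x := jU (isqrtj p) v; pose D := N x.
have additive := minimizing_dist_additive gmin; rewrite ga in additive.
have xE : jlog (jU (isqrtj p) (g b)) = x.
  by rewrite gb /geodesic_path scale1r isqrt_sqrtK// jexpK.
have Dgb : geod_dist p (g b) = D by rewrite /geod_dist xE.
have gcone' t : a <= t -> t <= b -> jcone (g t) by move=> at_ tb; apply: gcone; rewrite in_itv/= at_.
have onpath t : a <= t -> t <= b -> exists s, [/\ 0 <= s <= 1, g t = geodesic_path p v s &
    geod_dist p (g t) = s * D].
  move=> at_ tb; have tc := gcone' t at_ tb.
  have bc := gcone' b (ltW ab) (lexx b).
  have := additive t t at_ (lexx t) tb; rewrite geod_distxx// addr0.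
  move=> /(geod_dist_between pcone tc bc)[s [s01 sE]]; rewrite xE in sE.
  exists s; split=> //; rewrite sE -[X in geod_dist p X]/(geodesic_path p v s).
  by rewrite geodesic_dist// ger0_norm//; case/andP: s01.
have mono s t : a <= s -> s <= t -> t <= b -> geod_dist p (g s) <= geod_dist p (g t).
  move=> as_ st tb.
  have := additive s t as_ st tb.
  have := geod_dist_triangle pcone (gcone' t (le_trans as_ st) tb) (gcone' b (ltW ab) (lexx b)).
  have := geod_dist_ge0 (g s) (g t).
  lra.
have ba : 0 < b - a by rewrite subr_gt0.
have [D0|Dn0] := eqVneq D 0.
  have x0 : x = 0 by exact: gauge_norm_eq0.
  exists (fun t => (t - a) / (b - a)); split.
  - apply: continuous_subspaceT => t; apply: cvgMl; apply: cvgB; first exact: cvg_id.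
    exact: cvg_cst.
  - by move=> s t _ _ st; rewrite ler_pM2r ?invr_gt0// lerB.
  - by rewrite subrr mul0r.
  - by rewrite divff// gt_eqF.
  - move=> t; rewrite in_itv/= => /andP[at_ tb].
    have [s [_ -> _]] := onpath t at_ tb.
    by rewrite /geodesic_path -/x x0 !scaler0.
have D_gt0 : 0 < D by rewrite lt_neqAle eq_sym Dn0 gauge_norm_ge0.
exists (fun t => geod_dist p (g t) / D); split.
- have cd := geod_dist_path_continuous pcone gcone cg.
  by move=> t; apply: cvgMl; exact: cd.
- move=> s t; rewrite !in_itv/= => /andP[as_ _] /andP[_ tb] st.
  by rewrite ler_pM2r ?invr_gt0// mono.
- by rewrite ga geod_distxx// mul0r.
- by rewrite Dgb divff.
- move=> t; rewrite in_itv/= => /andP[at_ tb].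
  have [s [_ gtE dE]] := onpath t at_ tb.
  by rewrite dE mulfK.
Qed.

End FiniteDimensional.

Theorem theorem4p9 (R : realType) (V : jbAlgType R) (n : nat)
    (phi : 'rV[R]_n -> R)
    (Vfin : finite_dimensional V) (Vrank : jrank_is V n)
    (phi_gauge : symmetric_gauge phi) :
  (forall p v : V, jcone p ->
    let alpha := geodesic_path p v in
    [/\ symmetric_space_geodesic alpha,
        alpha 0 = p /\ derive1 alpha 0 = v,
        minimizing phi 0 1 alpha,
        jlength phi 0 1 alpha = (gauge_norm phi (jU (jpow p (- 2^-1)) v))%:E &
        (gauge_norm phi (jU (jpow p (- 2^-1)) v))%:E
          = jdist phi (alpha 0) (alpha 1)]) /\
  (strictly_convex_norm (gauge_norm phi : V -> R) ->
    forall (a b : R) (g : R -> V), minimizing phi a b g ->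
      (exists v : V, reparametrizes a b g (geodesic_path (g a) v)) /\
      (forall p v : V, jcone p ->
         g a = geodesic_path p v 0 -> g b = geodesic_path p v 1 ->
         reparametrizes a b g (geodesic_path p v))).
Proof.
split=> [p v pcone /=|N_strict a b g gmin].
  have a0 := geodesic0 Vfin Vrank v pcone.
  have len := geodesic_length Vfin Vrank phi_gauge v pcone.
  have dist : (gauge_norm phi (jU (jpow p (- 2^-1)) v))%:E
      = jdist phi (geodesic_path p v 0) (geodesic_path p v 1).
    rewrite a0 (jdistE Vfin Vrank)//; last exact: (geodesic_cone Vfin Vrank).
    by rewrite (geodesic_dist Vfin Vrank)// normr1 mul1r.
  split=> //.
  - exact: (geodesic_equation Vfin Vrank).
  - by split=> //; exact: (geodesic_velocity Vfin Vrank).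
  - by split; [exact: (geodesic_jpath Vfin Vrank)|rewrite len].
have [gpath _] := gmin; have [ac bc] := jpath_endpoints gpath.
split=> [|p v pcone].
  exists (jU (jpow (g a) 2^-1) (jlog (jU (jpow (g a) (- 2^-1)) (g b)))).
  apply: (minimizing_reparametrizes Vfin Vrank phi_gauge N_strict) => //.
  by rewrite (geodesic_path_log Vfin Vrank).
rewrite (geodesic0 Vfin Vrank)// => ga gb.
exact: (minimizing_reparametrizes Vfin Vrank phi_gauge N_strict).
Qed.
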